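(* Let $k\ge 1$ be an integer and let $\alpha\ge 2$ be real. Then the constant $J_a(2k,\alpha)$, i.e. the smallest constant $J$ such that $$E_{n}^a(f)\le J\,\omega_{2k}(f,\alpha\pi/n)$$ for all $f\in C[-1,1]$ and all integers $n>2k(2k-1)$, satisfies $$J_a(2k,\alpha)<10 .$$
   Context: For $f\in C[-1,1]$ real-valued, $E_{m}^a(f):=\inf_{p}\sup_{x\in[-1,1]}|f(x)-p(x)|$, where $p$ runs over real algebraic polynomials of degree at most $m$. The $r$-th modulus of smoothness is $$\omega_r(f,\delta):=\sup |\widehat\Delta_h^r f(x)|,\qquad \widehat\Delta_h^r f(x):=\sum_{j=0}^r(-1)^{r-j}\binom{r}{j}f(x+jh-rh/2),$$ the supremum being over all $0<h\le\delta$ and all $x$ such that $x-rh/2$ and $x+rh/2$ belong to $[-1,1]$. *)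

(* Defs.v *)
From mathcomp Require Import all_boot all_order all_algebra.
From mathcomp Require Import all_classical all_reals all_analysis.
Import Order.TTheory GRing.Theory Num.Theory.
Import numFieldNormedType.Exports.

Set Implicit Arguments.
Unset Strict Implicit.
Unset Printing Implicit Defensive.

Local Open Scope classical_set_scope.
Local Open Scope ring_scope.

(* A function f in C[-1,1] is represented by a total f : R -> R such that
   {within `[-1, 1], continuous f}. Nothing below evaluates f outside [-1,1].
   For such f the sets under the real-valued [sup] and [inf] are nonempty and
   bounded, provided 0 < delta in [omega]. *)

Definition approx_error (R : realType) (f : R -> R) (p : {poly R}) : R :=
  sup [set `|f x - p.[x]| | x in `[-1, 1]].

(* [size p <= m.+1] means that p has degree at most m. *)
Definition best_approx (R : realType) (m : nat) (f : R -> R) : R :=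
  inf [set approx_error f p | p in [set p : {poly R} | (size p <= m.+1)%N]].

Definition central_diff (R : realType) (r : nat) (h : R) (f : R -> R) (x : R)
    : R :=
  \sum_(j < r.+1)
    (-1) ^+ (r - j) * 'C(r, j)%:R * f (x + j%:R * h - r%:R * h / 2).

Definition omega (R : realType) (r : nat) (f : R -> R) (delta : R) : R :=
  sup [set y | exists h x : R,
    [/\ 0 < h <= delta,
        -1 <= x - r%:R * h / 2 <= 1,
        -1 <= x + r%:R * h / 2 <= 1
      & y = `|central_diff r h f x|]].

Definition jackson_constants (R : realType) (k : nat) (alpha : R) : set R :=
  [set J | forall f : R -> R, {within `[-1, 1], continuous f} ->
     forall n : nat, (2 * k * (2 * k - 1) < n)%N ->
       best_approx n f <= J * omega (2 * k) f (alpha * pi / n%:R)].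

(* J = J_a(2k, alpha). *)
Definition is_Ja (R : realType) (k : nat) (alpha J : R) : Prop :=
  jackson_constants k alpha J /\ lbound (jackson_constants k alpha) J.

(* Main.v *)
From HB Require Import structures.
Require Import Defs.
From mathcomp Require Import all_boot all_order all_algebra.
From mathcomp Require Import all_classical all_reals all_analysis.
From mathcomp Require Import ring lra zify.
Import Order.TTheory GRing.Theory Num.Theory.
Import numFieldNormedType.Exports.

Set Implicit Arguments.
Unset Strict Implicit.
Unset Printing Implicit Defensive.

Local Open Scope classical_set_scope.
Local Open Scope ring_scope.

(** Rescale [-1,1] to [0,N] with N = max(n/pi, 2k+1), so that unit steps are
    admissible, and write w for the modulus.  Three steps produce a polynomial.

    Whitney: on a window of 2k+1 unit cells f is compared with the derivative
    of the polynomial interpolating a primitive of f at the nodes 0, ..., 2k.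
    Averaging differences over the step bounds the error by w times variations
    of the Lagrange basis, cell by cell.  Gluing f with the two end polynomials
    at points where they agree with f extends f, up to O(w), to a function on
    the whole line whose 2k-th differences are at most B w.

    Smoothing: the 2k-th centered difference of a second primitive, divided by
    squared steps, yields u with |f - u| <= B w / C(2k,k) and u'' a combination
    of second differences of f, i.e. u'' = T D f with D the unit second
    difference and T a translation operator.  Convexity of the coefficients
    makes those of T alternate in sign, so that the norm of T is an alternating
    sum and hence small.  Iterating k times leaves T^k D^k f, which is bounded
    by the 2k-th differences.

    Jackson: the discrete Fejer-Korovkin kernel, with weights
    sin((l+1) pi/(m+2)), reproduces 1 and multiplies x by cos(pi/(m+2)); this
    gives E_m(u) <= c_m E_{m-2}(u'') with c_m close to pi^2/(2 m^2), which
    closes the iteration.  For k = 1 and n <= 4 the chord of f suffices. *)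

(** The obstacle is to keep the constant below 10 for every k, although a difference of order 2k has
    total weight 4^k. Whitney's estimate therefore keeps the factor 1 / C(2k,j) on cell j: it is the
    reciprocal of the weight that a difference gives to that node, so the errors of the extension
    enter its differences with weights adding up to O(k^2) only ([extension_const]). The smoothing
    error 1 / C(2k,k) then wins. With M the norm of T, one step of the iteration multiplies the
    remaining error by 4 M c (N/2)^2, c being the Jackson constant of the current degree; this is at
    most 3/2 for k >= 5. The final term carries 4^-k, because D^k f is bounded at once and not by k
    separate uses of the norm 4 of D. Each Jackson step lowers the degree by 2; as n > 2k(2k-1), the
    total loss is a small part of n for large k. The tightest case is k = 1, and the cells for k =
    1, 2 get constants of their own. *)

(** * Calculus *)

(* [lia] becomes very slow when the context contains facts about reals. *)
Ltac nlia := repeat match goal with H : context [Real.sort _] |- _ => clear H end; lia.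

(* [is_derive] is a type class; this alias keeps [apply] from solving
   derivative side goals by instance search with uncontrolled values. *)
Definition has_deriv (R : realType) (f : R -> R) (x a : R) : Prop :=
  is_derive x (1 : R) f a.

Section Calculus.
Variable R : realType.
Implicit Types f g F G df dg ddf : R -> R.

Lemma has_deriv_continuous f df :
  (forall x, has_deriv f x (df x)) -> continuous f.
Proof.
move=> h x; apply: differentiable_continuous; apply/derivable1_diffP.
by have [] := h x.
Qed.

Lemma has_deriv_eq f (x a b : R) : has_deriv f x a -> a = b -> has_deriv f x b.
Proof. by move=> ? <-. Qed.

Lemma has_deriv_cst (c x : R) : has_deriv (fun=> c) x 0.
Proof. exact: is_derive_cst. Qed.

Lemma has_deriv_id (x : R) : has_deriv (fun y => y) x 1.
Proof. exact: is_derive_id. Qed.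

Lemma has_derivD f g (x a b : R) : has_deriv f x a -> has_deriv g x b ->
  has_deriv (fun y => f y + g y) x (a + b).
Proof. by move=> hf hg; exact: (is_deriveD hf hg). Qed.

Lemma has_derivB f g (x a b : R) : has_deriv f x a -> has_deriv g x b ->
  has_deriv (fun y => f y - g y) x (a - b).
Proof. by move=> hf hg; exact: (is_deriveB hf hg). Qed.

Lemma has_derivN f (x a : R) : has_deriv f x a ->
  has_deriv (fun y => - f y) x (- a).
Proof. by move=> hf; exact: (is_deriveN hf). Qed.

Lemma has_derivM f g (x a b : R) : has_deriv f x a -> has_deriv g x b ->
  has_deriv (fun y => f y * g y) x (a * g x + f x * b).
Proof.
move=> hf hg; have h := is_deriveM hf hg.
rewrite (_ : a * g x + f x * b = f x *: b + g x *: a); first exact: h.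
by rewrite /GRing.scale /= addrC [g x * a]mulrC.
Qed.

Lemma has_derivZ f (c x a : R) : has_deriv f x a ->
  has_deriv (fun y => c * f y) x (c * a).
Proof. by move=> hf; exact: (is_deriveZ c hf). Qed.

Lemma has_deriv_affine f (c d x a : R) : has_deriv f (c + d * x) a ->
  has_deriv (fun y => f (c + d * y)) x (d * a).
Proof.
move=> hf.
have h : has_deriv (fun y => c + d * y) x d.
  rewrite -[X in has_deriv _ _ X]add0r -[X in has_deriv _ _ (_ + X)]mulr1.
  apply: has_derivD; first exact: has_deriv_cst.
  by apply: has_derivZ; exact: has_deriv_id.
by rewrite mulrC; exact: (@is_derive1_comp _ f (fun y => c + d * y) _ _ _ hf h).
Qed.

Lemma has_deriv_sum (I : Type) (s : seq I) (P : pred I) (h : I -> R -> R)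
    (dh : I -> R) (x : R) :
  (forall i, P i -> has_deriv (h i) x (dh i)) ->
  has_deriv (fun y => \sum_(i <- s | P i) h i y) x (\sum_(i <- s | P i) dh i).
Proof.
move=> H; elim: s => [|i s ih].
  rewrite big_nil (_ : (fun y => _) = fun=> 0); first exact: has_deriv_cst.
  by apply/funext => y; rewrite big_nil.
rewrite big_cons (_ : (fun y => _) = fun y =>
  if P i then h i y + \sum_(j <- s | P j) h j y
  else \sum_(j <- s | P j) h j y); last first.
  by apply/funext => y; rewrite big_cons.
by case: ifP => // Pi; apply: has_derivD => //; exact: H.
Qed.

Lemma has_deriv_horner (p : {poly R}) (x : R) :
  has_deriv (horner p) x p^`().[x].
Proof. exact: is_derive_poly. Qed.

(** Plays the role of monotonicity of the integral: averages over the step and total variations are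
    handled through increments of primitives. *)
Lemma derive_bound_ub f df g dg (a b : R) : a <= b ->
  (forall x, a <= x <= b -> has_deriv f x (df x)) ->
  (forall x, a <= x <= b -> has_deriv g x (dg x)) ->
  (forall x, a < x < b -> df x <= dg x) ->
  f b - f a <= g b - g a.
Proof.
rewrite le_eqVlt => /predU1P[->|ab]; first by rewrite !subrr.
move=> hf hg hle.
have hd x : a <= x <= b -> has_deriv (fun y => g y - f y) x (dg x - df x).
  by move=> hx; apply: has_derivB; [exact: hg|exact: hf].
have [||c cab] := @MVT _ (fun y => g y - f y) (fun x => dg x - df x) _ _ ab.
- by move=> x /andP[/ltW xa /ltW xb]; apply: hd; rewrite xa.
- apply: continuous_in_subspaceT => x; rewrite inE/= in_itv/= => hx.
  apply: differentiable_continuous; apply/derivable1_diffP.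
  by have [] := hd x hx.
move: cab; rewrite in_itv/= => /hle hc /= e.
have: 0 <= (dg c - df c) * (b - a) by rewrite mulr_ge0 ?subr_ge0// ltW.
by rewrite -e; lra.
Qed.

Lemma derive_bound f df g dg (a b : R) : a <= b ->
  (forall x, a <= x <= b -> has_deriv f x (df x)) ->
  (forall x, a <= x <= b -> has_deriv g x (dg x)) ->
  (forall x, a < x < b -> `|df x| <= dg x) ->
  `|f b - f a| <= g b - g a.
Proof.
move=> ab hf hg h.
have h1 : f b - f a <= g b - g a.
  apply: derive_bound_ub ab hf hg _ => x /h; apply: le_trans.
  exact: ler_norm.
have h2 : - f b - - f a <= g b - g a.
  apply: (@derive_bound_ub (fun y => - f y) (fun x => - df x) _ dg _ _ ab).
  - by move=> x hx; apply: has_derivN; exact: hf.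
  - exact: hg.
  - by move=> x /h; apply: le_trans; rewrite -normrN; exact: ler_norm.
by rewrite ler_norml; apply/andP; split; lra.
Qed.

Lemma derive_const f (a b : R) : a <= b ->
  (forall x, a <= x <= b -> has_deriv f x 0) -> f b = f a.
Proof.
move=> ab h; apply/eqP; rewrite -subr_eq0 -normr_le0.
have := @derive_bound f (fun=> 0) (fun=> 0) (fun=> 0) a b ab h.
rewrite subrr; apply => x _; first exact: has_deriv_cst.
by rewrite normr0.
Qed.

Lemma second_derive_bound f df ddf (B : R) :
  (forall x : R, 0 <= x <= 1 -> has_deriv f x (df x)) ->
  (forall x : R, 0 <= x <= 1 -> has_deriv df x (ddf x)) ->
  f 0 = 0 -> df 0 = 0 ->
  (forall x : R, 0 <= x <= 1 -> `|ddf x| <= B) ->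
  `|f 1| <= B / 2.
Proof.
move=> hf hdf f0 df0 hB.
have dB (x : R) : has_deriv (fun t => B * t) x B.
  by apply: has_deriv_eq; [exact/has_derivZ/has_deriv_id|rewrite mulr1].
have h1 (x : R) : 0 <= x <= 1 -> `|df x| <= B * x.
  move=> /andP[x0 x1].
  have := @derive_bound df ddf (fun t => B * t) (fun=> B) 0 x x0.
  rewrite df0 mulr0 !subr0; apply => // t.
  - by move=> /andP[t0 tx]; apply: hdf; rewrite t0 (le_trans tx).
  - by move=> /andP[/ltW t0 /ltW tx]; apply: hB; rewrite t0 (le_trans tx).
have := @derive_bound f df (fun t => B / 2 * (t * t)) (fun t => B * t) 0 1 ler01.
rewrite f0 subr0 !mulr0 subr0 !mulr1; apply => // t.
- move=> _; apply: has_deriv_eq.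
    by apply: has_derivZ; apply: has_derivM; exact: has_deriv_id.
  by rewrite /=; field.
- by move=> /andP[/ltW t0 /ltW tx]; apply: h1; rewrite t0.
Qed.

(** The fundamental theorem gives the derivative only to the right of the base point of the
    integral, so the base point moves with x; subtracting the value at 0 removes the dependence on
    it. *)
Lemma exists_primitive f : continuous f ->
  exists F, forall x, has_deriv F x (f x).
Proof.
move=> cf.
pose I a x := (\int[lebesgue_measure]_(t in [set` `[a, x]]) f t)%R.
have dI a x : a < x -> has_deriv (I a) x (f x).
  move=> ax.
  have [||d e] := @continuous_FTC1_closed R f a x (x + 1) _ _ ax (cf x).
  - by rewrite ltrDl.
  - apply: continuous_compact_integrable; first exact: segment_compact.
    exact: continuous_subspaceT.
  - by apply: (DeriveDef d); rewrite -derive1E.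
pose c (x : R) : R := - (`|x| + 1).
have c_lt x : (c x < x) /\ (c x < 0).
  rewrite /c; have := ler_norm (- x); rewrite normrN.
  by have := normr_ge0 x; split; lra.
exists (fun x => I (c x) x - I (c x) 0) => x0.
(* For x within 1 of [x0] the base point [c x] lies to the right of this [a], which can thus replace
   it locally. *)
pose a : R := - (`|x0| + 2).
apply: (@near_eq_is_derive _ _ _ (fun x => I a x - I a 0)).
- near=> x.
  have hx : `|x| < `|x0| + 1.
    near: x; have : x0 \in `]x0 - 1, (x0 + 1)[.
      by rewrite in_itv/= ltrDl ltrBlDr ltrDl ltr01.
    move=> /near_in_itvoo; apply: filterS => x; rewrite in_itv/= => hx.
    have : `|x - x0| < 1 by rewrite ltr_norml; lra.
    by have := lerB_dist x x0; lra.
  have hac : a < c x by rewrite /a /c; lra.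
  have [cx c0] := c_lt x.
  have D t : c x < t -> has_deriv (fun x' => I a x' - I (c x) x') t 0.
    move=> ct; apply: has_deriv_eq.
      apply: has_derivB; apply: dI; last exact: ct.
      by lra.
    by rewrite subrr.
  have [x0'|x0'] := leP 0 x.
  + have h := @derive_const (fun x' => I a x' - I (c x) x') 0 x x0' _.
    have {h} : I a x - I (c x) x = I a 0 - I (c x) 0.
      by apply: h => t ht; apply: D; lra.
    by lra.
  + have h := @derive_const (fun x' => I a x' - I (c x) x') x 0 (ltW x0') _.
    have {h} : I a 0 - I (c x) 0 = I a x - I (c x) x.
      by apply: h => t ht; apply: D; lra.
    by lra.
- apply: (@has_deriv_eq (fun x => I a x - I a 0)); last exact: subr0.
  apply: has_derivB; last exact: has_deriv_cst.
  apply: dI; rewrite /a; have := ler_norm (- x0); rewrite normrN.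
  by have := normr_ge0 x0; lra.
Unshelve. all: by end_near. Qed.

End Calculus.

(** * Finite differences and Lagrange nodes *)

Section FiniteDifferences.
Variable R : realType.
Implicit Types (F : R -> R) (p q : {poly R}).

(** The sign is that of (1 - shift)^r, so [F x] itself has coefficient 1; for even r this is the
    usual forward difference. *)
Definition fdiff (r : nat) (s : R) F (x : R) : R :=
  \sum_(i < r.+1) (-1) ^+ i * 'C(r, i)%:R * F (x + i%:R * s).

Lemma fdiff0 s F x : fdiff 0 s F x = F x.
Proof. by rewrite /fdiff big_ord1 expr0 bin0 !mul1r mul0r addr0. Qed.

Lemma fdiffS r s F x :
  fdiff r.+1 s F x = fdiff r s (fun y => F y - F (y + s)) x.
Proof.
have lf (i : nat) : bump 0 i = i.+1 by [].
rewrite /fdiff; under [RHS]eq_bigr do rewrite mulrBr.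
rewrite sumrB.
transitivity (\sum_(i < r.+2) (-1) ^+ i * 'C(r, i)%:R * F (x + i%:R * s)
  - \sum_(i < r.+1) (-1) ^+ i * 'C(r, i)%:R * F (x + i%:R * s + s)).
  rewrite [in LHS]big_ord_recl [X in _ = X - _]big_ord_recl /= !bin0 -addrA; congr (_ + _).
  rewrite -sumrB; apply: eq_bigr => i _; rewrite !lf binS natrD exprS.
  have -> : x + i.+1%:R * s = x + i%:R * s + s by rewrite -natr1; ring.
  by ring.
by rewrite big_ord_recr /= bin_small // mulr0 mul0r addr0.
Qed.

Lemma eq_fdiff r s F1 F2 x :
  (forall i, (i <= r)%N -> F1 (x + i%:R * s) = F2 (x + i%:R * s)) ->
  fdiff r s F1 x = fdiff r s F2 x.
Proof. by move=> h; apply: eq_bigr => i _; rewrite h // -ltnS. Qed.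

Lemma fdiffB r s F1 F2 x :
  fdiff r s (fun y => F1 y - F2 y) x = fdiff r s F1 x - fdiff r s F2 x.
Proof. by rewrite /fdiff -sumrB; apply: eq_bigr => i _; rewrite mulrBr. Qed.

Lemma size_poly_shiftB p (c : R) :
  (size (p - (p \Po ('X + c%:P)))%R <= (size p).-1)%N.
Proof.
have s2 : size ('X + c%:P : {poly R}) = 2%N by rewrite size_XaddC.
have ss := size_comp_poly2 p s2.
apply/leq_sizeP => j hj; rewrite coefB.
have [->|jp] := eqVneq j (size p).-1; last first.
  have hj' : (size p <= j)%N by case: (size p) hj jp => // n; lia.
  by rewrite !nth_default ?subr0 // ss.
have := @lead_coef_comp _ p ('X + c%:P) _; rewrite s2 lead_coefXaddC expr1n mulr1.
by rewrite /lead_coef ss => -> //; rewrite subrr.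
Qed.

Lemma fdiff_poly r s p x : (size p <= r)%N -> fdiff r s (horner p) x = 0.
Proof.
elim: r p x => [|r ih] p x hp.
  by rewrite fdiff0; move: hp; rewrite leqn0 size_poly_eq0 => /eqP->; rewrite horner0.
rewrite fdiffS -[RHS](ih (p - (p \Po ('X + s%:P))) x).
  by apply: eq_fdiff => i _; rewrite !hornerE horner_comp !hornerE.
by apply: leq_trans (size_poly_shiftB p s) _; move: hp; case: (size p).
Qed.

Lemma fdiff_rev r s F x : fdiff r s F x =
  (-1) ^+ r * fdiff r s (fun y => F (- y)) (- (x + r%:R * s)).
Proof.
rewrite /fdiff big_distrr /= (reindex_inj rev_ord_inj) /=.
apply: eq_bigr => i _; have hi : (i <= r)%N by rewrite -ltnS.
rewrite subSS !mulrA bin_sub // -exprD.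
have -> : (-1) ^+ (r - i) = (-1) ^+ (r + i) :> R.
  by rewrite -signr_odd -[RHS]signr_odd oddB // oddD.
by congr (_ * F _); rewrite natrB //; ring.
Qed.

Definition other_nodes (r i : nat) : seq nat := iota 0 i ++ iota i.+1 (r - i).

(** The Lagrange basis polynomial without its factor (-1)^(r-i) C(r,i). The binomial is split off
    because it cancels the 1 / C(r,i) of [avg_diff]. *)
Definition nodepoly (r i : nat) : {poly R} :=
  (r`!%:R)^-1 *: \prod_(l <- other_nodes r i) ('X - (l%:R)%:P).

Definition lagr (r i : nat) : {poly R} :=
  ((-1) ^+ (r - i) * 'C(r, i)%:R) *: nodepoly r i.

Lemma mem_other_nodes r i m : (i <= r)%N ->
  (m \in other_nodes r i) = (m <= r)%N && (m != i).
Proof. by move=> ir; rewrite mem_cat !mem_iota; lia. Qed.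

Lemma size_nodepoly r i : (i <= r)%N -> (size (nodepoly r i) <= r.+1)%N.
Proof.
move=> ir; rewrite /nodepoly (leq_trans (size_scale_leq _ _)) //.
by rewrite size_prod_XsubC size_cat !size_iota; lia.
Qed.

Lemma nodepoly_neq r i m : (i <= r)%N -> (m <= r)%N -> m != i ->
  (nodepoly r i).[m%:R] = 0.
Proof.
move=> ir mr mi; rewrite hornerZ horner_prod.
rewrite (perm_big _ (perm_to_rem (_ : m \in _))) ?mem_other_nodes ?mr //=.
by rewrite big_cons hornerXsubC subrr mul0r mulr0.
Qed.

Lemma prod_iota0_nat i : \prod_(l <- iota 0 i) (i%:R - l%:R : R) = i`!%:R.
Proof.
rewrite -[iota 0 i]/(iota 0 i) -{1}(subn0 i) -/(index_iota 0 i) big_nat_rev /= add0n.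
rewrite fact_prod big_add1 /= natr_prod !big_nat; apply: eq_bigr => l /andP[_ li].
by rewrite -natrB; [congr (_%:R); lia|lia].
Qed.

Lemma prod_iotaS_nat i n :
  \prod_(l <- iota i.+1 n) (i%:R - l%:R : R) = (-1) ^+ n * n`!%:R.
Proof.
elim: n => [|n ih]; first by rewrite big_nil expr0 mul1r.
rewrite -(addn1 n) iotaD big_cat /= ih big_seq1 addn1 factS natrM exprS.
have -> : (i%:R - (i.+1 + n)%:R : R) = - n.+1%:R.
  by rewrite -natr1 addSn -natr1 natrD; ring.
by ring.
Qed.

Lemma nodepoly_eq r i : (i <= r)%N ->
  (nodepoly r i).[i%:R] = (-1) ^+ (r - i) / 'C(r, i)%:R.
Proof.
move=> ir; rewrite hornerZ horner_prod.
under eq_bigr do rewrite hornerXsubC.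
rewrite big_cat /= prod_iota0_nat prod_iotaS_nat.
have nz n : (n`!%:R : R) != 0 by rewrite pnatr_eq0 -lt0n fact_gt0.
have cz : ('C(r, i)%:R : R) != 0 by rewrite pnatr_eq0 -lt0n bin_gt0.
have e : 'C(r, i)%:R * (i`!%:R * (r - i)`!%:R) = (r`!%:R : R).
  by rewrite -!natrM bin_fact.
rewrite -e invfM; field.
by rewrite !nz cz.
Qed.

Lemma lagr_node r i m : (i <= r)%N -> (m <= r)%N ->
  (lagr r i).[m%:R] = (m == i)%:R.
Proof.
move=> ir mr; rewrite hornerZ; have [->|mi] := eqVneq m i; last first.
  by rewrite nodepoly_neq // mulr0.
have cz : ('C(r, i)%:R : R) != 0 by rewrite pnatr_eq0 -lt0n bin_gt0.
rewrite nodepoly_eq // mulrACA divff // mulr1 -exprD addnn -mul2n exprM.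
by rewrite sqrrN !expr1n.
Qed.

Lemma lagr_interp r (p : {poly R}) : (size p <= r.+1)%N ->
  p = \sum_(i < r.+1) p.[i%:R] *: lagr r i.
Proof.
move=> sp; apply/eqP; rewrite -subr_eq0; apply/eqP.
apply: (@roots_geq_poly_eq0 _ _ [seq (i%:R : R) | i <- iota 0 r.+1]).
- apply/allP => x /mapP[m]; rewrite mem_iota => /andP[_ mr] ->.
  rewrite add0n ltnS in mr.
  rewrite /root hornerD hornerN horner_sum (bigD1 (@Ordinal r.+1 m mr)) //=.
  rewrite hornerZ lagr_node // eqxx mulr1 big1 ?addr0 ?subrr // => i im.
  have ir : (i <= r)%N by rewrite -ltnS.
  rewrite hornerZ lagr_node // (_ : (m == i) = false) ?mulr0 //.
  by apply/negbTE; rewrite eq_sym; exact: im.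
- rewrite map_inj_uniq ?iota_uniq // => m n /eqP; rewrite eqr_nat => /eqP.
  exact.
- rewrite size_map size_iota (leq_trans (size_polyD _ _)) // geq_max sp size_polyN.
  apply: (leq_trans (size_sum _ _ _)); apply/bigmax_leqP => i _.
  rewrite (leq_trans (size_scale_leq _ _)) // (leq_trans (size_scale_leq _ _)) //.
  by apply: size_nodepoly; rewrite -ltnS.
Qed.

End FiniteDifferences.

(** * Whitney's inequality *)

Section WhitneyCore.
Variables (R : realType) (r : nat) (N w : R) (e G : R -> R).
Hypothesis hG : forall x, has_deriv G x (e x).
Hypothesis hw : forall x s : R, 0 <= x -> 0 <= s <= 1 -> x + r%:R * s <= N ->
  `|fdiff r s e x| <= w.

(** Average [fdiff r t e (z - i t)] over t in [0,1]. A term m <> i becomes (G(z+m-i) - G z) / (m-i),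
    the value at m of S = (Q - Q(i)) / (X - i). Since S has degree below r, its own r-th difference
    vanishes, so these terms add up to minus the term of S at i, where S(i) = Q'(i). The average is
    therefore (-1)^i C(r,i) (e z - Q'(i)). *)
Lemma avg_diff (z : R) (i : nat) (Q : {poly R}) : (i <= r)%N ->
  (size Q <= r.+1)%N ->
  (forall m, (m <= r)%N -> Q.[m%:R] = G (z + (m%:R - i%:R))) ->
  0 <= z - i%:R -> z - i%:R + r%:R <= N ->
  `|e z - Q^`().[i%:R]| <= w / 'C(r, i)%:R.
Proof.
move=> ir sQ hQ z0 zN.
have cgt : (0 : R) < 'C(r, i)%:R by rewrite ltr0n bin_gt0.
have Qi : Q.[i%:R] = G z by rewrite hQ // subrr addr0.
(* The primitive in t, zero at 0, of t -> e (z + (m - i) t); m = i is separated because of the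
   division. *)
pose T (m : nat) (t : R) : R := if m == i then t * e z
  else (m%:R - i%:R)^-1 * (G (z + (m%:R - i%:R) * t) - G z).
pose dT (m : nat) (t : R) : R := if m == i then e z
  else e (z + (m%:R - i%:R) * t).
have hT m t : has_deriv (T m) t (dT m t).
  rewrite /T /dT; have [_|mi] := eqVneq m i.
    apply: has_deriv_eq; first by apply: has_derivM; [exact: has_deriv_id|exact: has_deriv_cst].
    by rewrite /= mul1r mulr0 addr0.
  have mi0 : (m%:R - i%:R : R) != 0 by rewrite subr_eq0 eqr_nat.
  apply: has_deriv_eq.
    apply: has_derivZ; apply: has_derivB; last exact: has_deriv_cst.
    by apply: has_deriv_affine; exact: hG.
  by rewrite subr0 mulrA mulVf // mul1r.
pose Th t := \sum_(m < r.+1) (-1) ^+ m * 'C(r, m)%:R * T m t.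
have hTh t : has_deriv Th t (fdiff r t e (z - i%:R * t)).
  apply: has_deriv_eq.
    by apply: has_deriv_sum => m _; apply: has_derivZ; exact: hT.
  apply: eq_bigr => m _; rewrite /dT; congr (_ * _); case: eqP => [->|_].
    by rewrite subrK.
  by congr e; ring.
have Th0 : Th 0 = 0.
  rewrite /Th big1 // => m _; rewrite /T; case: ifP => _.
    by rewrite mul0r mulr0.
  by rewrite mulr0 addr0 subrr !mulr0.
have b1 : `|Th 1 - Th 0| <= w * 1 - w * 0.
  apply: (@derive_bound _ Th (fun t => fdiff r t e (z - i%:R * t))
     (fun t => w * t) (fun=> w)) => [||t _|t /andP[t0 t1]].
  - exact: ler01.
  - by move=> t _.
  - by apply: has_deriv_eq; [exact/has_derivZ/has_deriv_id|rewrite mulr1].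
  - have ii : 0 <= (i%:R : R) by rewrite ler0n.
    have rr : (i%:R : R) <= r%:R by rewrite ler_nat.
    apply: hw; [nra|lra|nra].
rewrite Th0 subr0 mulr1 mulr0 subr0 in b1.
have /factor_theorem[S hS] : root (Q - Q.[i%:R]%:P) i%:R.
  by rewrite /root !hornerE subrr.
have QS m : Q.[m] = Q.[i%:R] + S.[m] * (m - i%:R).
  have := congr1 (horner^~ m) hS; rewrite hornerM hornerXsubC hornerD hornerN hornerC.
  by move=> <-; ring.
have sS : (size S <= r)%N.
  have [->|S0] := eqVneq S 0; first by rewrite size_poly0.
  have := congr1 (fun p : {poly R} => size p) hS.
  rewrite size_Mmonic ?monicXsubC // size_XsubC addn2 /= => hs.
  rewrite -ltnS -hs (leq_trans (size_polyD _ _)) // geq_max sQ size_polyN.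
  by rewrite (leq_trans (size_polyC_leq1 _)).
have dQ : Q^`().[i%:R] = S.[i%:R].
  have -> : Q = S * ('X - i%:R%:P) + Q.[i%:R]%:P by rewrite -hS subrK.
  rewrite derivD derivC addr0 derivM derivXsubC mulr1 hornerD hornerM.
  by rewrite hornerXsubC subrr mulr0 add0r.
have hSum : \sum_(m < r.+1) (-1) ^+ m * 'C(r, m)%:R * S.[m%:R] = 0.
  rewrite -[RHS](@fdiff_poly R r 1 S 0 sS); apply: eq_bigr => m _.
  by rewrite mulr1 add0r.
have ThE : Th 1 = (-1) ^+ i * 'C(r, i)%:R * (e z - S.[i%:R]).
  rewrite -[LHS]subr0 -[in LHS]hSum /Th -sumrB.
  have ir' : (i < r.+1)%N by [].
  rewrite (bigD1 (Ordinal ir')) //= big1 => [|m mi].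
    by rewrite /T eqxx mul1r addr0 mulrBr.
  have mi' : (m : nat) != i by exact: mi.
  have mr : (m <= r)%N by rewrite -ltnS.
  rewrite /T (negbTE mi') mulr1 -hQ // -Qi (QS m%:R).
  have mi0 : (m%:R - i%:R : R) != 0 by rewrite subr_eq0 eqr_nat.
  have -> (a b c : R) : a + b * c - a = b * c by ring.
  by rewrite [_^-1 * _]mulrC mulfK // subrr.
rewrite dQ ler_pdivlMr //; move: b1; rewrite ThE !normrM normrX normrN1 expr1n.
by rewrite mul1r normr_nat mulrC.
Qed.

(** The grid is slid: [Q y] interpolates G on the nodes moved by x - y, which lies in [0,1], and
    [Phi y] is (Q y)'(y). At y = x all the values of G vanish; at y = j, [avg_diff] compares [Phi]
    with e x. In the derivative of [Phi] the term (Q y)''(y) is expanded once more in the Lagrange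
    basis, so that [avg_diff] bounds each coefficient and its 1 / C(r,m) cancels against [lagr]. *)
Lemma whitney_pointwise (H : R -> R) (j : nat) (x : R) :
  (forall m, (m <= r)%N -> G m%:R = 0) ->
  (forall y, has_deriv H y (\sum_(m < r.+1) `|(nodepoly R r m)^`().[y]|)) ->
  (0 < r)%N -> r%:R + 1 <= N ->
  (j <= r)%N -> j%:R <= x <= j%:R + 1 ->
  `|e x| <= w * ('C(r, j)%:R^-1 + (H x - H j%:R)).
Proof.
move=> G0 hH r0 rN jr /andP[jx xj].
pose Q y := \sum_(m < r.+1) G (m%:R + x - y) *: lagr R r m.
have sQ y : (size (Q y) <= r.+1)%N.
  apply: (leq_trans (size_sum _ _ _)); apply/bigmax_leqP => i _.
  rewrite (leq_trans (size_scale_leq _ _)) // (leq_trans (size_scale_leq _ _)) //.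
  by apply: size_nodepoly; rewrite -ltnS.
have hQ y m : (m <= r)%N -> (Q y).[m%:R] = G (m%:R + x - y).
  move=> mr; rewrite horner_sum (bigD1 (@Ordinal r.+1 m mr)) //=.
  rewrite hornerZ lagr_node // eqxx mulr1 big1 ?addr0 // => i im.
  have ir : (i <= r)%N by rewrite -ltnS.
  rewrite hornerZ lagr_node // (_ : (m == i) = false) ?mulr0 //.
  by apply/negbTE; rewrite eq_sym; exact: im.
pose Phi y := \sum_(m < r.+1) (lagr R r m)^`().[y] * G (m%:R + x - y).
have hPhi y : has_deriv Phi y
    (\sum_(m < r.+1) (lagr R r m)^`().[y] * ((Q y)^`().[m%:R] - e (m%:R + x - y))).
  apply: has_deriv_eq.
    apply: has_deriv_sum => m _; apply: has_derivM; first exact: has_deriv_horner.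
    have -> : (fun y0 => G (m%:R + x - y0)) = (fun y0 => G (m%:R + x + (-1) * y0)).
      by apply/funext => u; rewrite mulN1r.
    by apply: has_deriv_affine; exact: hG.
  rewrite big_split /=; under [RHS]eq_bigr do rewrite mulrBr.
  rewrite sumrB; congr (_ + _); last first.
    rewrite -sumrN; apply: eq_bigr => m _.
    by rewrite !mulN1r mulrN.
  transitivity ((Q y)^`()^`()).[y].
    rewrite /Q !raddf_sum /= horner_sum; apply: eq_bigr => m _.
    by move: (lagr R r m) => L; rewrite !derivZ hornerZ mulrC.
  rewrite [in LHS](@lagr_interp R r (Q y)^`()).
    rewrite raddf_sum /= horner_sum; apply: eq_bigr => m _.
    by move: (lagr R r m) => L; rewrite derivZ hornerZ mulrC.
  have := lt_size_deriv; case: (eqVneq (Q y) 0) => [->|Q0 /(_ _ _ Q0) h].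
    by rewrite deriv0 size_poly0.
  by apply: leq_trans (sQ y); exact: ltnW.
have b1 : `|Phi x - Phi j%:R| <= w * H x - w * H j%:R.
  apply: (@derive_bound R Phi _ (fun y => w * H y) _ _ _ jx
      (fun y _ => hPhi y) (fun y _ => has_derivZ w (hH y))) => y /andP[yj yx].
  rewrite (le_trans (ler_norm_sum _ _ _)) // mulr_sumr ler_sum // => m _.
  have mr : (m <= r)%N by rewrite -ltnS.
  have cgt : (0 : R) < 'C(r, m)%:R by rewrite ltr0n bin_gt0.
  rewrite derivZ hornerZ !normrM normrX normrN1 expr1n mul1r normr_nat.
  rewrite distrC.
  have h : `|e (m%:R + x - y) - (Q y)^`().[m%:R]| <= w / 'C(r, m)%:R.
    apply: avg_diff => //.
    - by move=> m' mr'; rewrite hQ //; congr G; ring.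
    - by lra.
    - by lra.
  rewrite ler_pdivlMr // in h.
  have := ler_wpM2l (normr_ge0 (nodepoly R r m)^`().[y]) h.
  move: `|_ - _| `|_| => b a.
  by rewrite (_ : a * (b * 'C(r, m)%:R) = 'C(r, m)%:R * a * b) ?[a * w]mulrC //; ring.
have Phix : Phi x = 0.
  rewrite /Phi big1 // => m _; rewrite addrK G0 ?mulr0 //.
  by rewrite -ltnS.
have Phij : Phi j%:R = (Q j%:R)^`().[j%:R].
  rewrite /Q raddf_sum /= horner_sum; apply: eq_bigr => m _.
  by move: (lagr R r m) => L; rewrite derivZ hornerZ mulrC.
rewrite Phix sub0r normrN Phij in b1.
have h : `|e x - (Q j%:R)^`().[j%:R]| <= w / 'C(r, j)%:R.
  apply: avg_diff => //.
  - by move=> m mr; rewrite hQ //; congr G; ring.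
  - by lra.
  - by lra.
rewrite mulrDr mulrBr.
have := ler_normD (e x - (Q j%:R)^`().[j%:R]) (Q j%:R)^`().[j%:R].
by rewrite subrK; lra.
Qed.

End WhitneyCore.

(** * Variation of the Lagrange basis on a unit cell *)

Section Variation.
Variable R : realType.

(** The sign condition on [dq] makes q rise to its maximum and fall afterwards, so the variation is
    twice the maximum minus the two end values. *)
Lemma unimodal_variation (q dq V : R -> R) (a b m : R) : a <= b ->
  (forall x, has_deriv q x (dq x)) ->
  (forall x, has_deriv V x `|dq x|) ->
  (forall u v, a < u -> u < v -> v < b -> dq u < 0 -> dq v <= 0) ->
  (forall x, a <= x <= b -> q x <= m) ->
  V b - V a <= 2 * m - q a - q b.
Proof.
move=> ab hq hV hs hm.
have cq : continuous q by exact: has_deriv_continuous hq.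
have [c cab cmax] := EVT_max ab (continuous_subspaceT cq).
rewrite in_itv /= in cab; case/andP: (cab) => ac cb.
have max0 u : a < u < b -> q c <= q u -> dq u = 0.
  move=> /andP[au ub] cu.
  have umax : is_derive u (1 : R) q 0.
    apply: (@derive1_at_max _ q a b u ab).
    - by move=> t _; have [] := hq t.
    - by rewrite in_itv /= au.
    - move=> t; rewrite in_itv /= => /andP[ta tb].
      by apply: le_trans cu; apply: cmax; rewrite in_itv /= !ltW.
  by have := hq u; rewrite /has_deriv => -[_ <-]; case: umax.
have up u : a < u -> u < c -> 0 <= dq u.
  move=> au uc; rewrite leNgt; apply/negP => du.
  have h1 : q c - q u <= 0 - 0.
    apply: (@derive_bound_ub _ q dq (fun=> 0) (fun=> 0)) => [|x _|x _|x /andP[ux xc]].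
    - exact: ltW.
    - exact: hq.
    - exact: has_deriv_cst.
    - by apply: (hs u x) => //; exact: lt_le_trans cb.
  have ub := lt_le_trans uc cb.
  by move: du; rewrite max0 ?ltxx // ?au //; lra.
have dn u : c < u -> u < b -> dq u <= 0.
  move=> cu ub; rewrite leNgt; apply/negP => du.
  have h1 : 0 - 0 <= q u - q c.
    apply: (@derive_bound_ub _ (fun=> 0) (fun=> 0) q dq) => [|x _|x _|x /andP[ux xc]].
    - exact: ltW.
    - exact: has_deriv_cst.
    - exact: hq.
    - rewrite leNgt; apply/negP => dx.
      have := hs x u (le_lt_trans ac ux) xc ub dx.
      by rewrite leNgt du.
  have au := le_lt_trans ac cu.
  by move: du; rewrite max0 ?ltxx // ?au //; lra.
have V1 : V c - V a <= q c - q a.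
  apply: (derive_bound_ub ac (fun x _ => hV x) (fun x _ => hq x)) => x /andP[ax xc].
  by rewrite ger0_norm // up.
have V2 : V b - V c <= - q b - - q c.
  apply: (derive_bound_ub cb (fun x _ => hV x) (fun x _ => has_derivN (hq x))) => x /andP[ax xc].
  by rewrite ler0_norm // dn.
by have := hm c cab; lra.
Qed.

Lemma deriv_prod_XsubC (s : seq R) (u : R) : u \notin s ->
  (\prod_(l <- s) ('X - l%:P))^`().[u] =
  (\prod_(l <- s) ('X - l%:P)).[u] * \sum_(l <- s) (u - l)^-1.
Proof.
elim: s => [|l s ih]; first by rewrite !big_nil derivC hornerC mulr0.
rewrite in_cons negb_or => /andP[ul us].
have ul0 : u - l != 0 by rewrite subr_eq0.
rewrite !big_cons derivM derivXsubC mul1r hornerD !hornerM ih // !hornerXsubC.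
by field.
Qed.

Lemma deriv2_prod_XsubC (s : seq R) (u : R) : u \notin s ->
  (\prod_(l <- s) ('X - l%:P))^`()^`().[u] =
  (\prod_(l <- s) ('X - l%:P)).[u] *
    ((\sum_(l <- s) (u - l)^-1) ^+ 2 - \sum_(l <- s) (u - l)^-1 ^+ 2).
Proof.
elim: s => [|l s ih].
  by rewrite !big_nil derivC deriv0 horner0 expr0n subrr mulr0.
rewrite in_cons negb_or => /andP[ul us].
have ul0 : u - l != 0 by rewrite subr_eq0.
rewrite !big_cons derivM derivXsubC mul1r derivD derivM derivXsubC mul1r.
rewrite !hornerD !hornerM ih // hornerXsubC deriv_prod_XsubC //.
by field.
Qed.

Lemma horner_prod_sign (s : seq R) (a b : R) :
  all (fun l => (l <= a) || (b <= l)) s ->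
  exists sg : bool, forall u, a <= u <= b ->
    0 <= (-1) ^+ sg * (\prod_(l <- s) ('X - l%:P)).[u].
Proof.
elim: s => [_|l s ih /= /andP[hl hs]].
  by exists false => u _; rewrite big_nil hornerC expr0 mulr1.
have [sg hsg] := ih hs.
exists (sg (+) (b <= l)%R) => u /andP[au ub].
have h := hsg u; rewrite au ub in h; have {}h := h isT.
rewrite big_cons hornerM hornerXsubC signr_addb.
move: (horner _ u) h => P h.
rewrite (_ : _ * _ = (-1) ^+ (b <= l)%R * (u - l) * ((-1) ^+ sg * P)); last by ring.
rewrite mulr_ge0 //; case: (leP b l) hl => /= bl hl.
  by rewrite expr1 mulN1r; lra.
by rewrite expr0 mul1r; rewrite orbF in hl; lra.
Qed.

Definition abs_node (r i : nat) (u : R) : R := `|(nodepoly R r i).[u]|.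

Lemma nodepoly_prod r i : nodepoly R r i = (r`!%:R)^-1 *:
  \prod_(l <- [seq (l%:R : R) | l <- other_nodes r i]) ('X - l%:P).
Proof. by rewrite /nodepoly big_map. Qed.

Lemma other_nodes_cell r i j :
  all (fun l => (l <= j%:R) || ((j%:R + 1 : R) <= l))
    [seq (l%:R : R) | l <- other_nodes r i].
Proof.
apply/allP => _ /mapP[l _ ->]; rewrite ler_nat natr1 ler_nat.
by case: leqP.
Qed.

Lemma notin_cell (s : seq R) (a b u : R) : a < u < b ->
  all (fun l => (l <= a) || (b <= l)) s -> u \notin s.
Proof. by move=> ub /allP h; apply/negP => /h; lra. Qed.

(** Within a cell no factor changes sign, and the logarithmic derivative, a sum of terms 1 / (x -
    l), is decreasing; hence the absolute value of the node polynomial is unimodal there. *)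
Lemma node_variation r i j (V : R -> R) (m : R) : (i <= r)%N ->
  (forall x, has_deriv V x `|(nodepoly R r i)^`().[x]|) ->
  (forall x : R, j%:R <= x <= j%:R + 1 -> abs_node r i x <= m) ->
  V (j%:R + 1) - V j%:R <= 2 * m - abs_node r i j%:R - abs_node r i (j%:R + 1).
Proof.
move=> ir hV hm.
have jj1 : (j%:R : R) < j%:R + 1 by rewrite ltrDl.
have hall := other_nodes_cell r i j.
have npE := nodepoly_prod r i.
set s := [seq (l%:R : R) | l <- other_nodes r i] in hall npE.
have [sg hsg] := horner_prod_sign hall.
have fgt : (0 : R) < (r`!%:R)^-1 by rewrite invr_gt0 ltr0n fact_gt0.
pose q u := (-1) ^+ sg * (nodepoly R r i).[u].
pose dq u := (-1) ^+ sg * (nodepoly R r i)^`().[u].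
have q_ge0 u : j%:R <= u <= j%:R + 1 -> 0 <= q u.
  move=> hu; rewrite /q npE hornerZ mulrCA.
  by rewrite mulr_ge0 ?(ltW fgt) // hsg.
have qE u : j%:R <= u <= j%:R + 1 -> q u = abs_node r i u.
  move=> hu; rewrite -[q u]ger0_norm ?q_ge0 // /q normrM normrX normrN1 expr1n.
  by rewrite mul1r.
rewrite -!qE ?lexx ?(ltW jj1) //.
apply: (@unimodal_variation q dq) => //.
- exact: ltW.
- by move=> x; apply: has_derivZ; exact: has_deriv_horner.
- move=> x; rewrite /dq normrM normrX normrN1 expr1n mul1r; exact: hV.
- move=> u v ju uv vj.
  have dqE x : j%:R < x < j%:R + 1 -> dq x = q x * \sum_(l <- s) (x - l)^-1.
    move=> hx; rewrite /dq /q npE derivZ !hornerZ deriv_prod_XsubC ?(notin_cell hx hall) //.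
    by ring.
  have uI : j%:R < u < j%:R + 1 by rewrite ju (lt_trans uv).
  have vI : j%:R < v < j%:R + 1 by rewrite vj (lt_trans ju).
  rewrite !dqE // => du.
  have qu : 0 <= q u by apply: q_ge0; lra.
  have qv : 0 <= q v by apply: q_ge0; lra.
  have hu : \sum_(l <- s) (u - l)^-1 < 0.
    by rewrite ltNge; apply/negP => h; move: du; rewrite ltNge mulr_ge0.
  rewrite mulr_ge0_le0 //; apply: le_trans (ltW hu).
  rewrite big_seq [leRHS]big_seq; apply: ler_sum => l ls.
  have /orP[hl|hl] := allP hall l ls.
  + by rewrite lef_pV2 ?posrE; lra.
  + rewrite -lerN2 -!invrN !opprB lef_pV2 ?posrE; lra.
- by move=> x hx; rewrite qE // hm.
Qed.

Lemma absnode_node r i j : (i <= r)%N -> (j <= r)%N ->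
  abs_node r i j%:R = (i == j)%:R / 'C(r, j)%:R.
Proof.
move=> ir jr; rewrite /abs_node; have [->|ij] := eqVneq i j.
  by rewrite nodepoly_eq // normrM normrX normrN1 expr1n normfV normr_nat.
by rewrite nodepoly_neq ?normr0 ?mul0r // eq_sym.
Qed.

(** The two subtracted terms are end values: at the node j only the polynomial of index j survives,
    at j + 1 only that of index j + 1. *)
Lemma cell_variation r j (H : R -> R) (m : nat -> R) : (j < r)%N ->
  (forall y, has_deriv H y (\sum_(i < r.+1) `|(nodepoly R r i)^`().[y]|)) ->
  (forall i (x : R), (i <= r)%N -> j%:R <= x <= j%:R + 1 ->
    'C(r, j)%:R * abs_node r i x <= m i) ->
  'C(r, j)%:R * (H (j%:R + 1) - H j%:R) <=
    2 * (\sum_(i < r.+1) m i) - 1 - 'C(r, j)%:R / 'C(r, j.+1)%:R.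
Proof.
move=> jr hH hm.
have : forall i, exists V, forall x, has_deriv V x `|(nodepoly R r i)^`().[x]|.
  move=> i; apply: exists_primitive => x.
  exact: (continuous_comp (@continuous_horner R _ x) (@norm_continuous R R _)).
move=> /choice[V hV].
have jj1 : (j%:R : R) <= j%:R + 1 by rewrite lerDl.
have cgt : (0 : R) < 'C(r, j)%:R by rewrite ltr0n bin_gt0 ltnW.
have e1 : H (j%:R + 1) - H j%:R <=
    \sum_(i < r.+1) V i (j%:R + 1) - \sum_(i < r.+1) V i j%:R.
  apply: (@derive_bound_ub R H _ (fun y => \sum_(i < r.+1) V i y)
    (fun y => \sum_(i < r.+1) `|(nodepoly R r i)^`().[y]|) _ _ jj1
    (fun x _ => hH x)) => [x _|x _]; last exact: lexx.
  by apply: has_deriv_sum => i _; exact: hV.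
rewrite (le_trans (ler_wpM2l (ltW cgt) e1)) // -sumrB mulr_sumr.
have key (i : 'I_r.+1) : 'C(r, j)%:R * (V i (j%:R + 1) - V i j%:R) <=
    2 * m i - (i == j :> nat)%:R - 'C(r, j)%:R / 'C(r, j.+1)%:R * (i == j.+1 :> nat)%:R.
  have ir : (i <= r)%N by rewrite -ltnS.
  have hb (x : R) : j%:R <= x <= j%:R + 1 -> abs_node r i x <= m i / 'C(r, j)%:R.
    by move=> hx; rewrite ler_pdivlMr // mulrC hm.
  have := node_variation ir (hV i) hb.
  rewrite natr1 !absnode_node // ?(ltnW jr) // => /(ler_wpM2l (ltW cgt)).
  move=> /le_trans; apply; rewrite le_eqVlt; apply/orP; left; apply/eqP.
  by field; rewrite !pnatr_eq0 -!lt0n !bin_gt0 jr (ltnW jr).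
apply: (le_trans (ler_sum _ (fun i _ => key i))).
rewrite !sumrB -!mulr_sumr.
have ind a : (a <= r)%N -> \sum_(i < r.+1) (i == a :> nat)%:R = 1 :> R.
  move=> ar; rewrite (bigD1 (@Ordinal r.+1 a ar)) //= eqxx big1 ?addr0 // => i ia.
  by rewrite (_ : (i == a :> nat) = false) //; apply/negbTE; exact: ia.
by rewrite !ind ?(ltnW jr) // mulr1.
Qed.

(** At x = j + f the product of all |x - l|, l <= r, is f j! (r-j)! times these two factors:
    [up_factor j] collects the nodes left of j, [down_factor (r - j)] those right of j. *)
Definition up_factor (j : nat) (f : R) : R := \prod_(l < j) (1 + f / l.+1%:R).
Definition down_factor (n : nat) (f : R) : R := \prod_(l < n) (1 - f / l.+1%:R).

Lemma absnode_cell r i j (f : R) : (i <= r)%N -> (j < r)%N -> 0 <= f <= 1 ->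
  'C(r, j)%:R * abs_node r i (j%:R + f) * `|j%:R + f - i%:R| =
  f * up_factor j f * down_factor (r - j) f.
Proof.
move=> ir jr /andP[f0 f1].
have nz n : (n`!%:R : R) != 0 by rewrite pnatr_eq0 -lt0n fact_gt0.
have e : 'C(r, j)%:R * (j`!%:R * (r - j)`!%:R) = (r`!%:R : R).
  by rewrite -!natrM bin_fact // ltnW.
have h1 : abs_node r i (j%:R + f) * `|j%:R + f - i%:R| =
    (r`!%:R)^-1 * `|\prod_(l <- iota 0 r.+1) (j%:R + f - l%:R)|.
  rewrite /abs_node -normrM hornerZ horner_prod -mulrA normrM ger0_norm; last first.
    by rewrite invr_ge0 ler0n.
  congr (_ * `|_|); under eq_bigr do rewrite hornerXsubC.
  rewrite mulrC; have -> : iota 0 r.+1 = iota 0 i ++ i :: iota i.+1 (r - i).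
    rewrite -[i :: _]/(iota i (r - i).+1) -iotaD; congr iota; lia.
  by rewrite !big_cat /= big_cons; ring.
rewrite -mulrA h1.
have -> : iota 0 r.+1 = iota 0 j.+1 ++ iota j.+1 (r - j).
  by rewrite -iotaD; congr iota; lia.
rewrite big_cat normrM /=.
have e1 : `|\prod_(l <- iota 0 j.+1) (j%:R + f - l%:R)| = j`!%:R * (f * up_factor j f).
  rewrite ger0_norm; last first.
    rewrite big_seq prodr_ge0 // => l; rewrite mem_iota add0n ltnS => /andP[_ lj].
    by have : (l%:R : R) <= j%:R by [rewrite ler_nat]; lra.
  transitivity (\prod_(l < j.+1) (l%:R + f)).
    rewrite -[iota 0 j.+1]/(index_iota 0 j.+1) big_nat_rev /= big_mkord.
    apply: eq_bigr => l _; have lj : (l <= j)%N by rewrite -ltnS.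
    by rewrite add0n subSS natrB //; ring.
  rewrite big_ord_recl add0r mulrCA; congr (_ * _).
  rewrite fact_prod big_add1 /= big_mkord natr_prod /up_factor -big_split /=.
  apply: eq_bigr => l _; have l0 : l.+1%:R != 0 :> R by rewrite pnatr_eq0.
  by rewrite /bump leq0n add1n mulrDr mulr1 mulrCA divff // mulr1.
have e2 : `|\prod_(l <- iota j.+1 (r - j)) (j%:R + f - l%:R)| = (r - j)`!%:R * down_factor (r - j) f.
  move: (r - j)%N => n; rewrite fact_prod big_add1 /= big_mkord natr_prod /down_factor -big_split /=.
  rewrite -{1}[j.+1]addn0 iotaDl big_map -{1}(subn0 n) -/(index_iota 0 n) big_mkord.
  rewrite normr_prod; apply: eq_bigr => l _.
  rewrite ler0_norm; last first.
    by rewrite addSn -natr1 natrD; have := ler0n R l; lra.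
  rewrite mulrBr mulr1 mulrCA divff ?pnatr_eq0 // mulr1 addSn -!natr1 natrD.
  by ring.
by rewrite e1 e2 -e; field; rewrite !nz pnatr_eq0 -lt0n bin_gt0 ltnW.
Qed.

End Variation.

(** * Reflection of the nodes, and the first cell *)

Section CellBounds.
Variable R : realType.
Local Notation abs_node := (@abs_node R).
Local Notation up_factor := (@up_factor R).
Local Notation down_factor := (@down_factor R).

Lemma uniq_other_nodes r i : (i <= r)%N -> uniq (other_nodes r i).
Proof.
move=> ir; rewrite cat_uniq !iota_uniq /= andbT.
by apply/hasPn => l; rewrite !mem_iota; lia.
Qed.

Lemma nodepoly_rev r m : (m <= r)%N ->
  nodepoly R r m \Po (r%:R%:P - 'X) = (-1) ^+ r *: nodepoly R r (r - m).
Proof.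
move=> mr; rewrite /nodepoly linearZ /= scalerA mulrC -scalerA; congr (_ *: _).
rewrite rmorph_prod /=.
have pe : perm_eq (other_nodes r m) [seq (r - l)%N | l <- other_nodes r (r - m)].
  apply: uniq_perm; first exact: uniq_other_nodes.
    rewrite map_inj_in_uniq; first by apply: uniq_other_nodes; lia.
    by move=> x y; rewrite !mem_other_nodes ?leq_subr //; lia.
  move=> l; rewrite mem_other_nodes //; apply/idP/mapP => [/andP[lr lm]|[y]].
    by exists (r - l)%N; [rewrite mem_other_nodes; lia|lia].
  by rewrite mem_other_nodes ?leq_subr //; lia.
rewrite (perm_big _ pe) big_map /=.
have sz : size (other_nodes r (r - m)) = r.
  by rewrite size_cat !size_iota; lia.
have hs : all (fun l => l <= r)%N (other_nodes r (r - m)).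
  by apply/allP => l; rewrite mem_other_nodes ?leq_subr // => /andP[].
have -> : (-1) ^+ r = (-1) ^+ size (other_nodes r (r - m)) :> R by rewrite sz.
elim: (other_nodes r (r - m)) hs => [|l s ih] /=.
  by rewrite !big_nil expr0 scale1r.
move=> /andP[lr hs]; rewrite !big_cons ih //.
have -> : ('X - (r - l)%:R%:P) \Po (r%:R%:P - 'X) = - ('X - l%:R%:P) :> {poly R}.
  rewrite comp_polyB comp_polyX comp_polyC natrB // polyCB; ring.
by rewrite exprS mulN1r scaleNr mulNr scalerAr.
Qed.

Lemma deriv_reflect (p q : {poly R}) (c s y : R) :
  p \Po (c%:P - 'X) = s *: q -> - p^`().[c - y] = s * q^`().[y].
Proof.
move=> /(congr1 (fun p => p^`().[y])).
rewrite deriv_comp derivB derivC derivX sub0r mulrN1 hornerN horner_comp.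
by rewrite derivZ hornerZ !hornerE.
Qed.

(** The reflection y -> r - y permutes the node polynomials up to sign, which reduces the right half
    of the cells to the left half. *)
Lemma cell_sym r j (H : R -> R) : (j < r)%N ->
  (forall y, has_deriv H y (\sum_(i < r.+1) `|(nodepoly R r i)^`().[y]|)) ->
  H (j%:R + 1) - H j%:R = H ((r - j.+1)%:R + 1) - H (r - j.+1)%:R.
Proof.
move=> jr hH.
pose S (y : R) := \sum_(i < r.+1) `|(nodepoly R r i)^`().[y]|.
have SE y : S (r%:R - y) = S y.
  rewrite /S (reindex_inj rev_ord_inj) /=; apply: eq_bigr => i _.
  have ir : (i <= r)%N by rewrite -ltnS.
  rewrite subSS.
  have := congr1 (fun x => `|x|) (deriv_reflect y (nodepoly_rev (leq_subr i r))).
  by rewrite normrN normrM normrX normrN1 expr1n mul1r subKn.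
have jj1 : (j%:R : R) <= j%:R + 1 by rewrite lerDl.
have hS : forall y, has_deriv H y (S y) by exact: hH.
have hD : forall y, has_deriv (fun y => H y + H (r%:R + (-1) * y)) y 0.
  move=> y; apply: has_deriv_eq.
    by apply: has_derivD; [exact: hS|apply: has_deriv_affine; exact: hS].
  by rewrite !mulN1r SE subrr.
have := derive_const jj1 (fun y _ => hD y).
have -> : (r - j.+1)%:R = r%:R - j%:R - 1 :> R.
  by rewrite natrB // -natr1; ring.
by rewrite subrK !mulN1r opprD addrA; lra.
Qed.

(* For j = 0 and 0 < u < 1, with p = nodepoly r 0 and A = sum 1/(l-u), the
   terms i > 0 satisfy |q_i'| <= |p| (1 + u (A - 1/(i-u))) / (i-u), and these
   sum up to the derivative of the polynomial 3 p - u p' up to sign. *)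
Lemma first_cell_variation r (H : R -> R) : (0 < r)%N ->
  (forall y, has_deriv H y (\sum_(i < r.+1) `|(nodepoly R r i)^`().[y]|)) ->
  H 1 - H 0 <= 3.
Proof.
move=> r0 hH.
pose s := [seq (l%:R : R) | l <- iota 1 r].
have sall : all (fun l => (l <= 0) || ((1 : R) <= l)) s.
  by apply/allP => x /mapP[l]; rewrite mem_iota => /andP[l1 _] ->; rewrite ler1n l1 orbT.
have [sg hsg] := horner_prod_sign sall.
set P := \prod_(l <- s) ('X - l%:P) in hsg.
pose c : R := (r`!%:R)^-1.
have c0 : 0 < c by rewrite invr_gt0 ltr0n fact_gt0.
pose K u := (-1) ^+ sg * c * (u * P^`().[u] - 3 * P.[u]).
have hK u : has_deriv K u ((-1) ^+ sg * c * (u * P^`()^`().[u] - 2 * P^`().[u])).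
  apply: has_deriv_eq.
    apply: has_derivZ; apply: has_derivB.
      by apply: has_derivM; [exact: has_deriv_id|exact: has_deriv_horner].
    by apply: has_derivZ; exact: has_deriv_horner.
  by rewrite /=; ring.
have : H 1 - H 0 <= K 1 - K 0.
  apply: (derive_bound_ub ler01 (fun x _ => hH x) (fun x _ => hK x)) => u /andP[u0 u1].
  have us : u \notin s by apply: (notin_cell _ sall); rewrite u0.
  have Pu : 0 <= (-1) ^+ sg * P.[u] by apply: hsg; rewrite !ltW.
  rewrite deriv2_prod_XsubC // deriv_prod_XsubC // -/P.
  pose b (i : 'I_r) : R := (i.+1%:R - u)^-1.
  have iu (i : 'I_r) : 0 < i.+1%:R - u.
    by have := ler0n R i; rewrite -natr1; lra.
  have b0 i : 0 < b i by rewrite invr_gt0.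
  have sumE (g : R -> R) : \sum_(l <- s) g l = \sum_(i < r) g i.+1%:R.
    rewrite big_map (_ : iota 1 r = index_iota 1 r.+1); last by rewrite /index_iota subn1.
    by rewrite big_add1 /= big_mkord.
  have bN (i : 'I_r) : (u - i.+1%:R)^-1 = - b i by rewrite /b -invrN opprB.
  have AE : \sum_(l <- s) (u - l)^-1 = - \sum_i b i.
    by rewrite sumE -sumrN; apply: eq_bigr => i _; rewrite bN.
  have A2E : \sum_(l <- s) (u - l)^-1 ^+ 2 = \sum_i b i ^+ 2.
    by rewrite sumE; apply: eq_bigr => i _; rewrite bN sqrrN.
  rewrite AE A2E sqrrN; set A := \sum_i b i.
  have A0 : 0 <= A by apply: sumr_ge0 => i _; exact: ltW.
  have cP : 0 <= c * ((-1) ^+ sg * P.[u]) by rewrite mulr_ge0 // ltW.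
  have cPn : `|c * P.[u]| = c * ((-1) ^+ sg * P.[u]).
    rewrite -[RHS]ger0_norm // !normrM normrX normrN1 expr1n mul1r.
    by [].
  rewrite big_ord_recl.
  have -> : (nodepoly R r (@ord0 r))^`().[u] = c * P.[u] * - A.
    have -> : nodepoly R r (@ord0 r) = c *: P.
      by rewrite nodepoly_prod /other_nodes /= subn0.
    by rewrite derivZ hornerZ deriv_prod_XsubC // -/P AE mulrA.
  rewrite normrM normrN cPn (ger0_norm A0).
  have key (i : 'I_r) : `|(nodepoly R r (lift ord0 i))^`().[u]| <=
      c * ((-1) ^+ sg * P.[u]) * (b i + u * (b i * A - b i ^+ 2)).
    rewrite (_ : (lift ord0 i : nat) = i.+1) // nodepoly_prod -/c.
    have hall := other_nodes_cell R r i.+1 0; rewrite add0r in hall.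
    set t := [seq _ | l <- _] in hall *.
    have ut : u \notin t by apply: (notin_cell _ hall); rewrite u0.
    rewrite derivZ hornerZ deriv_prod_XsubC //.
    have perm : perm_eq (i.+1%:R :: t) (0 :: s).
      rewrite /t /s (_ : 0 = 0%:R) // -!map_cons; apply: perm_map.
      apply: uniq_perm.
      - by rewrite cons_uniq uniq_other_nodes // mem_other_nodes // eqxx andbF.
      - by rewrite /= iota_uniq mem_iota.
      - by move=> l; rewrite in_cons mem_other_nodes // in_cons mem_iota; have := ltn_ord i; nlia.
    have prodE : (\prod_(l <- t) ('X - l%:P)).[u] = - (u * b i * P.[u]).
      have := congr1 (fun p => p.[u]) (perm_big _ perm : \prod_(l <- _) ('X - l%:P) = _).
      rewrite !big_cons !hornerM !hornerXsubC subr0 -/P => h.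
      have iu0 : u - i.+1%:R != 0 by rewrite -oppr_eq0 opprB gt_eqF.
      apply: (mulfI iu0); rewrite h /b; field.
      by rewrite nat1r gt_eqF.
    have sumE' : \sum_(l <- t) (u - l)^-1 = u^-1 - A + b i.
      have := perm_big _ perm : \sum_(l <- _) (u - l)^-1 = _.
      rewrite !big_cons AE bN subr0 -/A /= => h.
      apply: (addrI (- b i)); rewrite h.
      by ring.
    rewrite prodE sumE'.
    have u00 : u != 0 by rewrite gt_eqF.
    have -> : c * (- (u * b i * P.[u]) * (u^-1 - A + b i)) =
      (c * P.[u]) * (- (b i + u * b i * - (A - b i))) by field.
    rewrite normrM cPn normrN; apply: ler_wpM2l => //.
    have bA : b i <= A by rewrite /A (bigD1 i) //= lerDl sumr_ge0 // => l _; exact: ltW.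
    rewrite (le_trans (ler_normD _ _)) // (ger0_norm (ltW (b0 i))).
    rewrite normrM normrN (ger0_norm (mulr_ge0 (ltW u0) (ltW (b0 i)))).
    by rewrite ger0_norm ?subr_ge0 //; lra.
  apply: (le_trans (lerD (lexx _) (ler_sum _ (fun i _ => key i)))).
  rewrite -mulr_sumr big_split /= -mulr_sumr sumrB -mulr_suml -/A.
  set X := \sum_i b i ^+ 2; rewrite le_eqVlt; apply/orP; left; apply/eqP.
  by ring.
(* Only the end values of K matter now: P vanishes at 1, its normalised value at 0 is 1 and yields
   the 3, and the remaining term with P'(1) is nonpositive. *)
move/le_trans; apply; rewrite /K.
have P1 : P.[1] = 0.
  rewrite /P /s; case: (r) r0 => // r' _.
  by rewrite /= big_cons hornerM hornerXsubC subrr mul0r.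
have P0 : c * ((-1) ^+ sg * P.[0]) = 1.
  have P0' : 0 <= (-1) ^+ sg * P.[0] by apply: hsg; rewrite lexx ler01.
  rewrite -(ger0_norm (mulr_ge0 (ltW c0) P0')) !normrM normrX normrN1 expr1n mul1r.
  rewrite -normrM.
  have -> : c * P.[0] = (nodepoly R r 0).[0%:R].
    by rewrite nodepoly_prod /other_nodes /= subn0 hornerZ.
  by rewrite nodepoly_eq // bin0 divr1 normrX normrN1 expr1n.
have dP1 : 0 <= - ((-1) ^+ sg * P^`().[1]).
  have [r' rE] : exists r', r = r'.+1 by case: (r) r0 => // r'; exists r'.
  pose t := [seq (l%:R : R) | l <- iota 2 r'].
  have tall : all (fun l => (l <= 0) || ((1 : R) <= l)) t.
    apply/allP => x /mapP[l]; rewrite mem_iota => /andP[l1 _] ->.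
    by rewrite ler1n (ltn_trans _ l1) ?orbT.
  have PE : P = ('X - 1%:P) * \prod_(l <- t) ('X - l%:P).
    by rewrite /P /s rE /= big_cons.
  have [sg' hsg'] := horner_prod_sign tall.
  have h1 := hsg' 1; rewrite ler01 lexx in h1; have {}h1 := h1 isT.
  have h0 := hsg' 0; rewrite ler01 lexx in h0; have {}h0 := h0 isT.
  move: P0 h0 h1; rewrite PE derivM derivXsubC mul1r hornerD !hornerM !hornerXsubC.
  move: (horner _ 0) (horner _ 1) => Q0 Q1; rewrite subrr mul0r addr0 sub0r.
  by case: (sg) (sg') => [] [] /=; rewrite ?expr0 ?expr1 => *; nra.
rewrite P1; move: P0; rewrite !(mulr0, mul0r, sub0r, subr0, mul1r).
have := mulr_ge0 (ltW c0) dP1.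
by move: (horner _ _) (horner _ _) => x y; nra.
Qed.

End CellBounds.

(** * Numerical bounds on a general cell of the left half *)

Section CellNumbers.
Variable R : realType.
Local Notation absnode := (@abs_node R).
Local Notation upfac := (@up_factor R).
Local Notation downfac := (@down_factor R).

Lemma upfacS j f : upfac j.+1 f = upfac j f * (1 + f / j.+1%:R).
Proof. by rewrite /up_factor big_ord_recr. Qed.

Lemma downfacS n f : downfac n.+1 f = downfac n f * (1 - f / n.+1%:R).
Proof. by rewrite /down_factor big_ord_recr. Qed.

Lemma div_succ_itv (f : R) n : 0 <= f <= 1 -> 0 <= f / n.+1%:R <= 1.
Proof.
move=> /andP[f0 f1]; rewrite divr_ge0 // ler_pdivrMr ?ltr0n // mul1r.
by rewrite (le_trans f1) // ler1n.
Qed.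

Lemma upfac_ge0 j f : 0 <= f <= 1 -> 0 <= upfac j f.
Proof.
move=> hf; elim: j => [|j ih]; first by rewrite /up_factor big_ord0.
by rewrite upfacS mulr_ge0 // addr_ge0 //; have /andP[] := div_succ_itv j hf.
Qed.

Lemma downfac_ge0 n f : 0 <= f <= 1 -> 0 <= downfac n f.
Proof.
move=> hf; elim: n => [|n ih]; first by rewrite /down_factor big_ord0.
by rewrite downfacS mulr_ge0 // subr_ge0; have /andP[] := div_succ_itv n hf.
Qed.

Lemma downfac_le n m f : 0 <= f <= 1 -> (n <= m)%N -> downfac m f <= downfac n f.
Proof.
move=> hf /subnK <-; elim: (m - n)%N => // d ih.
rewrite addSn downfacS (le_trans _ ih) // -[leRHS]mulr1.
by rewrite ler_wpM2l ?downfac_ge0 // lerBlDr lerDl; have /andP[] := div_succ_itv (d + n) hf.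
Qed.

(** Without the surplus factors of [downfac] the product is that of the 1 - f^2 / l^2, of which only
    l = 1 is kept. *)
Lemma updown_le j n f : 0 <= f <= 1 -> (0 < j <= n)%N ->
  upfac j f * downfac n f <= 1 - f ^+ 2.
Proof.
move=> hf /andP[j0 jn].
apply: (@le_trans _ _ (upfac j f * downfac j f)).
  by rewrite ler_wpM2l ?upfac_ge0 // downfac_le.
case: j j0 {jn} => // j _; elim: j => [|j ih].
  rewrite upfacS downfacS /up_factor /down_factor !big_ord0 !mul1r divr1.
  by rewrite le_eqVlt; apply/orP; left; apply/eqP; ring.
rewrite upfacS downfacS (le_trans _ ih) //.
have h0 : 0 <= upfac j.+1 f * downfac j.+1 f.
  by rewrite mulr_ge0 ?upfac_ge0 ?downfac_ge0.
have := div_succ_itv j.+1 hf; move: (f / j.+2%:R) h0.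
move: (upfac _ _) (downfac _ _) => a b x h0 hx.
have -> : a * (1 + x) * (b * (1 - x)) = a * b * (1 - x ^+ 2) by ring.
by rewrite ler_piMr //; nra.
Qed.

(* The product of [(1 + f/l) (1 - f/(l+1)) = 1 + x/(l(l+1))], [x = f(1-f)],
   telescopes against [1 - x (1 - 1/(l+1))]. *)
Lemma updownS_le j n f : 0 <= f <= 1 -> (j < n)%N ->
  f * upfac j f * downfac n f <= 1 - f.
Proof.
move=> hf jn; have /andP[f0 f1] := hf.
pose x := f * (1 - f).
have x0 : 0 <= x by rewrite /x; nra.
apply: (@le_trans _ _ (f * (upfac j f * downfac j.+1 f))).
  by rewrite mulrA ler_wpM2l ?downfac_le // mulr_ge0 ?upfac_ge0.
have main : upfac j f * downfac j.+1 f * (1 - x * (1 - j.+1%:R^-1)) <= 1 - f.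
  elim: j {jn} => [|j ih].
    rewrite downfacS /up_factor /down_factor !big_ord0 !invr1 le_eqVlt.
    by apply/orP; left; apply/eqP; ring.
  have j1 : j.+1%:R != 0 :> R by rewrite pnatr_eq0.
  have j2 : j.+2%:R != 0 :> R by rewrite pnatr_eq0.
  have -> : upfac j.+1 f * downfac j.+2 f * (1 - x * (1 - j.+2%:R^-1)) =
    upfac j f * downfac j.+1 f *
      ((1 + x * (j.+1%:R^-1 - j.+2%:R^-1)) * (1 - x * (1 - j.+2%:R^-1))).
    rewrite upfacS (downfacS j.+1) /x.
    move: (upfac _ _) (downfac _ _) j1 j2 => a b; rewrite -[j.+2%:R]natr1.
    by move: j.+1%:R => y y0 y1; field; rewrite y0 y1.
  apply: le_trans ih; rewrite ler_wpM2l //.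
    by rewrite mulr_ge0 ?upfac_ge0 ?downfac_ge0.
  have y1 : 0 <= (j.+1%:R^-1 : R) <= 1.
    by rewrite invr_ge0 ler0n /= invf_le1 ?ltr0n // ler1n.
  have y2 : 0 <= (j.+2%:R^-1 : R) <= j.+1%:R^-1.
    by rewrite invr_ge0 ler0n /= lef_pV2 ?posrE ?ltr0n // ler_nat.
  move: (j.+1%:R^-1) (j.+2%:R^-1) y1 y2 => y z y1 y2.
  have : 0 <= x * (y - z) * (x * (1 - z)).
    by rewrite !mulr_ge0 //; lra.
  nra.
apply: le_trans main.
have D0 : 0 <= upfac j f * downfac j.+1 f.
  by rewrite mulr_ge0 ?upfac_ge0 ?downfac_ge0.
rewrite mulrC ler_wpM2l //.
have : 0 <= x * j.+1%:R^-1 by rewrite mulr_ge0 // invr_ge0.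
have : 0 <= (1 - f) ^+ 2 by rewrite sqr_ge0.
by move: (j.+1%:R^-1) => y; rewrite /x; nra.
Qed.

Lemma bin_ratio r j : (j < r)%N ->
  ('C(r, j)%:R / 'C(r, j.+1)%:R : R) = j.+1%:R / (r - j)%:R.
Proof.
move=> jr; apply/eqP; rewrite eqr_div ?pnatr_eq0 -?lt0n ?subn_gt0 ?bin_gt0 //.
by rewrite -!natrM eqr_nat [(j.+1 * _)%N]mulnC [('C(r, j) * _)%N]mulnC -mul_bin_left mulnC.
Qed.

Lemma absnode_le r i j (f m d : R) : (i <= r)%N -> (j < r)%N -> 0 <= f <= 1 ->
  0 < d -> d <= `|j%:R + f - i%:R| -> f * upfac j f * downfac (r - j) f <= m * d ->
  'C(r, j)%:R * absnode r i (j%:R + f) <= m.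
Proof.
move=> ir jr hf d0 hd hm; rewrite -(ler_pM2r d0); apply: le_trans hm.
rewrite -(absnode_cell ir jr hf); apply: ler_wpM2l => //.
by rewrite mulr_ge0 ?ler0n // normr_ge0.
Qed.

(** Bounds for C(r,j) times the node polynomial i on cell j. Away from the two ends of the cell they
    majorise f (1 - f^2) / d, where the distance d to node i is 1 + f for i = j - 1, 2 - f for i = j
    + 2, and at least 2 otherwise. *)
Definition node_bound (j i : nat) : R :=
  if i == j then 1 else if i == j.+1 then 1 else if i.+1 == j then 1 / 4
  else if i == j.+2 then 3 / 10 else 1 / 5.

Lemma absnode_self_le r j f : (j < r - j)%N -> 0 <= f <= 1 ->
  'C(r, j)%:R * absnode r j (j%:R + f) <= 1.
Proof.
move=> jr hf; have /andP[f0 f1] := hf.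
have jr' : (j < r)%N by lia.
have [->|fn0] := eqVneq f 0.
  rewrite addr0 absnode_node ?(ltnW jr') // eqxx mul1r divff // pnatr_eq0.
  by rewrite -lt0n bin_gt0 ltnW.
have fp : 0 < f by rewrite lt_def fn0.
apply: (@absnode_le _ _ _ _ _ f) => //; first exact: ltnW.
  by rewrite addrAC subrr add0r ger0_norm.
rewrite mul1r -mulrA ler_piMr //.
case: j jr {jr'} => [|j] jr.
  rewrite /up_factor big_ord0 mul1r (le_trans (downfac_le hf (leq0n _))) //.
  by rewrite /down_factor big_ord0.
by rewrite (le_trans (updown_le hf _)) //; [lia|nra].
Qed.

Lemma absnode_next_le r j f : (j < r - j)%N -> 0 <= f <= 1 ->
  'C(r, j)%:R * absnode r j.+1 (j%:R + f) <= 1.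
Proof.
move=> jr hf; have /andP[f0 f1] := hf.
have jr' : (j < r)%N by lia.
have [->|fn1] := eqVneq f 1.
  rewrite natr1 absnode_node // eqxx mul1r bin_ratio //.
  by rewrite ler_pdivrMr ?ltr0n ?subn_gt0 // mul1r ler_nat.
have fp : 0 < 1 - f by rewrite subr_gt0 lt_neqAle fn1.
apply: (@absnode_le _ _ _ _ _ (1 - f)) => //.
  by rewrite -natr1 ler_normr; apply/orP; right; lra.
by rewrite mul1r updownS_le.
Qed.

Lemma absnode_generic r j i f : (0 < j)%N -> (j < r - j)%N -> (i <= r)%N ->
  0 <= f <= 1 -> 'C(r, j)%:R * absnode r i (j%:R + f) <= node_bound j i.
Proof.
move=> j0 jr ir hf; have /andP[f0 f1] := hf.
have jr' : (j < r)%N by lia.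
rewrite /node_bound; case: eqP => [->|ij]; first exact: absnode_self_le.
case: eqP => [->|ij1]; first exact: absnode_next_le.
have pf : f * upfac j f * downfac (r - j) f <= f * (1 - f ^+ 2).
  by rewrite -mulrA ler_wpM2l // updown_le //; lia.
case: eqP => [e|ij2].
  apply: (@absnode_le _ _ _ _ _ (1 + f)) => //; first by lra.
    by rewrite -e -natr1 ler_normr; apply/orP; left; lra.
  apply: (le_trans pf).
  have -> : f * (1 - f ^+ 2) = f * (1 - f) * (1 + f) by ring.
  rewrite ler_wpM2r //; first by lra.
  have h := sqr_ge0 (f - 1 / 2).
  have e1 : (f - 1 / 2) ^+ 2 = 1 / 4 - f * (1 - f) by field.
  by rewrite e1 subr_ge0 in h.
case: eqP => [e|ij3].
  apply: (@absnode_le _ _ _ _ _ (2 - f)) => //; first by lra.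
    by rewrite e -!natr1 ler_normr; apply/orP; right; lra.
  apply: (le_trans pf).
  (* States that f^3 lies above its tangent at 2/3, close to the maximiser of the quotient; the
     tangent at 4/7, close to 1 / sqrt 3, serves the same purpose below. *)
  have h : 0 <= (f - 2 / 3) ^+ 2 * (f + 4 / 3) by rewrite mulr_ge0 ?sqr_ge0 //; lra.
  have e1 : (f - 2 / 3) ^+ 2 * (f + 4 / 3) = f * f * f - 4 / 3 * f + 16 / 27 by field.
  have e2 : f * (1 - f ^+ 2) = f - f * f * f by ring.
  by rewrite e2; rewrite e1 in h; lra.
apply: (@absnode_le _ _ _ _ _ 2) => //.
  rewrite ler_normr; apply/orP.
  have [ltij|leij] := ltnP i j.
    have : (i.+2%:R : R) <= j%:R by rewrite ler_nat; lia.
    by rewrite -!natr1 => h; left; lra.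
  have : (j.+3%:R : R) <= i%:R by rewrite ler_nat; lia.
  by rewrite -!natr1 => h; right; lra.
apply: (le_trans pf).
have h : 0 <= (f - 4 / 7) ^+ 2 * (f + 8 / 7) by rewrite mulr_ge0 ?sqr_ge0 //; lra.
have e1 : (f - 4 / 7) ^+ 2 * (f + 8 / 7) = f * f * f - 48 / 49 * f + 128 / 343 by field.
have e2 : f * (1 - f ^+ 2) = f - f * f * f by ring.
by rewrite e2; rewrite e1 in h; lra.
Qed.

Lemma sum_node_bound r j : (0 < j)%N -> (j < r - j)%N ->
  \sum_(i < r.+1) node_bound j i = (r + 1)%:R / 5 + 7 / 4.
Proof.
move=> j0 jr.
have ind a : (a <= r)%N -> \sum_(i < r.+1) (i == a :> nat)%:R = 1 :> R.
  move=> ar; rewrite (bigD1 (@Ordinal r.+1 a ar)) //= eqxx big1 ?addr0 // => i ia.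
  by rewrite (_ : (i == a :> nat) = false) //; apply/negbTE; exact: ia.
have e (i : nat) : node_bound j i = 1 / 5 + 4 / 5 * (i == j)%:R + 4 / 5 * (i == j.+1)%:R
   + 1 / 20 * (i == j.-1)%:R + 1 / 10 * (i == j.+2)%:R.
  rewrite /node_bound; case: (i =P j) => h1; case: (i =P j.+1) => h2;
    case: (i.+1 =P j) => h3; case: (i =P j.+2) => h4; case: (i =P j.-1) => h5;
    try (by exfalso; lia); by rewrite ?mulr1 ?mulr0; lra.
under eq_bigr do rewrite e.
rewrite !big_split /= -!mulr_sumr !ind; try lia.
by rewrite sumr_const card_ord -mulr_natl addn1; lra.
Qed.

Lemma generic_cell_variation r j (H : R -> R) : (0 < j)%N -> (j < r - j)%N ->
  (forall y, has_deriv H y (\sum_(i < r.+1) `|(nodepoly R r i)^`().[y]|)) ->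
  'C(r, j)%:R * (H (j%:R + 1) - H j%:R) <= 2 / 5 * r%:R + 29 / 10.
Proof.
move=> j0 jr hH; have jr' : (j < r)%N by lia.
have := @cell_variation R r j H (node_bound j) jr' hH.
rewrite sum_node_bound // => h.
have {}h := h _; apply: (le_trans (h _)).
  move=> i x ir hx; have := @absnode_generic r j i (x - j%:R) j0 jr ir.
  by rewrite [j%:R + _]addrC subrK; apply; lra.
have : 0 <= 'C(r, j)%:R / 'C(r, j.+1)%:R :> R by rewrite divr_ge0.
by rewrite natrD; lra.
Qed.

End CellNumbers.

(** * Sharper cell constants for k = 1 and k = 2 *)

Section SmallCells.
Variable R : realType.
Local Notation absnode := (@abs_node R).

Lemma absnodeE r i x : absnode r i x =
  (r`!%:R)^-1 * `|\prod_(l <- other_nodes r i) (x - l%:R)|.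
Proof.
rewrite /abs_node hornerZ horner_prod normrM ger0_norm ?invr_ge0 ?ler0n //.
by under eq_bigr do rewrite hornerXsubC.
Qed.

Lemma absnode_expand (r i : nat) (c x y m : R) : 0 <= c -> 0 <= y ->
  (\prod_(l <- other_nodes r i) (x - l%:R) = y \/
   \prod_(l <- other_nodes r i) (x - l%:R) = - y) ->
  c * y <= m * r`!%:R -> c * absnode r i x <= m.
Proof.
move=> c0 y0 h hm; rewrite absnodeE.
have -> : `|\prod_(l <- other_nodes r i) (x - l%:R)| = y.
  by case: h => ->; rewrite ?normrN ger0_norm.
by rewrite mulrCA ler_pdivrMl ?ltr0n ?fact_gt0 // [leRHS]mulrC.
Qed.

(** Both are 1 plus a cell variation, the 1 being C(2k,j) times the averaging error 1 / C(2k,j). For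
    k >= 3 the variations are 3 on the first cell and (2/5)(2k) + 29/10 on the others; for k <= 2
    they come from explicit bounds. With k = 1 there is no inner cell, and the inner value repeats
    the end value. *)
Definition whitney_end (k : nat) : R := if (k <= 2)%N then 11 / 4 else 4.
Definition whitney_inner (k : nat) : R :=
  if (k <= 1)%N then 11 / 4 else if (k == 2)%N then 71 / 20
  else 4 / 5 * k%:R + 39 / 10.

Lemma cell_variation_2 (H : R -> R) :
  (forall y, has_deriv H y (\sum_(i < 3) `|(nodepoly R 2 i)^`().[y]|)) ->
  H 1 - H 0 <= 7 / 4.
Proof.
move=> hH.
pose m (i : nat) : R := if i == 0%N then 1 else if i == 1%N then 1 / 2 else 1 / 8.
have := @cell_variation R 2 0 H m isT hH.
rewrite !big_ord_recr big_ord0 /= add0r bin0 bin1 mul1r /m /=.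
move=> h; apply: (le_trans (h _)); last by lra.
move=> [|[|[|//]]] x _; rewrite ?add0r => /andP[x0 x1] /=.
- have := @absnode_self_le R 2 0 x isT; rewrite bin0 add0r.
  by apply; rewrite x0.
- apply: (@absnode_expand _ _ _ _ (x * (2 - x))) => //; first by nra.
    by right; rewrite /= !big_cons big_nil; ring.
  by rewrite (_ : (2`!)%:R = 2 :> R) //; have := sqr_ge0 (x - 1); nra.
- apply: (@absnode_expand _ _ _ _ (x * (1 - x))) => //; first by nra.
    by right; rewrite /= !big_cons big_nil; ring.
  by rewrite (_ : (2`!)%:R = 2 :> R) //; have := sqr_ge0 (x - 1 / 2); nra.
Qed.

Lemma cell_variation_40 (H : R -> R) :
  (forall y, has_deriv H y (\sum_(i < 5) `|(nodepoly R 4 i)^`().[y]|)) ->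
  H 1 - H 0 <= 7 / 4.
Proof.
move=> hH.
(* Maxima over the cell, mostly rounded up; 1/24 is exact. In the certificates below the squares
   vanish near the maximisers. *)
pose m (i : nat) : R := if i == 0%N then 1 else if i == 1%N then 29 / 100 else
  if i == 2%N then 1 / 10 else if i == 3%N then 3 / 50 else 1 / 24.
have := @cell_variation R 4 0 H m isT hH.
rewrite !big_ord_recr big_ord0 /= add0r bin0 bin1 mul1r /m /=.
move=> h; apply: (le_trans (h _)); last by lra.
have f4 : (4`!)%:R = 24 :> R by [].
move=> [|[|[|[|[|//]]]]] x _; rewrite ?add0r => /andP[x0 x1] /=.
- have := @absnode_self_le R 4 0 x isT; rewrite bin0 add0r.
  by apply; rewrite x0.
- apply: (@absnode_expand _ _ _ _ (x * (2 - x) * (3 - x) * (4 - x))) => //.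
  + by rewrite !mulr_ge0 //; lra.
  + by right; rewrite /= !big_cons big_nil; ring.
  rewrite f4 -subr_ge0.
  have -> : 29 / 100 * 24 - 1 * (x * (2 - x) * (3 - x) * (4 - x)) =
    5 * ((2 / 3 - x) ^+ 2 * (8 / 3 - x)) + (24 / 25 - 25 / 27) + (1 - x) ^+ 4 by field.
  have h1 : 0 <= (2 / 3 - x) ^+ 2 * (8 / 3 - x) by rewrite mulr_ge0 ?sqr_ge0 //; lra.
  have h2 : 0 <= (1 - x) ^+ 4 by rewrite exprn_ge0 //; lra.
  by lra.
- apply: (@absnode_expand _ _ _ _ (x * (1 - x) * (3 - x) * (4 - x))) => //.
  + by rewrite !mulr_ge0 //; lra.
  + by right; rewrite /= !big_cons big_nil; ring.
  rewrite f4 -subr_ge0.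
  have -> : 1 / 10 * 24 - 1 * (x * (1 - x) * (3 - x) * (4 - x)) =
    8 * ((x - 2 / 5) ^+ 2 * (1 - x)) + 23 / 5 * (x - 9 / 20) ^+ 2
    + (377 / 2000 - 9 / 50 * x) + x ^+ 4 by field.
  have h1 : 0 <= (x - 2 / 5) ^+ 2 * (1 - x) by rewrite mulr_ge0 ?sqr_ge0 //; lra.
  have h2 : 0 <= x ^+ 4 by rewrite exprn_ge0.
  have h3 := sqr_ge0 (x - 9 / 20).
  by lra.
- apply: (@absnode_expand _ _ _ _ (x * (1 - x) * (2 - x) * (4 - x))) => //.
  + by rewrite !mulr_ge0 //; lra.
  + by right; rewrite /= !big_cons big_nil; ring.
  rewrite f4 -subr_ge0.
  have -> : 3 / 50 * 24 - 1 * (x * (1 - x) * (2 - x) * (4 - x)) =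
    7 * ((x - 2 / 5) ^+ 2 * (1 - x)) + 7 / 5 * (x - 9 / 20) ^+ 2
    + (73 / 2000 - 1 / 50 * x) + x ^+ 4 by field.
  have h1 : 0 <= (x - 2 / 5) ^+ 2 * (1 - x) by rewrite mulr_ge0 ?sqr_ge0 //; lra.
  have h2 : 0 <= x ^+ 4 by rewrite exprn_ge0.
  have h3 := sqr_ge0 (x - 9 / 20).
  by lra.
- apply: (@absnode_expand _ _ _ _ (x * (1 - x) * (2 - x) * (3 - x))) => //.
  + by rewrite !mulr_ge0 //; lra.
  + by right; rewrite /= !big_cons big_nil; ring.
  rewrite f4 -subr_ge0.
  have -> : 1 / 24 * 24 - 1 * (x * (1 - x) * (2 - x) * (3 - x)) =
    (1 - 3 * x + x ^+ 2) ^+ 2 by field.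
  exact: sqr_ge0.
Qed.

Lemma cell_variation_41 (H : R -> R) :
  (forall y, has_deriv H y (\sum_(i < 5) `|(nodepoly R 4 i)^`().[y]|)) ->
  4 * (H (1 + 1) - H 1) <= 51 / 20.
Proof.
move=> hH.
pose m (i : nat) : R := if i == 0%N then 1 / 6 else if i == 1%N then 1 else
  if i == 2%N then 2 / 3 else if i == 3%N then 9 / 50 else 3 / 32.
have := @cell_variation R 4 1 H m isT hH.
rewrite !big_ord_recr big_ord0 /= add0r bin1 (_ : 'C(4, 2) = 6%N) // /m /=.
move=> h; apply: (le_trans (h _)); last by lra.
have f4 : (4`!)%:R = 24 :> R by [].
move=> [|[|[|[|[|//]]]]] x _ => /andP[x0 x1] /=.
- apply: (@absnode_expand _ _ _ _ ((x - 1) * (2 - x) * (3 - x) * (4 - x))) => //.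
  + by rewrite !mulr_ge0 //; lra.
  + by right; rewrite /= !big_cons big_nil; ring.
  rewrite f4 -subr_ge0.
  have -> : 1 / 6 * 24 - 4 * ((x - 1) * (2 - x) * (3 - x) * (4 - x)) =
    4 * (1 - 3 * (x - 1) + (x - 1) ^+ 2) ^+ 2 by field.
  by rewrite mulr_ge0 // sqr_ge0.
- have := @absnode_self_le R 4 1 (x - 1) isT; rewrite bin1 [1%:R + _]addrC subrK.
  by apply; lra.
- apply: (@absnode_expand _ _ _ _ (x * (x - 1) * (3 - x) * (4 - x))) => //.
  + by rewrite !mulr_ge0 //; lra.
  + by left; rewrite /= !big_cons big_nil; ring.
  rewrite f4 -subr_ge0.
  have -> : 2 / 3 * 24 - 4 * (x * (x - 1) * (3 - x) * (4 - x)) =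
    4 * ((2 - x) ^+ 2 * (5 - (2 - x) ^+ 2)) by field.
  by rewrite !mulr_ge0 // ?sqr_ge0 //; nra.
- apply: (@absnode_expand _ _ _ _ (x * (x - 1) * (2 - x) * (4 - x))) => //.
  + by rewrite !mulr_ge0 //; lra.
  + by left; rewrite /= !big_cons big_nil; ring.
  rewrite f4 -subr_ge0.
  have -> : 9 / 50 * 24 - 4 * (x * (x - 1) * (2 - x) * (4 - x)) =
    4 * ((x - 1) ^+ 3 * (2 - x) + 2 * ((x - 1 - 11 / 20) ^+ 2 * (x - 1 + 8 / 5)) +
    (14 / 125 - 17 / 200 * (x - 1))) by field.
  have h1 : 0 <= (x - 1) ^+ 3 * (2 - x) by rewrite mulr_ge0 ?exprn_ge0 //; lra.
  have h2 : 0 <= (x - 1 - 11 / 20) ^+ 2 * (x - 1 + 8 / 5).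
    by rewrite mulr_ge0 ?sqr_ge0 //; lra.
  by lra.
- apply: (@absnode_expand _ _ _ _ (x * (x - 1) * (2 - x) * (3 - x))) => //.
  + by rewrite !mulr_ge0 //; lra.
  + by left; rewrite /= !big_cons big_nil; ring.
  rewrite f4 -subr_ge0.
  have -> : 3 / 32 * 24 - 4 * (x * (x - 1) * (2 - x) * (3 - x)) =
    4 * ((1 / 4 - (x - 1) * (2 - x)) * (9 / 4 + (x - 1) * (2 - x))) by field.
  have -> : 1 / 4 - (x - 1) * (2 - x) = (x - 3 / 2) ^+ 2 by field.
  have hx : 0 <= (x - 1) * (2 - x) by rewrite mulr_ge0 //; lra.
  by apply: mulr_ge0 => //; apply: mulr_ge0; [exact: sqr_ge0|lra].
Qed.

Lemma cell_bound k j (H : R -> R) : (0 < k)%N -> (j < k)%N ->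
  (forall y, has_deriv H y (\sum_(i < (2 * k).+1) `|(nodepoly R (2 * k) i)^`().[y]|)) ->
  1 + 'C(2 * k, j)%:R * (H (j%:R + 1) - H j%:R) <=
    if j == 0%N then whitney_end k else whitney_inner k.
Proof.
move=> k0 jk hH; rewrite /whitney_end /whitney_inner.
case: (ltnP k 3) => k3; last first.
  have -> : (k <= 2)%N = false by lia.
  have -> : (k <= 1)%N = false by lia.
  have -> : (k == 2)%N = false by lia.
  case: j jk => [|j] jk; rewrite ?eqxx.
    rewrite bin0 mul1r add0r; have := @first_cell_variation R (2 * k) H _ hH.
    by rewrite muln_gt0 k0 => /(_ isT); lra.
  have jr : (j.+1 < 2 * k - j.+1)%N by lia.
  have := generic_cell_variation (ltn0Sn j) jr hH.
  rewrite (_ : (j.+1 == 0)%N = false) // natrM.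
  by move: (_ * (_ - _)) => x; lra.
case: k k0 jk k3 hH => [//|[|[|//]]] _ jk _ hH /=.
  case: j jk => //= _; rewrite bin0 mul1r add0r.
  by have := cell_variation_2 hH; lra.
case: j jk => [|[|//]] _ /=.
  rewrite bin0 mul1r add0r; have := cell_variation_40 hH; lra.
by have := cell_variation_41 hH; rewrite bin1; lra.
Qed.

End SmallCells.

(** * Whitney's inequality with a contact point *)

Section Whitney.
Variable R : realType.

Lemma exists_node_variation r : exists H : R -> R,
  forall y, has_deriv H y (\sum_(i < r.+1) `|(nodepoly R r i)^`().[y]|).
Proof.
have : forall i, exists V, forall x, has_deriv V x `|(nodepoly R r i)^`().[x]|.
  move=> i; apply: exists_primitive => x.
  exact: (continuous_comp (@continuous_horner R _ x) (@norm_continuous R R _)).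
move=> /choice[V hV]; exists (fun y => \sum_(i < r.+1) V i y) => y.
by apply: has_deriv_sum => i _; exact: hV.
Qed.

(** A primitive of F minus its interpolant Q vanishes at all nodes, so Rolle's theorem on [k-1, k]
    yields a point where F meets P = Q'. Right of the middle, cell j is the mirror image of cell 2k
    - j - 1, hence the weight C(2k,j+1) of its right end there. *)
Lemma whitney (k : nat) (N w : R) (F : R -> R) : (0 < k)%N -> continuous F ->
  (2 * k)%:R + 1 <= N ->
  (forall x s : R, 0 <= x -> 0 <= s <= 1 -> x + (2 * k)%:R * s <= N ->
    `|fdiff (2 * k) s F x| <= w) ->
  exists (P : {poly R}) (a : R), [/\ (size P <= 2 * k)%N,
    k%:R - 1 <= a <= k%:R, F a = P.[a],
    forall j y, (j < k)%N -> j%:R <= y <= j%:R + 1 ->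
      'C(2 * k, j)%:R * `|F y - P.[y]| <=
        w * (if j == 0%N then whitney_end R k else whitney_inner R k)
  & forall j y, (k <= j < 2 * k)%N -> j%:R <= y <= j%:R + 1 ->
      'C(2 * k, j.+1)%:R * `|F y - P.[y]| <=
        w * (if j.+1 == (2 * k)%N then whitney_end R k else whitney_inner R k)].
Proof.
move=> k0 cF hN hw; set r := (2 * k)%N in hN hw *.
have r0 : (0 < r)%N by rewrite /r muln_gt0.
have [G0 hG0] := exists_primitive cF.
have [H hH] := exists_node_variation r.
pose Q := \sum_(m < r.+1) G0 m%:R *: lagr R r m.
have sQ : (size Q <= r.+1)%N.
  apply: (leq_trans (size_sum _ _ _)); apply/bigmax_leqP => i _.
  rewrite (leq_trans (size_scale_leq _ _)) // (leq_trans (size_scale_leq _ _)) //.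
  by apply: size_nodepoly; rewrite -ltnS.
have hQ m : (m <= r)%N -> Q.[m%:R] = G0 m%:R.
  move=> mr; rewrite horner_sum (bigD1 (@Ordinal r.+1 m mr)) //=.
  rewrite hornerZ lagr_node // eqxx mulr1 big1 ?addr0 // => i im.
  have ir : (i <= r)%N by rewrite -ltnS.
  rewrite hornerZ lagr_node // (_ : (m == i) = false) ?mulr0 //.
  by apply/negbTE; rewrite eq_sym; exact: im.
pose G y := G0 y - Q.[y].
pose e y := F y - Q^`().[y].
have hG y : has_deriv G y (e y) by apply: has_derivB; [exact: hG0|exact: has_deriv_horner].
have G_node m : (m <= r)%N -> G m%:R = 0 by move=> mr; rewrite /G hQ // subrr.
have sP : (size Q^`() <= r)%N.
  have [->|Q0] := eqVneq Q 0; first by rewrite deriv0 size_poly0.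
  by rewrite -ltnS; apply: leq_trans sQ; exact: lt_size_deriv.
have hw' x s : 0 <= x -> 0 <= s <= 1 -> x + r%:R * s <= N -> `|fdiff r s e x| <= w.
  move=> x0 s01 xN; rewrite /e fdiffB (fdiff_poly s x sP) subr0.
  exact: hw.
have w0 : 0 <= w.
  apply: (le_trans (normr_ge0 (fdiff r 0 F 0))).
  by apply: hw; rewrite ?lexx ?ler01 // mulr0 add0r; have := ler0n R r; lra.
have pw j x : (j < r)%N -> j%:R <= x <= j%:R + 1 ->
    `|e x| <= w * ('C(r, j)%:R^-1 + (H (j%:R + 1) - H j%:R)).
  move=> jr hx; apply: le_trans (whitney_pointwise hG hw' G_node hH r0 hN (ltnW jr) hx) _.
  rewrite ler_wpM2l // lerD2l lerD2r -subr_ge0 -(subrr 0).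
  have /andP[_ xj1] := hx.
  apply: (@derive_bound_ub _ (fun=> 0) (fun=> 0) H _ _ _ xj1
    (fun y _ => has_deriv_cst _ _) (fun y _ => hH y)) => y _.
  by apply: sumr_ge0.
have cz j : (j <= r)%N -> ('C(r, j)%:R : R) != 0.
  by move=> jr; rewrite pnatr_eq0 -lt0n bin_gt0.
have [a ain ha] : exists2 a : R, k%:R - 1 <= a <= k%:R & e a = 0.
  have k1 : (k.-1%:R : R) = k%:R - 1 by rewrite -subn1 natrB.
  have [||||a ain ha] := @Rolle _ G (k%:R - 1) k%:R.
  - by lra.
  - by move=> x _; have [] := hG x.
  - exact/continuous_subspaceT/has_deriv_continuous/hG.
  - by rewrite -k1 !G_node // /r; lia.
  exists a; first by move: ain; rewrite in_itv /= => /andP[/ltW -> /ltW ->].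
  by have := hG a; rewrite /has_deriv => -[_ <-]; case: ha.
exists Q^`(), a; split => //.
- by apply/eqP; rewrite -subr_eq0; apply/eqP.
- move=> j y jk hy; have jr : (j < r)%N by rewrite /r; lia.
  apply: (le_trans (ler_wpM2l (ler0n _ _) (pw j y jr hy))).
  rewrite mulrCA ler_wpM2l // mulrDr divff ?cz ?(ltnW jr) //.
  exact: cell_bound.
- move=> j y /andP[kj jr] hy.
  apply: (le_trans (ler_wpM2l (ler0n _ _) (pw j y jr hy))).
  rewrite mulrCA ler_wpM2l // (cell_sym jr hH).
  have jr' : (r - j.+1 < k)%N by rewrite /r; lia.
  have := cell_bound k0 jr' hH; rewrite -/r (bin_sub jr).
  rewrite (_ : (r - j.+1 == 0)%N = (j.+1 == r)); last by lia.
  move/(le_trans _); apply; rewrite mulrDr lerD2r.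
  rewrite ler_pdivrMr ?ltr0n ?bin_gt0 ?(ltnW jr) // mul1r ler_nat.
  rewrite -(leq_pmul2l (ltn0Sn j)) mul_bin_left leq_mul2r; apply/orP; right.
  by rewrite /r; lia.
Qed.

End Whitney.

(** * Extension to the line *)

HB.lock Definition step_from (V : nmodType) m (c : V) i := if (i < m)%N then 0 else c.
HB.lock Definition delta_at (V : nmodType) j (c : V) (i : nat) := if i == j then c else 0.

Section Extension.
Variable R : realType.

Lemma leq_bin_left r i j : (i <= j)%N -> (2 * j <= r)%N -> ('C(r, i) <= 'C(r, j))%N.
Proof.
move=> /subnK <-; elim: (j - i)%N => // d ih; rewrite addSn => hr.
apply: leq_trans (ih _) _; first by nlia.
rewrite -(leq_pmul2l (ltn0Sn (d + i))) mul_bin_left leq_mul2r; apply/orP; right.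
by nlia.
Qed.

Lemma leq_bin_right r i j : (r <= 2 * j)%N -> (j <= i <= r)%N -> ('C(r, i) <= 'C(r, j))%N.
Proof.
move=> rj /andP[ji ir]; rewrite -(bin_sub ir) -(bin_sub (leq_trans ji ir)).
by apply: leq_bin_left; nlia.
Qed.

Lemma leq_bin_inner r i : (0 < i < r)%N -> (r <= 'C(r, i))%N.
Proof.
move=> /andP[i0 ir]; have [h|h] := leqP (2 * i) r.
  by rewrite -[leqLHS]bin1; apply: leq_bin_left.
rewrite -[leqLHS]bin1 -(bin_sub (ltnW ir)); apply: leq_bin_left; nlia.
Qed.

Lemma whitney_endS k : whitney_end R k.+3 = 4.
Proof. by rewrite /whitney_end (_ : (k.+3 <= 2)%N = false) //; nlia. Qed.

Lemma whitney_innerS k : whitney_inner R k.+3 = 4 / 5 * k.+3%:R + 39 / 10.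
Proof.
rewrite /whitney_inner (_ : (k.+3 <= 1)%N = false); last by nlia.
by rewrite (_ : (k.+3 == 2)%N = false) //; nlia.
Qed.

(** Transfers an inner-cell estimate to an end node: inner binomials are at least 2k, while the end
    node has weight 1. *)
Lemma whitney_inner_le k : (0 < k)%N ->
  whitney_inner R k <= whitney_end R k * (2 * k)%:R.
Proof.
case: k => [//|[|[|k]]] _.
- by rewrite /whitney_inner /whitney_end /= muln1; lra.
- by rewrite /whitney_inner /whitney_end natrM /=; lra.
rewrite whitney_endS whitney_innerS natrM -(addn3 k) natrD.
by have := ler0n R k; lra.
Qed.

Lemma whitney_end_le k : (0 < k)%N ->
  1 + whitney_end R k <= (1 + k%:R^-1) * whitney_inner R k.
Proof.
case: k => [//|[|[|k]]] _.
- by rewrite /whitney_inner /whitney_end /= invr1; lra.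
- by rewrite /whitney_inner /whitney_end /=; lra.
rewrite whitney_endS whitney_innerS.
have h : 0 <= k.+3%:R^-1 * (4 / 5 * k.+3%:R + 39 / 10) :> R.
  by rewrite mulr_ge0 ?invr_ge0 // addr_ge0 // mulr_ge0.
rewrite mulrDl mul1r; move: (_ * _) h => z h.
by rewrite -(addn3 k) natrD; have := ler0n R k; lra.
Qed.

Lemma whitney_end_gt0 k : 0 < whitney_end R k.
Proof. by rewrite /whitney_end; case: ifP => _; lra. Qed.

Lemma whitney_inner_gt0 k : 0 < whitney_inner R k.
Proof.
rewrite /whitney_inner; case: ifP => _; first by lra.
by case: ifP => _; [lra|have := ler0n R k; lra].
Qed.

Variable k : nat.
Hypothesis k0 : (0 < k)%N.
Local Notation r := (2 * k)%N.
Local Notation We := (whitney_end R k).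
Local Notation wi := (whitney_inner R k).

Definition whitney_bounds (w : R) (F : R -> R) (P : {poly R}) : Prop :=
  (forall j y, (j < k)%N -> j%:R <= y <= j%:R + 1 ->
      'C(r, j)%:R * `|F y - P.[y]| <= w * (if j == 0%N then We else wi)) /\
  (forall j y, (k <= j < r)%N -> j%:R <= y <= j%:R + 1 ->
      'C(r, j.+1)%:R * `|F y - P.[y]| <= w * (if j.+1 == r then We else wi)).

Lemma cell_of (y : R) : 0 <= y -> exists j, j%:R <= y /\ y < j%:R + 1.
Proof.
by move=> y0; exists (Num.truncn y); rewrite natr1; apply/andP/truncn_itv.
Qed.

Lemma scaled_le (c1 c2 : nat) (e B : R) : (c1 <= c2)%N -> 0 <= e ->
  c2%:R * e <= B -> c1%:R * e <= B.
Proof.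
by move=> c12 e0; apply: le_trans; rewrite ler_wpM2r // ler_nat.
Qed.

(** Binomials increase up to the middle, so the cell of a point y >= i carries at least the weight
    of node i. *)
Lemma left_node w F P i (y : R) : 0 <= w -> whitney_bounds w F P ->
  i%:R <= y -> y < k%:R ->
  'C(r, i)%:R * `|F y - P.[y]| <= w * (if i == 0%N then We else wi).
Proof.
move=> w0 [hP _] iy yk.
have [j [jy yj]] := cell_of (le_trans (ler0n R i) iy).
have ij : (i <= j)%N by rewrite -ltnS -(ltr_nat R) -natr1; lra.
have jk : (j < k)%N by rewrite -(ltr_nat R); lra.
have hj := hP j y jk; rewrite jy (ltW yj) in hj; have {}hj := hj isT.
case: (eqVneq i 0%N) => [i0|i0]; last first.
  have -> : wi = (if j == 0%N then We else wi).
    by rewrite (_ : (j == 0)%N = false) //; nlia.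
  by apply: scaled_le hj; rewrite ?normr_ge0 //; apply: leq_bin_left; nlia.
rewrite i0 bin0; case: (eqVneq j 0%N) hj => [->|j0] hj; first by rewrite bin0 in hj.
have h : r%:R * `|F y - P.[y]| <= w * (We * r%:R).
  apply: le_trans (ler_wpM2l w0 (whitney_inner_le k0)).
  by apply: scaled_le hj; rewrite ?normr_ge0 //; apply: leq_bin_inner; nlia.
rewrite mul1r -(ler_pM2l (_ : 0 < r%:R)) ?ltr0n; last by nlia.
by rewrite (le_trans h) // mulrA mulrC.
Qed.

(** Past the middle the weights decrease, so a cell below i weighs at least as much as node i. The
    exception is i = k with y in cell k - 1, where the ratio C(2k,k) / C(2k,k-1) = 1 + 1/k
    enters. *)
Lemma right_node w F P i (y : R) : 0 <= w -> whitney_bounds w F P ->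
  k%:R - 1 <= y -> y < i%:R -> (i <= r)%N ->
  'C(r, i)%:R * `|F y - P.[y]| <=
    w * (if i == r then We else if i == k then (1 + k%:R^-1) * wi else wi).
Proof.
move=> w0 [hP hP2] ky yi ir.
have k1 : (k.-1%:R : R) = k%:R - 1 by rewrite -subn1 natrB.
have y0 : 0 <= y by apply: le_trans ky; rewrite -k1.
have [j [jy yj]] := cell_of y0.
have ji : (j < i)%N by rewrite -(ltr_nat R); lra.
have kj : (k.-1 <= j)%N by rewrite -ltnS -(ltr_nat R) -natr1 k1; lra.
have r0 : 0 < (r%:R : R) by rewrite ltr0n; nlia.
have inner m : (0 < m < r)%N -> 'C(r, m)%:R * `|F y - P.[y]| <= w * wi ->
    'C(r, r)%:R * `|F y - P.[y]| <= w * We.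
  move=> hm h; rewrite binn mul1r -(ler_pM2l r0).
  have h2 : r%:R * `|F y - P.[y]| <= w * (We * r%:R).
    apply: le_trans (ler_wpM2l w0 (whitney_inner_le k0)).
    by apply: scaled_le h; rewrite ?normr_ge0 //; exact: leq_bin_inner.
  by rewrite (le_trans h2) // mulrA mulrC.
have [kj'|jk] := leqP k j.
  have jr : (j < r)%N by nlia.
  have h := hP2 j y; rewrite kj' jr jy (ltW yj) in h; have {}h := h isT isT.
  case: (eqVneq i r) => [->|ir'].
    case: (eqVneq j.+1 r) h => [->|jr'] h; first by [].
    by apply: (inner j.+1); [nlia|].
  rewrite (_ : (i == k) = false); last by nlia.
  rewrite (_ : (j.+1 == r) = false) in h; last by nlia.
  by apply: scaled_le h; rewrite ?normr_ge0 //; apply: leq_bin_right; nlia.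
have jE : j = k.-1 by nlia.
have h := hP j y jk; rewrite jy (ltW yj) in h; have {}h := h isT.
have h' : 'C(r, k.-1)%:R * `|F y - P.[y]| <= w * wi.
  rewrite -jE; apply: le_trans h _; rewrite ler_wpM2l //.
  case: ifP => [/eqP j0|//]; have k_1 : k = 1%N by nlia.
  by rewrite k_1.
case: (eqVneq i r) => [->|ir'].
  case: (ltnP 1 k) => k1'; first by apply: (inner k.-1) => //; nlia.
  have k_1 : k = 1%N by nlia.
  rewrite binn; move: h; rewrite jE (_ : (k.-1 == 0)%N); last by nlia.
  by rewrite (_ : k.-1 = 0%N) ?bin0 //; nlia.
case: (eqVneq i k) => [->|ik]; last first.
  apply: scaled_le h'; rewrite ?normr_ge0 //.
  rewrite -(bin_sub (_ : (k.-1 <= r)%N)); last by nlia.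
  by apply: leq_bin_right; nlia.
have kr : 'C(r, k)%:R = (1 + k%:R^-1) * 'C(r, k.-1)%:R :> R.
  have kz : k%:R != 0 :> R by rewrite pnatr_eq0 -lt0n.
  apply: (mulfI kz); rewrite mulrA mulrDr mulr1 divff // natr1 -!natrM; congr _%:R.
  have := mul_bin_left r k.-1; rewrite prednK // => ->; congr (_ * _)%N; nlia.
by rewrite kr -mulrA [leRHS]mulrCA ler_wpM2l // addr_ge0 // invr_ge0.
Qed.

(** P up to a, F on [a, N - b], and y -> P'(N - y) beyond. The form with [max] and [min] yields
    continuity without cases. *)
Definition glue F (P : {poly R}) (a : R) (P' : {poly R}) b N (y : R) : R :=
  F (Num.max a (Num.min y (N - b))) + (P.[Num.min y a] - P.[a]) +
  (P'.[N - Num.max y (N - b)] - P'.[b]).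

Section Glue.
Variables (F : R -> R) (P P' : {poly R}) (a b N : R).
Hypothesis abN : a <= N - b.
Hypothesis Fa : F a = P.[a].
Hypothesis Fb : F (N - b) = P'.[b].

Lemma glue_left y : y <= a -> glue F P a P' b N y = P.[y].
Proof.
move=> ya; have yb := le_trans ya abN.
rewrite /glue (min_idPl yb) (max_idPl ya) (min_idPl ya) (max_idPr yb) Fa.
by rewrite subKr subrr addr0 addrC subrK.
Qed.

Lemma glue_middle y : a <= y <= N - b -> glue F P a P' b N y = F y.
Proof.
move=> /andP[ya yb].
rewrite /glue (min_idPl yb) (max_idPr ya) (min_idPr ya) (max_idPr yb).
by rewrite subKr !subrr !addr0.
Qed.

Lemma glue_right y : N - b <= y -> glue F P a P' b N y = P'.[N - y].
Proof.
move=> yb; have ya := le_trans abN yb.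
rewrite /glue (min_idPr yb) (max_idPr abN) (min_idPr ya) (max_idPl yb) Fb.
by rewrite subrr addr0 addrC subrK.
Qed.

Lemma continuous_glue : continuous F -> continuous (glue F P a P' b N).
Proof.
move=> cF y; apply: (@continuousD _ _ _ (fun y => F (Num.max a (Num.min y (N - b)))
  + (P.[Num.min y a] - P.[a])) (fun y => P'.[N - Num.max y (N - b)] - P'.[b])).
  apply: (@continuousD _ _ _ (fun y => F (Num.max a (Num.min y (N - b))))
    (fun y => P.[Num.min y a] - P.[a])).
    apply: (@continuous_comp _ _ _ (fun y => Num.max a (Num.min y (N - b))) F).
      apply: (@continuous_max _ _ (fun=> a) (fun y => Num.min y (N - b))).
        exact: cst_continuous.
      by apply: continuous_min; [exact: cvg_id|exact: cst_continuous].
    exact: cF.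
  apply: (@continuousB _ _ _ (fun y => P.[Num.min y a]) (fun=> P.[a])); last exact: cst_continuous.
  apply: (@continuous_comp _ _ _ (fun y => Num.min y a) (fun y => P.[y])).
    by apply: continuous_min; [exact: cvg_id|exact: cst_continuous].
  exact: continuous_horner.
apply: (@continuousB _ _ _ (fun y => P'.[N - Num.max y (N - b)]) (fun=> P'.[b])); last exact: cst_continuous.
apply: (@continuous_comp _ _ _ (fun y => N - Num.max y (N - b)) (fun y => P'.[y])).
  apply: (@continuousB _ _ _ (fun=> N) (fun y => Num.max y (N - b))); first exact: cst_continuous.
  by apply: continuous_max; [exact: cvg_id|exact: cst_continuous].
exact: continuous_horner.
Qed.

End Glue.

Lemma glue_sym F P a P' b N y : a <= N - b -> F a = P.[a] -> F (N - b) = P'.[b] ->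
  glue F P a P' b N (N - y) = glue (fun y => F (N - y)) P' b P a N y.
Proof.
move=> abN Fa Fb.
have ab' : b <= N - a by lra.
have Fa' : F (N - (N - a)) = P.[a] by rewrite subKr.
have [yb|yb] := leP y b.
  by rewrite glue_right ?glue_left ?subKr //; lra.
have [ya|ya] := leP y (N - a).
  by rewrite !glue_middle //; lra.
by rewrite glue_left ?glue_right //; lra.
Qed.

Lemma sum_step_from m n (c : R) : (m <= n)%N ->
  \sum_(i < n) step_from m c i = (n%:R - m%:R) * c.
Proof.
rewrite step_from.unlock; elim: n => [|n ih] mn; first by rewrite big_ord0 (_ : m = 0%N) ?subrr ?mul0r //; nlia.
have [mn'|->] : (m <= n)%N \/ m = n.+1 by nlia.
  by rewrite big_ord_recr /= ih // ltnNge mn' /= -(@natr1 R n); ring.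
by rewrite subrr mul0r big1 // => i _; rewrite ltn_ord.
Qed.

Lemma sum_delta_at j n (c : R) : (j < n)%N -> \sum_(i < n) delta_at j c i = c.
Proof.
move=> jn; rewrite delta_at.unlock -big_mkcond (big_pred1 (Ordinal jn)) //.
Qed.

Lemma normr_fdiff_le s (F : R -> R) x (t : nat -> R) w :
  (forall i, (i <= r)%N -> 'C(r, i)%:R * `|F (x + i%:R * s)| <= w * t i) ->
  `|fdiff r s F x| <= w * \sum_(i < r.+1) t i.
Proof.
move=> h; rewrite mulr_sumr; apply: le_trans (ler_norm_sum _ _ _) _.
apply: ler_sum => i _; rewrite -mulrA normrM normrX normrN1 expr1n mul1r.
by rewrite normrM normr_nat; apply: h; rewrite -ltnS.
Qed.

Definition extension_const : R := (r%:R - 1 + k%:R^-1) * wi + We.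

(** The first three terms pay for F against the left polynomial at the nodes k, ..., 2k; the last
    pays for F against the right polynomial at nodes that have passed N - b. Sums of steps and point
    masses make the total immediate. *)
Definition left_weight i := step_from k.+1 wi i + delta_at k ((1 + k%:R^-1) * wi) i
  + delta_at r (We - wi) i + step_from k.+2 wi i.

Lemma left_weightE i : (k <= i)%N -> left_weight i =
  (if i == r then We else if i == k then (1 + k%:R^-1) * wi else wi) +
  (if (i < k.+2)%N then 0 else wi).
Proof.
move=> ki; rewrite /left_weight step_from.unlock delta_at.unlock; congr (_ + _).
case: (eqVneq i k) => ?; case: (eqVneq i r) => ?; case: (ltnP i k.+1) => ?;
  try nlia; lra.
Qed.

Lemma left_weight_ge0 i : 0 <= left_weight i.
Proof.
have wi0 := whitney_inner_gt0 k; have We0 := whitney_end_gt0 k.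
have c0 : 0 <= (1 + k%:R^-1) * wi by rewrite mulr_ge0 ?addr_ge0 ?invr_ge0 // ltW.
have [ki|ik] := leqP k i.
  by rewrite left_weightE //; do !case: ifP => _; lra.
rewrite /left_weight step_from.unlock delta_at.unlock.
have -> : (i < k.+1)%N by nlia.
have -> : (i < k.+2)%N by nlia.
have -> : (i == k) = false by nlia.
have -> : (i == r) = false by nlia.
by rewrite !addr0.
Qed.

Lemma sum_left_weight : \sum_(i < r.+1) left_weight i = extension_const.
Proof.
have h1 : (k.+1 <= r.+1)%N by nlia.
have h2 : (k.+2 <= r.+1)%N by nlia.
have h3 : (k < r.+1)%N by nlia.
rewrite !big_split /= (sum_step_from wi h1) (sum_step_from wi h2).
rewrite (sum_delta_at ((1 + k%:R^-1) * wi) h3) (sum_delta_at (We - wi) (leqnn r.+1)).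
by rewrite /extension_const -!natr1; ring.
Qed.

Definition end_weight i := step_from 0 wi i + delta_at 0 (We - wi) i
  + delta_at r (We - wi) i + delta_at k (- wi) i.

Lemma end_weightE i :
  end_weight i = if (i == 0)%N || (i == r) then We else if i == k then 0 else wi.
Proof.
rewrite /end_weight step_from.unlock delta_at.unlock.
case: (eqVneq i k) => ?; case: (eqVneq i r) => ?; case: (eqVneq i 0%N) => ? /=;
  try nlia; lra.
Qed.

Lemma end_weight_lt i : (i < k)%N ->
  end_weight i = if (i == 0)%N then We else wi.
Proof.
move=> ik; have e1 : (i == r) = false by lia.
have e2 : (i == k) = false by lia.
by rewrite end_weightE e1 e2 orbF.
Qed.

Lemma end_weight_gt i : (i <= r)%N -> (r - i < k)%N ->
  end_weight i = if (r - i == 0)%N then We else wi.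
Proof.
move=> ir ik; have e1 : (i == 0)%N = false by lia.
have e2 : (i == k) = false by lia.
have e3 : (r - i == 0)%N = (i == r) by lia.
by rewrite end_weightE e1 e2 e3.
Qed.

Lemma sum_end_weight_le : 1 + \sum_(i < r.+1) end_weight i <= extension_const.
Proof.
have h3 : (k < r.+1)%N by nlia.
rewrite !big_split /= (sum_step_from wi (leq0n r.+1)).
rewrite (sum_delta_at (We - wi) (ltn0Sn r)) (sum_delta_at (We - wi) (leqnn r.+1)).
rewrite (sum_delta_at (- wi) h3) /extension_const -natr1.
have := whitney_end_le k0; rewrite mulrDl mul1r => h.
by rewrite !mulrDl; move: (k%:R^-1 * _) h => u; lra.
Qed.

Lemma leq_bin_reflect i : (i <= r)%N -> ((r - i).+1 < k)%N ->
  ('C(r, i) <= 'C(r, (r - i).+1))%N.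
Proof. by move=> ir ik; rewrite -[leqLHS](bin_sub ir); apply: leq_bin_left; nlia. Qed.

Section Stencil.
Variables (F : R -> R) (P P' : {poly R}) (a b N w : R).
Hypothesis w0 : 0 <= w.
Hypothesis hN : r%:R + 1 <= N.
Hypothesis sP : (size P <= r)%N.
Hypothesis ha : k%:R - 1 <= a <= k%:R.
Hypothesis hb : k%:R - 1 <= b <= k%:R.
Hypothesis Fa : F a = P.[a].
Hypothesis Fb : F (N - b) = P'.[b].
Hypothesis hP : whitney_bounds w F P.
Hypothesis hP' : whitney_bounds w (fun y => F (N - y)) P'.
Notation f1 := (glue F P a P' b N).

(** Subtract P, whose difference vanishes: nodes up to a contribute nothing. As s <= 1, a node i
    beyond a has i > i0 and still lies left of i, so [right_node] applies. Beyond N - b the two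
    polynomials are compared through F, and N >= 2k + 1 brings the node into the range of
    [left_node] for the reflected function. *)
Lemma glue_stencil_left x s i0 : 0 <= s <= 1 -> (i0 <= r)%N ->
  x + i0%:R * s < a -> x + i0%:R * s < i0%:R ->
  `|fdiff r s f1 x| <= w * extension_const.
Proof.
move=> /andP[s0 s1] i0r ya yi0.
have rE : r%:R = 2 * k%:R :> R by rewrite natrM.
have wi0 := whitney_inner_gt0 k; have We0 := whitney_end_gt0 k.
have /andP[a1 a2] := ha; have /andP[b1 b2] := hb.
have N1 := hN; rewrite rE in N1.
have abN : a <= N - b by lra.
rewrite -[fdiff _ _ _ _]subr0 -(fdiff_poly s x sP) -fdiffB.
rewrite -sum_left_weight; apply: normr_fdiff_le => i ir; set y := x + _.
have t0 := left_weight_ge0 i.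
have [yla|yla] := leP y a.
  by rewrite (glue_left _ abN Fa yla) subrr normr0 mulr0 mulr_ge0.
have ii0 : (i0 < i)%N.
  rewrite ltnNge; apply/negP => h.
  have : i%:R * s <= i0%:R * s by rewrite ler_wpM2r // ler_nat.
  by move: yla ya; rewrite /y; lra.
have yi : y < i%:R.
  have h : (i%:R - i0%:R) * s <= (i%:R - i0%:R) * 1.
    by rewrite ler_wpM2l // subr_ge0 ler_nat ltnW.
  by move: h yi0; rewrite /y mulrBl; lra.
have rE' : (i%:R <= 2 * k%:R :> R) by rewrite -rE ler_nat.
have ki : (k <= i)%N.
  by rewrite -ltnS -(ltr_nat R) -natr1; lra.
have ky : k%:R - 1 <= y by lra.
have hr := right_node w0 hP ky yi ir.
have [yb|yb] := leP y (N - b).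
  rewrite glue_middle; last by rewrite yb ltW.
  apply: le_trans hr _; rewrite left_weightE // mulrDr lerDl mulr_ge0 //.
  by case: ifP => _ //; exact: ltW.
have iz : (r - i).+1%:R <= N - y by rewrite -natr1 natrB //; lra.
have zb : N - y < k%:R by lra.
have ik : ((r - i).+1 < k)%N by rewrite -(ltr_nat R); lra.
have hl := left_node w0 hP' iz zb; rewrite /= subKr in hl.
have hl' : 'C(r, i)%:R * `|F y - P'.[N - y]| <= w * wi.
  exact: scaled_le (leq_bin_reflect ir ik) (normr_ge0 _) hl.
rewrite (glue_right _ abN Fb (ltW yb)).
have -> : P'.[N - y] - P.[y] = (F y - P.[y]) - (F y - P'.[N - y]) by ring.
have ik2 : (i < k.+2)%N = false by clear -ik; lia.
rewrite left_weightE // ik2.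
rewrite mulrDr; apply: le_trans (_ : _ <= _) (lerD hr hl').
by rewrite -mulrDr ler_wpM2l // ler_normB.
Qed.

(** A node i outside [a, N - b] lies at distance at least i from the left end, or 2k - i from the
    right end. The glued function differs from F there by an error whose binomial denominator
    cancels the weight of the node. *)
Lemma glue_stencil_middle x s : 0 <= s <= 1 ->
  `|fdiff r s F x| <= w ->
  (forall i, (i <= r)%N -> a <= x + i%:R * s \/ i%:R <= x + i%:R * s) ->
  (forall i, (i <= r)%N -> b <= N - (x + i%:R * s) \/ r%:R - i%:R <= N - (x + i%:R * s)) ->
  `|fdiff r s f1 x| <= w * extension_const.
Proof.
move=> /andP[s0 s1] hF hl hr.
have rE : r%:R = 2 * k%:R :> R by rewrite natrM.
have wi0 := whitney_inner_gt0 k; have We0 := whitney_end_gt0 k.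
have /andP[a1 a2] := ha; have /andP[b1 b2] := hb.
have N1 := hN; rewrite rE in N1.
have abN : a <= N - b by lra.
have -> : fdiff r s f1 x = fdiff r s F x - fdiff r s (fun y => F y - f1 y) x.
  by rewrite fdiffB subKr.
apply: le_trans (ler_normB _ _) _.
apply: (@le_trans _ _ (w + w * \sum_(i < r.+1) end_weight i)); last first.
  by rewrite -{1}[w]mulr1 -mulrDr ler_wpM2l // sum_end_weight_le.
apply: lerD => //; apply: normr_fdiff_le => i ir; set y := x + _.
have t0 : 0 <= end_weight i by rewrite end_weightE; case: ifP => _; [|case: ifP => _]; lra.
have [ya|ya] := ltP y a.
  have [h|h] := hl i ir; first by move: ya; rewrite /y; lra.
  rewrite (glue_left _ abN Fa (ltW ya)); have yk : y < k%:R by lra.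
  apply: le_trans (left_node w0 hP h yk) _.
  by rewrite end_weight_lt // -(ltr_nat R) (le_lt_trans h).
have [yb|yb] := leP y (N - b).
  by rewrite glue_middle ?ya ?yb // subrr normr0 mulr0 mulr_ge0.
have [h|h] := hr i ir; first by move: yb; rewrite /y; lra.
rewrite -natrB // in h; have yk : N - y < k%:R by lra.
have hl' := left_node w0 hP' h yk; rewrite /= subKr in hl'.
rewrite (glue_right _ abN Fb (ltW yb)) -(bin_sub ir); apply: le_trans hl' _.
by rewrite end_weight_gt // -(ltr_nat R) (le_lt_trans h).
Qed.

End Stencil.

Lemma extension (N w : R) (F : R -> R) : continuous F -> r%:R + 1 <= N ->
  (forall x s : R, 0 <= x -> 0 <= s <= 1 -> x + r%:R * s <= N ->
    `|fdiff r s F x| <= w) ->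
  exists f1 : R -> R, [/\ continuous f1,
    forall y, 0 <= y <= N -> `|F y - f1 y| <= w * We
  & forall x s, 0 <= s <= 1 -> `|fdiff r s f1 x| <= w * extension_const].
Proof.
move=> cF hN hF.
have w0 : 0 <= w.
  apply: le_trans (normr_ge0 _) (hF 0 0 (lexx _) _ _); first by rewrite lexx ler01.
  by rewrite mulr0 addr0 (le_trans _ hN).
have cF' : continuous (fun y => F (N - y)).
  move=> y; apply: (@continuous_comp _ _ _ (fun y => N - y) F); last exact: cF.
  by apply: continuousB; [exact: cst_continuous|exact: cvg_id].
have revF G x s : fdiff r s (fun y => G (N - y)) x = fdiff r s G (N - (x + r%:R * s)).
  rewrite fdiff_rev exprM sqrrN expr1n expr1n mul1r /fdiff; apply: eq_bigr => i _.
  by congr (_ * G _); ring.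
have hF' x s : 0 <= x -> 0 <= s <= 1 -> x + r%:R * s <= N ->
    `|fdiff r s (fun y => F (N - y)) x| <= w.
  move=> x0 s01 xN; rewrite revF; apply: hF => //; lra.
have [P [a [sP ha Fa hP1 hP2]]] := whitney k0 cF hN hF.
have [P' [b [sP' hb Fb hP1' hP2']]] := whitney k0 cF' hN hF'.
have hP : whitney_bounds w F P by [].
have hP' : whitney_bounds w (fun y => F (N - y)) P' by [].
have rE : r%:R = 2 * k%:R :> R by rewrite natrM.
have k1 : 1 <= (k%:R : R) by rewrite ler1n.
have /andP[a1 a2] := ha; have /andP[b1 b2] := hb.
have N1 := hN; rewrite rE in N1.
have abN : a <= N - b by lra.
exists (glue F P a P' b N); split; first exact: continuous_glue.
  move=> y /andP[y0 yN].
  have [ya|ya] := ltP y a.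
    rewrite (glue_left _ abN Fa (ltW ya)); have yk : y < k%:R by lra.
    by have := left_node (i := 0) w0 hP y0 yk; rewrite bin0 mul1r.
  have [yb|yb] := leP y (N - b).
    by rewrite glue_middle ?ya ?yb // subrr normr0 mulr_ge0 // ltW // whitney_end_gt0.
  rewrite (glue_right _ abN Fb (ltW yb)); have yk : N - y < k%:R by lra.
  have y0' : 0%:R <= N - y by lra.
  by have := left_node w0 hP' y0' yk; rewrite /= bin0 mul1r subKr.
move=> x s s01.
(* The alternatives: a node left of both a and its own index, the mirror image of this at the right
   end, or neither. In the last case the whole stencil lies in [0, N]. *)
have [[i [ir ya yi]]|hl] := pselect (exists i, [/\ (i <= r)%N, x + i%:R * s < a
    & x + i%:R * s < i%:R]).
  exact: (glue_stencil_left w0 hN sP ha hb Fa Fb hP hP' s01 ir ya yi).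
have [[i [ir yb yi]]|hr] := pselect (exists i, [/\ (i <= r)%N, N - (x + i%:R * s) < b
    & N - (x + i%:R * s) < r%:R - i%:R]).
  have -> : fdiff r s (glue F P a P' b N) x =
      fdiff r s (glue (fun y => F (N - y)) P' b P a N) (N - (x + r%:R * s)).
    rewrite -revF; apply: eq_fdiff => j _.
    by rewrite -glue_sym ?subKr // ; lra.
  have ir' := leq_subr i r.
  have e : N - (x + r%:R * s) + (r - i)%:R * s = N - (x + i%:R * s).
    by rewrite natrB //; ring.
  have Fa' : F (N - (N - a)) = P.[a] by rewrite subKr.
  have hP0 : whitney_bounds w (fun y => F (N - (N - y))) P.
    by under eq_fun do rewrite subKr.
  apply: (glue_stencil_left (F := fun y => F (N - y)) w0 hN sP' hb ha Fb Fa' hP' hP0 s01 ir').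
    by rewrite e.
  by rewrite e natrB.
have hl' i : (i <= r)%N -> a <= x + i%:R * s \/ i%:R <= x + i%:R * s.
  move=> ir; have [h|h] := leP a (x + i%:R * s); [by left|right].
  by rewrite leNgt; apply/negP => h'; apply: hl; exists i.
have hr' i : (i <= r)%N -> b <= N - (x + i%:R * s) \/ r%:R - i%:R <= N - (x + i%:R * s).
  move=> ir; have [h|h] := leP b (N - (x + i%:R * s)); [by left|right].
  by rewrite leNgt; apply/negP => h'; apply: hr; exists i.
apply: glue_stencil_middle => //; apply: hF => //.
  by have [] := hl' 0%N isT; rewrite mul0r addr0 //; lra.
by have [] := hr' r (leqnn _); lra.
Qed.

End Extension.

(** * Smoothing *)

Section AlternatingSums.
Variable R : realFieldType.
Implicit Types f p V : nat -> R.

Definition altsum f n i := \sum_(m < n) (-1) ^+ m * f (i + m)%N.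

Lemma altsumS f n i : altsum f n.+1 i = f i - altsum f n i.+1.
Proof.
rewrite /altsum big_ord_recl /= expr0 mul1r addn0 -sumrN; congr (_ + _).
by apply: eq_bigr => m _; rewrite /bump /= exprS -addSnnS; ring.
Qed.

Lemma altsum_bounds f n i : (forall j, 0 <= f j) -> (forall j, f j.+1 <= f j) ->
  0 <= altsum f n i <= f i.
Proof.
move=> f0 fd; elim: n i => [|n ih] i; first by rewrite /altsum big_ord0 lexx f0.
by rewrite altsumS; have := ih i.+1; have := fd i; lra.
Qed.

Lemma altsum_add f n i : f (i + n)%N = 0 -> altsum f n i + altsum f n i.+1 = f i.
Proof.
move=> fin; have -> : altsum f n i = altsum f n.+1 i.
  by rewrite /altsum big_ord_recr /= fin mulr0 addr0.
by rewrite altsumS subrK.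
Qed.

Lemma altsum_antitone f n i : (forall j, f j.+1 <= f j) ->
  (forall j, f j.+1 - f j.+2 <= f j - f j.+1) ->
  altsum f n i.+1 <= altsum f n i.
Proof.
move=> fd fc; have h := @altsum_bounds (fun j => f j - f j.+1) n i.
rewrite -subr_ge0 (_ : _ - _ = altsum (fun j => f j - f j.+1) n i).
  by have /andP[] := h (fun j => ltac:(by rewrite subr_ge0)) fc.
by rewrite /altsum -sumrB; apply: eq_bigr => m _; rewrite addSn; ring.
Qed.

Lemma altsum0 f n i : (forall j, (i <= j)%N -> f j = 0) -> altsum f n i = 0.
Proof. by move=> h; rewrite /altsum big1 // => m _; rewrite h ?mulr0 ?leq_addr. Qed.

Lemma alternating_by_parts V p n :
  \sum_(i < n) (-1) ^+ i * (V i + V i.+1) * p i.+1 =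
  \sum_(i < n) (-1) ^+ i * V i * (p i.+1 - p i) + V 0%N * p 0%N
    - (-1) ^+ n * V n * p n.
Proof.
elim: n => [|n ih]; first by rewrite !big_ord0 expr0 mul1r add0r subrr.
by rewrite !big_ord_recr /= ih exprS; ring.
Qed.

End AlternatingSums.

(** * Coefficients of the smoothing operator and its norm *)

Section SmoothingCoefficients.
Variables (R : realType) (k : nat).
Hypothesis k0 : (0 < k)%N.
Local Notation r := (2 * k)%N.
Local Notation gam := ('C(r, k)%:R : R).

Definition side_bin j : R := 'C(r, k + j)%:R.

(* the coefficients [2 C(2k,k+j) / (C(2k,k) j^2)], indexed by [i = j - 1] *)
Definition smooth_coef i : R := 2 * side_bin i.+1 / (gam * i.+1%:R ^+ 2).

Lemma side_bin0 j : (k < j)%N -> side_bin j = 0.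
Proof. by move=> kj; rewrite /side_bin bin_small //; lia. Qed.

Lemma center_gt0 : 0 < gam.
Proof. by rewrite ltr0n bin_gt0; lia. Qed.

Lemma smooth_coef0 i : (k <= i)%N -> smooth_coef i = 0.
Proof. by move=> ki; rewrite /smooth_coef side_bin0 ?ltnS // mulr0 mul0r. Qed.

Lemma smooth_coef_ge0 i : 0 <= smooth_coef i.
Proof. by rewrite divr_ge0 // mulr_ge0 // exprn_ge0. Qed.

Lemma side_binS j : (k%:R + j.+1%:R) * side_bin j.+1 = (k%:R - j%:R) * side_bin j.
Proof.
have [kj|jk] := ltnP k j; first by rewrite !side_bin0 ?mulr0 //; lia.
rewrite /side_bin addnS -natrD -natrB // -!natrM addnS; congr _%:R.
by rewrite mul_bin_left; congr (_ * _)%N; lia.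
Qed.

Lemma side_bin_le i j : (i <= j)%N -> side_bin j <= side_bin i.
Proof.
move=> ij; rewrite ler_nat; have [h|h] := leqP (k + j) r.
  by apply: leq_bin_right; lia.
by rewrite bin_small.
Qed.

(** With n = i + 2, the neighbours of the middle binomial are it times 1 + (2n-1)/(k-n+1) and 1 -
    (2n+1)/(k+n+1). The second difference splits into that of 1/n^2 and the imbalance of these two
    corrections, each nonnegative. *)
Lemma smooth_coef_convex i :
  smooth_coef i.+1 - smooth_coef i.+2 <= smooth_coef i - smooth_coef i.+1.
Proof.
have [ki|ik] := leqP k i.+1.
  rewrite (smooth_coef0 ki) (smooth_coef0 (leqW ki)).
  by have := smooth_coef_ge0 i; lra.
pose K : R := k%:R; pose n : R := i.+2%:R; set b := side_bin i.+2.
have b0 : 0 <= b by rewrite ler0n.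
have n2 : 2 <= n by rewrite ler_nat.
have nK : n <= K by rewrite ler_nat.
have e1 : i.+1%:R = n - 1 :> R by rewrite /n -(natr1 i.+1) addrK.
have e3 : i.+3%:R = n + 1 :> R by rewrite /n natr1.
have s1 : side_bin i.+1 = b * ((K + n) / (K - n + 1)).
  have h : (K - (n - 1)) * side_bin i.+1 = (K + n) * b.
    by rewrite -e1; exact/esym/(side_binS i.+1).
  have z : K - n + 1 != 0 by apply: lt0r_neq0; lra.
  rewrite mulrA; apply: (canRL (mulfK z)).
  by rewrite [RHS]mulrC -h; ring.
have s3 : side_bin i.+3 = b * ((K - n) / (K + n + 1)).
  have h : (K + (n + 1)) * side_bin i.+3 = (K - n) * b.
    by rewrite -e3; exact/(side_binS i.+2).
  have z : K + n + 1 != 0 by apply: lt0r_neq0; lra.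
  rewrite mulrA; apply: (canRL (mulfK z)).
  by rewrite [RHS]mulrC -h; ring.
rewrite /smooth_coef e1 e3 s1 s3 -/n -/b.
clearbody K n b.
have n10 : n - 1 != 0 by apply: lt0r_neq0; lra.
have n00 : n != 0 by apply: lt0r_neq0; lra.
have n30 : n + 1 != 0 by apply: lt0r_neq0; lra.
have g0 := center_gt0; have g00 : gam != 0 by rewrite gt_eqF.
have z1 : K - n + 1 != 0 by apply: lt0r_neq0; lra.
have z3 : K + n + 1 != 0 by apply: lt0r_neq0; lra.
set u := (n - 1) ^- 2; set v := (n + 1) ^- 2.
have u0 : 0 <= u by rewrite invr_ge0 exprn_ge0 //; lra.
have v0 : 0 <= v by rewrite invr_ge0 exprn_ge0 //; lra.
have q : 0 <= (2 * n - 1) * u / (K - n + 1) - (2 * n + 1) * v / (K + n + 1).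
  have -> : (2 * n - 1) * u / (K - n + 1) - (2 * n + 1) * v / (K + n + 1) =
     ((2 * n - 1) * u - (2 * n + 1) * v) / (K - n + 1)
     + (2 * n + 1) * v * (2 * n) * ((K - n + 1) * (K + n + 1))^-1.
    by field; rewrite z1 z3.
  have h1 : 0 <= (2 * n - 1) * u - (2 * n + 1) * v.
    have -> : (2 * n - 1) * u - (2 * n + 1) * v =
        (6 * n ^+ 2 - 2) * (u * v).
      by rewrite /u /v; field; rewrite n10 n30.
    by rewrite !mulr_ge0 //; nra.
  apply: addr_ge0; first by rewrite divr_ge0 //; lra.
  by rewrite !mulr_ge0 ?invr_ge0 ?mulr_ge0 //; lra.
have q2 : 0 <= u + v - 2 * n ^- 2.
  have -> : u + v - 2 * n ^- 2 = (6 * n ^+ 2 - 2) * (u * v * n ^- 2).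
    by rewrite /u /v; field; rewrite n10 n30 n00.
  by apply: mulr_ge0; [nra|rewrite !mulr_ge0 ?invr_ge0 ?exprn_ge0 //; lra].
rewrite -subr_ge0.
set L := (X in 0 <= X).
have -> : L = 2 * b / gam * ((u + v - 2 * n ^- 2) +
    ((2 * n - 1) * u / (K - n + 1) - (2 * n + 1) * v / (K + n + 1))).
  by rewrite /L /u /v; field; rewrite n10 n00 n30 g00 z1 z3.
apply: mulr_ge0; last exact: addr_ge0.
by apply: divr_ge0; [exact: mulr_ge0|exact: ltW].
Qed.

Lemma smooth_coef_antitone i : smooth_coef i.+1 <= smooth_coef i.
Proof.
rewrite -subr_ge0; have [ki|ik] := leqP k i.
  by rewrite (smooth_coef0 ki) (smooth_coef0 (leqW ki)) subrr.
suff h d : smooth_coef (i + d)%N - smooth_coef (i + d).+1 <= smooth_coef i - smooth_coef i.+1.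
  have := h (k - i)%N; rewrite subnKC ?(ltnW ik) //.
  by rewrite (smooth_coef0 (leqnn k)) (smooth_coef0 (leqnSn k)) subrr.
elim: d => [|d ih]; first by rewrite addn0.
by apply: le_trans ih; rewrite addnS; exact: smooth_coef_convex.
Qed.

(** Successive quotients of the coefficient sequence by 1 + shift, one for each summation by parts
    in [smooth_opE]. Convexity of [smooth_coef] makes [coef_alt] antitone and thus [coef_abs]
    nonnegative. *)
Definition coef_alt i := altsum smooth_coef k i.
Definition coef_abs i := altsum coef_alt k i.

Lemma coef_alt_add i : coef_alt i + coef_alt i.+1 = smooth_coef i.
Proof. by apply: altsum_add; rewrite smooth_coef0 // leq_addl. Qed.

Lemma coef_alt0 i : (k <= i)%N -> coef_alt i = 0.
Proof. by move=> ki; apply: altsum0 => j ij; rewrite smooth_coef0 // (leq_trans ki). Qed.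

Lemma coef_alt_ge0 i : 0 <= coef_alt i.
Proof.
by have /andP[] := altsum_bounds k i smooth_coef_ge0 smooth_coef_antitone.
Qed.

Lemma coef_abs_add i : coef_abs i + coef_abs i.+1 = coef_alt i.
Proof. by apply: altsum_add; rewrite coef_alt0 // leq_addl. Qed.

Lemma coef_abs0 i : (k <= i)%N -> coef_abs i = 0.
Proof. by move=> ki; apply: altsum0 => j ij; rewrite coef_alt0 // (leq_trans ki). Qed.

Lemma coef_abs_ge0 i : 0 <= coef_abs i.
Proof.
have h j : coef_alt j.+1 <= coef_alt j.
  by apply: altsum_antitone; [exact: smooth_coef_antitone|exact: smooth_coef_convex].
by have /andP[] := altsum_bounds k i coef_alt_ge0 h.
Qed.

(** The l^1 norm of the coefficients of [side_op]: the central one plus twice the others regroups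
    into sums of neighbours, which are the [coef_alt]. *)
Definition smooth_norm : R := \sum_(i < k) coef_alt i.

Lemma smooth_norm_ge0 : 0 <= smooth_norm.
Proof. by apply: sumr_ge0 => i _; exact: coef_alt_ge0. Qed.

(** Pairing consecutive terms leaves the coefficients with odd j = 2l + 1. From j = 3 on the
    binomial is bounded by its value at 3, and (2l+1)^2 >= 4 l (l+1) makes the rest telescope. *)
Lemma smooth_norm_le :
  smooth_norm <= smooth_coef 0 + side_bin 3 / (2 * gam).
Proof.
have g0 := center_gt0; have g00 : gam != 0 by rewrite gt_eqF.
have e m : \sum_(i < 2 * m) coef_alt i = \sum_(l < m) smooth_coef (2 * l).
  elim: m => [|m ih]; first by rewrite muln0 !big_ord0.
  by rewrite mulnS !big_ord_recr /= ih -coef_alt_add addrA.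
apply: (@le_trans _ _ (\sum_(i < 2 * k) coef_alt i)).
  rewrite mul2n -addnn big_split_ord /= lerDl.
  by apply: sumr_ge0 => i _; exact: coef_alt_ge0.
rewrite e.
suff h m : \sum_(l < m.+1) smooth_coef (2 * l) <=
    smooth_coef 0 + side_bin 3 / (2 * gam) * (1 - m.+1%:R^-1).
  case: k k0 h => // m _ h; apply: le_trans (h m) _.
  rewrite lerD2l; apply: ler_piMr; last by rewrite gerBl invr_ge0.
  by rewrite divr_ge0 // mulr_ge0 // ltW.
elim: m => [|m ih].
  by rewrite big_ord1 invr1 subrr mulr0 addr0.
rewrite big_ord_recr /=; set S := \sum_(_ < _) _ in ih *.
suff h2 : smooth_coef (2 * m.+1) <=
    side_bin 3 / (2 * gam) * (m.+1%:R^-1 - m.+2%:R^-1).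
  apply: le_trans (lerD ih h2) _; rewrite -addrA -mulrDr (_ : 1 - _ + _ = 1 - m.+2%:R^-1) //; ring.
set x : R := m.+1%:R; have x1 : 1 <= x by rewrite ler1n.
have -> : m.+2%:R = x + 1 by rewrite natr1.
have -> : side_bin 3 / (2 * gam) * (x^-1 - (x + 1)^-1) =
   2 * side_bin 3 / (gam * (4 * x ^+ 2 + 4 * x)).
  field; rewrite g00 !lt0r_neq0 //; nra.
rewrite /smooth_coef; apply: ler_pM.
- by rewrite mulr_ge0.
- by rewrite invr_ge0 mulr_ge0 // exprn_ge0.
- by rewrite ler_wpM2l // side_bin_le // mulnS.
have -> : (2 * m.+1).+1%:R = 2 * x + 1 :> R by rewrite -natr1 natrM.
rewrite lef_pV2 ?posrE ?mulr_gt0 // ?ler_wpM2l //; nra.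
Qed.

End SmoothingCoefficients.

(** * Smoothing by a difference of a second primitive *)

Section SmoothingOperator.
Variables (R : realType) (k : nat).
Hypothesis k0 : (0 < k)%N.
Local Notation r := (2 * k)%N.
Local Notation gam := ('C(r, k)%:R : R).
Implicit Types g h : R -> R.

Definition shift_sum i s h (x : R) : R := h (x + i%:R * s) + h (x - i%:R * s).
Definition diff2 h (x : R) : R := shift_sum 1 1 h x - 2 * h x.

Lemma fdiff_center s h x : (-1) ^+ k * fdiff r s h (x - k%:R * s) =
  gam * h x + \sum_(j < k) (-1) ^+ j.+1 * side_bin R k j.+1 * shift_sum j.+1 s h x.
Proof.
have sgn (i : nat) : (-1) ^+ i * (-1) ^+ i = 1 :> R.
  by rewrite -exprD addnn -mul2n exprM sqrrN !expr1n.
rewrite /fdiff (_ : (2 * k).+1 = k + (1 + k))%N; last by lia.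
rewrite !big_split_ord /= big_ord1 addrCA mulrDr; congr (_ + _).
  by rewrite addn0 !mulrA sgn mul1r subrK.
rewrite [X in X + _](reindex_inj rev_ord_inj) /= -big_split mulr_sumr /=.
apply: eq_bigr => j _; have jk := ltn_ord j.
rewrite /shift_sum /side_bin mulrDr.
have -> : (k + (1 + j))%N = (k + j.+1)%N by [].
have -> : 'C(2 * k, k - j.+1) = 'C(2 * k, k + j.+1).
  by rewrite -(@bin_sub _ (k - j.+1)); [congr 'C(_, _)|]; nlia.
have e m : (m <= k)%N -> (-1) ^+ (k - m) = (-1) ^+ k * (-1) ^+ m :> R.
  by move=> mk; rewrite -[in RHS](subnK mk) exprD -mulrA sgn mulr1.
rewrite (e _ jk) exprD natrB // natrD.
have -> : x - k%:R * s + (k%:R - j.+1%:R) * s = x - j.+1%:R * s by ring.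
have -> : x - k%:R * s + (k%:R + j.+1%:R) * s = x + j.+1%:R * s by ring.
have := sgn k; set u := (-1) ^+ k; set v := (-1) ^+ _ => uu.
by rewrite !mulrA uu !mul1r; ring.
Qed.

Definition smooth_op h x : R :=
  \sum_(j < k) (-1) ^+ j * smooth_coef R k j * (shift_sum j.+1 1 h x - 2 * h x).

Lemma has_deriv_shift_sum i s h dh x : (forall x, has_deriv h x (dh x)) ->
  has_deriv (shift_sum i s h) x (shift_sum i s dh x).
Proof.
move=> H; apply: has_deriv_eq.
  apply: has_derivD.
    by have := @has_deriv_affine _ h (i%:R * s) 1 x _ (H _);
      under eq_fun do rewrite mul1r addrC; exact.
  by have := @has_deriv_affine _ h (- (i%:R * s)) 1 x _ (H _);
      under eq_fun do rewrite mul1r addrC; exact.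
by rewrite !mul1r /shift_sum ![_ + x]addrC.
Qed.

Lemma has_deriv_smooth_op h dh x : (forall x, has_deriv h x (dh x)) ->
  has_deriv (smooth_op h) x (smooth_op dh x).
Proof.
move=> H; apply: has_deriv_sum => j _; apply: has_derivZ.
by apply: has_derivB; [exact: has_deriv_shift_sum|exact/has_derivZ/H].
Qed.

(** In the step s, [Phi] is the second primitive, with zero initial data, of the signed centered
    difference of g at x; integrating twice divides the term of g (x +- j s) by j^2. At s = 1 this
    gives g - u = (2 / C(2k,k)) Phi(1), and |Phi(1)| <= B / 2. *)
Lemma smoothing g B : continuous g ->
  (forall x s : R, 0 <= s <= 1 -> `|fdiff r s g x| <= B) ->
  exists u u1 : R -> R, [/\ forall x, has_deriv u x (u1 x),
    forall x, has_deriv u1 x (smooth_op g x)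
  & forall x, `|g x - u x| <= B / gam].
Proof.
move=> cg hB.
have [G1 hG1] := exists_primitive cg.
have [G2 hG2] := exists_primitive (has_deriv_continuous hG1).
exists (smooth_op G2), (smooth_op G1); split.
- by move=> x; apply: has_deriv_smooth_op.
- by move=> x; apply: has_deriv_smooth_op.
move=> x; have g0 : 0 < gam := center_gt0 R k0; have g00 : gam != 0 by rewrite gt_eqF.
pose c j : R := (-1) ^+ j.+1 * side_bin R k j.+1.
pose Phi s := \sum_(j < k) c j / j.+1%:R ^+ 2 * (shift_sum j.+1 s G2 x - 2 * G2 x)
   + gam * g x / 2 * (s * s).
pose Phi1 s := \sum_(j < k) c j / j.+1%:R * (G1 (x + j.+1%:R * s) - G1 (x - j.+1%:R * s))
   + gam * g x * s.
pose Phi2 s := (-1) ^+ k * fdiff r s g (x - k%:R * s).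
have aff (h dh : R -> R) (d s : R) : (forall y, has_deriv h y (dh y)) ->
    has_deriv (fun s => h (x + d * s)) s (d * dh (x + d * s)).
  by move=> H; exact: has_deriv_affine.
have affN (h dh : R -> R) (d s : R) : (forall y, has_deriv h y (dh y)) ->
    has_deriv (fun s => h (x - d * s)) s (- d * dh (x - d * s)).
  move=> H; have := aff h dh (- d) s H; under eq_fun do rewrite mulNr.
  by rewrite !mulNr.
have d1 s : has_deriv Phi s (Phi1 s).
  apply: has_derivD; last first.
    apply: has_deriv_eq.
      by apply: has_derivZ; apply: has_derivM; exact: has_deriv_id.
    by rewrite /=; field.
  apply: has_deriv_sum => j _; apply: has_deriv_eq.
    apply: has_derivZ; apply: has_derivB; last exact: has_deriv_cst.
    by apply: has_derivD; [exact: aff|exact: affN].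
  rewrite /= /Phi1; have : j.+1%:R != 0 :> R by rewrite pnatr_eq0.
  by move: (j.+1%:R) (G1 _) (G1 _) => z ? ? z0; field.
have d2 s : has_deriv Phi1 s (Phi2 s).
  apply: has_deriv_eq.
    apply: has_derivD; last by apply: has_derivZ; exact: has_deriv_id.
    apply: has_deriv_sum => j _; apply: has_derivZ; apply: has_derivB.
      by apply: aff; exact: hG1.
    by apply: affN; exact: hG1.
  rewrite /Phi2 fdiff_center mulr1 addrC; congr (_ + _); apply: eq_bigr => j _.
  rewrite /shift_sum /c /=; have : j.+1%:R != 0 :> R by rewrite pnatr_eq0.
  by move: (j.+1%:R) (g _) (g _) => z ? ? z0; field.
have P0 : Phi 0 = 0.
  rewrite /Phi !mulr0 addr0 big1 // => j _.
  by rewrite /shift_sum mulr0 subr0 addr0; ring.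
have P10 : Phi1 0 = 0.
  by rewrite /Phi1 mulr0 addr0 big1 // => j _; rewrite mulr0 subr0 addr0 subrr mulr0.
have hP2 s : 0 <= s <= 1 -> `|Phi2 s| <= B.
  by move=> hs; rewrite normrM normrX normrN1 expr1n mul1r; exact: hB.
have h := second_derive_bound (fun s _ => d1 s) (fun s _ => d2 s) P0 P10 hP2.
have e : g x - smooth_op G2 x = 2 / gam * Phi 1.
  rewrite /Phi mulrDr addrC; congr (_ + _); last by field.
  rewrite /smooth_op -sumrN mulr_sumr; apply: eq_bigr => j _.
  rewrite /c /smooth_coef (exprS (-1) j); have : j.+1%:R != 0 :> R by rewrite pnatr_eq0.
  move: (j.+1%:R) (shift_sum _ _ _ _) => z ? z0; by field; rewrite g00 z0.
have c0 : 0 <= 2 / gam by rewrite divr_ge0 // ltW.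
rewrite e normrM (ger0_norm c0); apply: le_trans (ler_wpM2l c0 h) _.
by rewrite (_ : 2 / gam * (B / 2) = B / gam) //; field.
Qed.

Definition side_op h x : R := \sum_(i < k) (-1) ^+ i * coef_abs R k i *
  (if (i == 0 :> nat) then h x else shift_sum i 1 h x).

Lemma smooth_opE h x : smooth_op h x = side_op (diff2 h) x.
Proof.
pose a i : R := shift_sum i 1 h x.
(* First differences of [a], with index raised by one. The value 0 at index 0 removes the boundary
   term and makes the central term of [side_op] the plain second difference. *)
pose u i : R := if i is i'.+1 then a i'.+1 - a i' else 0.
have a0 : a 0%N = 2 * h x by rewrite /a /shift_sum mul0r subr0 addr0; ring.
have -> : side_op (diff2 h) x =
    \sum_(i < k) (-1) ^+ i * coef_abs R k i * (u i.+1 - u i).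
  apply: eq_bigr => -[i ik] _ /=; congr (_ * _); case: i ik => [|i] _ /=.
    by rewrite subr0 a0.
  rewrite /a /diff2 /shift_sum -(natr1 i.+1) -(natr1 i) (mulr1n 1) !mulr1.
  have -> : x + (i%:R + 1 + 1) = x + (i%:R + 1) + 1 by ring.
  have -> : x - (i%:R + 1 + 1) = x - (i%:R + 1) - 1 by ring.
  have -> : x + (i%:R + 1) - 1 = x + i%:R by ring.
  have -> : x - (i%:R + 1) + 1 = x - i%:R by ring.
  by ring.
have := alternating_by_parts (coef_abs R k) u k.
rewrite (coef_abs0 R k0 (leqnn k)) (mulr0 ((-1) ^+ k)) mul0r subr0 mulr0 addr0 => <-.
under eq_bigr do rewrite coef_abs_add //.
have := alternating_by_parts (coef_alt R k) a k.
rewrite (coef_alt0 R k0 (leqnn k)) mulr0 mul0r subr0 => /esym/(canRL (addrK _)) ->.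
rewrite /smooth_op; under eq_bigr do rewrite mulrBr.
rewrite sumrB -mulr_suml -a0; congr (_ - _ * _).
by apply: eq_bigr => i _; rewrite coef_alt_add.
Qed.

End SmoothingOperator.

(** * Commuting translations and iterated smoothing *)

Section TranslationOperators.
Variable R : realType.
Implicit Types (T U : (R -> R) -> R -> R) (h : R -> R).

Definition translation_op T : Prop :=
  exists l : seq (R * R), forall h x, T h x = \sum_(p <- l) p.1 * h (x + p.2).

Lemma translation_op_comm T U : translation_op T -> translation_op U ->
  forall h x, T (U h) x = U (T h) x.
Proof.
move=> [l hT] [m hU] h x; rewrite hT hU.
under eq_bigr do rewrite hU mulr_sumr; under [RHS]eq_bigr do rewrite hT mulr_sumr.
rewrite exchange_big; apply: eq_bigr => p _; apply: eq_bigr => q _.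
by rewrite mulrCA addrAC.
Qed.

Lemma translation_op_shift (d : R) : translation_op (fun h x => h (x + d)).
Proof. by exists [:: (1, d)] => h x; rewrite big_seq1 mul1r. Qed.

Lemma translation_op_id : translation_op (fun h x => h x).
Proof. by exists [:: (1, 0)] => h x; rewrite big_seq1 mul1r addr0. Qed.

Lemma translation_opD T U : translation_op T -> translation_op U ->
  translation_op (fun h x => T h x + U h x).
Proof. by move=> [l hT] [m hU]; exists (l ++ m) => h x; rewrite hT hU big_cat. Qed.

Lemma translation_opZ c T : translation_op T -> translation_op (fun h x => c * T h x).
Proof.
move=> [l hT]; exists [seq (c * p.1, p.2) | p <- l] => h x.
by rewrite hT big_map mulr_sumr; apply: eq_bigr => p _; rewrite mulrA.
Qed.

Lemma translation_op_sum n (T : nat -> (R -> R) -> R -> R) :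
  (forall i, translation_op (T i)) ->
  translation_op (fun h x => \sum_(i < n) T i h x).
Proof.
move=> hT; elim: n => [|n ih]; first by exists [::] => h x; rewrite big_nil big_ord0.
have [l hl] := translation_opD ih (hT n); exists l => h x.
by rewrite big_ord_recr -hl.
Qed.

Lemma translation_op_shift_sum i s : translation_op (@shift_sum R i s).
Proof. apply: translation_opD; exact: translation_op_shift. Qed.

Lemma translation_op_diff2 : translation_op (@diff2 R).
Proof.
have [l hl] := translation_opD (translation_op_shift_sum 1 1)
  (translation_opZ (- 2) translation_op_id).
by exists l => h x; rewrite -hl /diff2 mulNr.
Qed.

Lemma translation_op_fdiff r s : translation_op (@fdiff R r s).
Proof.
apply: (@translation_op_sum r.+1 (fun i h x => (-1) ^+ i * 'C(r, i)%:R * h (x + i%:R * s))) => i.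
by apply: translation_opZ; exact: translation_op_shift.
Qed.

Lemma translation_op_side_op k : translation_op (@side_op R k).
Proof.
apply: (@translation_op_sum k (fun i h x => (-1) ^+ i * coef_abs R k i *
  (if i == 0%N then h x else shift_sum i 1 h x))) => i.
apply: (@translation_opZ _ (fun h x => if i == 0%N then h x else shift_sum i 1 h x)).
by case: eqP => _; [exact: translation_op_id|exact: translation_op_shift_sum].
Qed.

Lemma continuous_translation_op T h : translation_op T -> continuous h ->
  continuous (T h).
Proof.
move=> [l hT] ch; rewrite (_ : T h = fun x => \sum_(p <- l) p.1 * h (x + p.2)); last first.
  by apply/funext => x; exact: hT.
elim: l {hT} => [|p l ih] x.
  rewrite (_ : (fun _ => _) = fun=> 0); first exact: cst_continuous.
  by apply/funext => y; rewrite big_nil.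
rewrite (_ : (fun _ => _) =
    fun y => p.1 * h (y + p.2) + \sum_(q <- l) q.1 * h (y + q.2)); last first.
  by apply/funext => y; rewrite big_cons.
apply: (@continuousD _ _ _ (fun y => p.1 * h (y + p.2))
  (fun y => \sum_(q <- l) q.1 * h (y + q.2))); last exact: ih.
apply: (@continuousM _ _ (fun=> p.1) (fun y => h (y + p.2))); first exact: cst_continuous.
apply: (@continuous_comp _ _ _ (fun y => y + p.2) h); last exact: ch.
by apply: (@continuousD _ _ _ (fun y => y) (fun=> p.2)); [exact: cvg_id|exact: cst_continuous].
Qed.

Lemma normr_diff2_le h B : (forall x, `|h x| <= B) -> forall x, `|diff2 h x| <= 4 * B.
Proof.
move=> hB x; rewrite /diff2 /shift_sum.
have := hB x; have := hB (x + 1%:R * 1); have := hB (x - 1%:R * 1).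
by move: (h _) (h _) (h _) => a b c; rewrite !ler_norml; lra.
Qed.

Variable k : nat.
Hypothesis k0 : (0 < k)%N.
Local Notation r := (2 * k)%N.
Local Notation M := (smooth_norm R k).

Lemma normr_side_op_le h B : 0 <= B -> (forall x, `|h x| <= B) ->
  forall x, `|side_op k h x| <= M * B.
Proof.
move=> B0 hB x.
have -> : M = \sum_(i < k) coef_abs R k i * (if (i == 0 :> nat) then 1 else 2).
  rewrite /smooth_norm; under eq_bigr do rewrite -coef_abs_add //.
  rewrite big_split /= ; case: k k0 => // k' _.
  rewrite big_ord_recl [X in _ + X]big_ord_recr /= (coef_abs0 R (ltn0Sn k') (leqnn k'.+1)) addr0.
  rewrite [RHS]big_ord_recl /= mulr1 -addrA -big_split /=; congr (_ + _).
  by apply: eq_bigr => i _; rewrite /bump /= mulr_natr mulr2n.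
rewrite mulr_suml; apply: le_trans (ler_norm_sum _ _ _) _; apply: ler_sum => i _.
rewrite !normrM normrX normrN1 expr1n mul1r ger0_norm ?coef_abs_ge0 //.
rewrite -mulrA ler_wpM2l ?coef_abs_ge0 //; case: ifP => _; first by rewrite mul1r.
rewrite /shift_sum; apply: le_trans (ler_normD _ _) _.
by rewrite mulrDl mul1r lerD.
Qed.

Lemma iter_diff2 h x : iter k (@diff2 R) h x = fdiff r 1 h (x - k%:R).
Proof.
elim: k h x => [|n ih] h x; first by rewrite fdiff0 subr0.
rewrite iterSr ih mulnS !fdiffS -(addrK 1 (x - n%:R)) -[in RHS]natr1.
rewrite /fdiff; apply: eq_bigr => i _; congr (_ * _).
rewrite /diff2 /shift_sum !mul1r.
set y := x - n%:R + 1 - 1 + i%:R * 1; have -> : x - (n%:R + 1) + i%:R * 1 = y - 1.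
  by rewrite /y; ring.
by rewrite subrK; ring.
Qed.

Definition smooth_iter (f : R -> R) i : R -> R := iter i (@smooth_op R k) f.

(** Differences commute with the operator, so each application costs only its norm: 4 for [diff2]
    times M for [side_op]. *)
Lemma fdiff_smooth_iter_le f B i : 0 <= B ->
  (forall x s, 0 <= s <= 1 -> `|fdiff r s f x| <= B) ->
  forall x s, 0 <= s <= 1 -> `|fdiff r s (smooth_iter f i) x| <= (4 * M) ^+ i * B.
Proof.
move=> B0 hB x s hs; have M0 := smooth_norm_ge0 R k0.
have hc j : 0 <= (4 * M) ^+ j * B by rewrite mulr_ge0 // exprn_ge0 // mulr_ge0.
elim: i x => [|i ih] x; first by rewrite expr0 mul1r; exact: hB.
have -> : fdiff r s (smooth_iter f i.+1) x =
    side_op k (diff2 (fdiff r s (smooth_iter f i))) x.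
  rewrite (_ : diff2 _ = fdiff r s (diff2 (smooth_iter f i))); last first.
    apply/funext => y; apply: translation_op_comm; first exact: translation_op_diff2.
    exact: translation_op_fdiff.
  rewrite -(translation_op_comm (translation_op_fdiff r s) (translation_op_side_op k)).
  by congr (fdiff _ _ _ _); apply/funext => y; exact: smooth_opE.
rewrite exprS (_ : _ * _ * _ = M * (4 * ((4 * M) ^+ i * B))); last by ring.
by apply: normr_side_op_le; [rewrite mulr_ge0|apply: normr_diff2_le].
Qed.

Lemma continuous_smooth_iter f i : continuous f -> continuous (smooth_iter f i).
Proof.
move=> cf; elim: i => // i ih.
rewrite (_ : smooth_iter f i.+1 = side_op k (diff2 (smooth_iter f i))); last first.
  by apply/funext => y; exact: smooth_opE.
apply: continuous_translation_op; first exact: translation_op_side_op.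
by apply: continuous_translation_op => //; exact: translation_op_diff2.
Qed.

(** All second differences are applied to f first, where together they form one difference of order
    2k. Hence M^k and not (4 M)^k. *)
Lemma smooth_iter_last_le f B : 0 <= B -> (forall x, `|fdiff r 1 f x| <= B) ->
  forall x, `|smooth_iter f k x| <= M ^+ k * B.
Proof.
move=> B0 hB; have M0 := smooth_norm_ge0 R k0.
have e i : smooth_iter f i = iter i (@side_op R k) (iter i (@diff2 R) f).
  elim: i => // i ih; rewrite [LHS]/= -/(smooth_iter f i) ih.
  have c h : diff2 (iter i (@side_op R k) h) = iter i (@side_op R k) (diff2 h).
    elim: i {ih} => // i ih; rewrite /= -ih; apply/funext => y.
    by apply: translation_op_comm; [exact: translation_op_diff2|exact: translation_op_side_op].
  by apply/funext => y; rewrite smooth_opE // c.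
rewrite e; set h := iter k (@diff2 R) f.
have hh x : `|h x| <= B by rewrite /h iter_diff2.
suff gen i x : `|iter i (@side_op R k) h x| <= M ^+ i * B by exact: gen.
elim: i x => [|i ih] x; first by rewrite expr0 mul1r.
rewrite exprS -mulrA; apply: normr_side_op_le => //.
by rewrite mulr_ge0 // exprn_ge0.
Qed.


End TranslationOperators.

(** * The discrete Fejer-Korovkin kernel and Jackson's inequality *)

Section FejerKorovkin.
Variable R : realType.

Lemma chebyshev_poly : exists T : nat -> {poly R}, forall d,
  (size (T d) <= d.+1)%N /\ forall t, cos (d%:R * t) = (T d).[cos t].
Proof.
suff /choice[T hT] : forall d, exists p : {poly R}, (size p <= d.+1)%N /\
  forall t, cos (d%:R * t) = p.[cos t] by exists T.
move=> d.
suff: exists p1 p2 : {poly R}, [/\ (size p1 <= d.+1)%N, (size p2 <= d.+2)%N,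
    forall t, cos (d%:R * t) = p1.[cos t] & forall t, cos (d.+1%:R * t) = p2.[cos t]].
  by move=> [p1 [p2 [s1 s2 h1 h2]]]; exists p1.
elim: d => [|d [p1 [p2 [s1 s2 h1 h2]]]].
  exists 1, 'X; split; rewrite ?size_poly1 ?size_polyX // => t.
    by rewrite mul0r cos0 hornerC.
  by rewrite mul1r hornerX.
exists p2, (2%:P * ('X * p2) - p1); split => // [|t].
  rewrite (leq_trans (size_polyD _ _)) // geq_max size_polyN (leq_trans s1) ?andbT; last by lia.
  by rewrite mul_polyC (leq_trans (size_scale_leq _ _)) // (leq_trans (size_polyMleq _ _)) // size_polyX.
rewrite hornerD hornerN !hornerM hornerC hornerX -h2 -h1.
have -> : d.+2%:R * t = d.+1%:R * t + t by rewrite -(natr1 d.+1); ring.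
have -> : d%:R * t = d.+1%:R * t - t by rewrite -(natr1 d); ring.
by rewrite cosD cosB; ring.
Qed.

Variable m : nat.
Local Notation q := m.+2.
Let phi : R := pi / q%:R.
Let theta (j : nat) : R := j%:R * (2 * phi).
Let rho : R := cos phi.

Lemma fk_phi : q%:R * phi = pi.
Proof. by rewrite /phi mulrC divfK // pnatr_eq0. Qed.

(** Multiplied by 2 sin(d phi), which is positive for 0 < d < q, the sum telescopes over d full
    turns. *)
Lemma sum_cos_nodes (b : R) d : (0 < d < q)%N ->
  \sum_(j < q) cos (b + d%:R * theta j) = 0.
Proof.
move=> /andP[d0 dq]; pose al : R := d%:R * phi.
have pi0 : 0 < pi :> R := pi_gt0 R.
have sal : 0 < sin al.
  apply: sin_gt0_pi; rewrite /al /phi mulr_gt0 ?divr_gt0 ?ltr0n //=.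
  by rewrite mulrCA gtr_pMr // ltr_pdivrMr ?ltr0n // mul1r ltr_nat.
pose u (j : nat) := sin (b - al + j%:R * (2 * al)).
have e : \sum_(j < q) (u j.+1 - u j) = 2 * sin al * \sum_(j < q) cos (b + d%:R * theta j).
  rewrite mulr_sumr; apply: eq_bigr => j _; rewrite /u.
  have -> : b - al + j.+1%:R * (2 * al) = (b + d%:R * theta j) + al.
    by rewrite -natr1 /theta /al; ring.
  have -> : b - al + j%:R * (2 * al) = (b + d%:R * theta j) - al.
    by rewrite /theta /al; ring.
  by rewrite sinD sinB; ring.
have uq : \sum_(j < q) (u j.+1 - u j) = 0.
  rewrite -(big_mkord xpredT (fun j => u j.+1 - u j)) telescope_sumr // /u mul0r addr0.
  have -> : q%:R * (2 * al) = pi *+ 2 *+ d.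
    by rewrite /al -(mulr_natr pi 2) -(mulr_natr _ d) -fk_phi; ring.
  by rewrite (periodicn (@sinD2pi R)) subrr.
move: e; rewrite uq => /esym/eqP; rewrite mulf_eq0 => /orP[|/eqP//].
by rewrite mulf_eq0 pnatr_eq0 /= gt_eqF.
Qed.

Lemma sum_sin_nodes (b : R) d : (0 < d < q)%N ->
  \sum_(j < q) sin (b + d%:R * theta j) = 0.
Proof.
move=> hd; rewrite -[RHS](sum_cos_nodes (b - pi / 2) hd); apply: eq_bigr => j _.
by rewrite addrAC cosBpihalf.
Qed.

Lemma node_cos l l' t : (l < l' + q)%N -> (l' < l + q)%N ->
  \sum_(j < q) cos ((l%:R - l'%:R) * (t + theta j)) = if l == l' then q%:R else 0.
Proof.
case: (ltngtP l l') => [h|h|->] h1 h2.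
- rewrite -[RHS](@sum_cos_nodes ((l' - l)%:R * t) (l' - l)); last by lia.
  apply: eq_bigr => j _; rewrite -mulrDr natrB ?(ltnW h) // -cosN; congr cos; ring.
- rewrite -[RHS](@sum_cos_nodes ((l - l')%:R * t) (l - l')); last by lia.
  by apply: eq_bigr => j _; rewrite -mulrDr natrB ?(ltnW h).
under eq_bigr do rewrite subrr mul0r cos0.
by rewrite sumr_const card_ord.
Qed.

Lemma node_sin l l' t : (l < l' + q)%N -> (l' < l + q)%N ->
  \sum_(j < q) sin ((l%:R - l'%:R) * (t + theta j)) = 0.
Proof.
case: (ltngtP l l') => [h|h|->] h1 h2.
- apply/eqP; rewrite -oppr_eq0 -sumrN; apply/eqP.
  rewrite -[RHS](@sum_sin_nodes ((l' - l)%:R * t) (l' - l)); last by lia.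
  apply: eq_bigr => j _; rewrite -mulrDr natrB ?(ltnW h) // -sinN; congr sin; ring.
- rewrite -[RHS](@sum_sin_nodes ((l - l')%:R * t) (l - l')); last by lia.
  by apply: eq_bigr => j _; rewrite -mulrDr natrB ?(ltnW h).
by under eq_bigr do rewrite subrr mul0r sin0; rewrite big1.
Qed.

Let a (l : nat) : R := sin (l.+1%:R * phi).
Let K (s : R) : R :=
  \sum_(l < m.+1) \sum_(l' < m.+1) a l * a l' * cos ((l%:R - l'%:R) * s).
Let Z : R := \sum_(l < m.+1) a l * a l.

(** The kernel is the squared modulus of the trigonometric sum with coefficients [a]. *)
Lemma fk_kernel_ge0 s : 0 <= K s.
Proof.
have -> : K s = (\sum_(l < m.+1) a l * cos (l%:R * s)) ^+ 2 +
                (\sum_(l < m.+1) a l * sin (l%:R * s)) ^+ 2.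
  rewrite !expr2 !mulr_suml -big_split /=; apply: eq_bigr => l _.
  rewrite !mulr_sumr -big_split /=; apply: eq_bigr => l' _.
  by rewrite mulrBl cosB; ring.
by rewrite addr_ge0 // sqr_ge0.
Qed.

Lemma fk_norm_gt0 : 0 < Z.
Proof.
rewrite /Z big_ord_recl /= ltr_wpDr //.
  by apply: sumr_ge0 => i _; exact: sqr_ge0.
suff h : 0 < a 0 by rewrite mulr_gt0.
have pi0 : 0 < pi :> R := pi_gt0 R.
apply: sin_gt0_pi; rewrite mul1r divr_gt0 ?ltr0n //=.
by rewrite ltr_pdivrMr ?ltr0n // ltr_pMr // ltr1n.
Qed.

Lemma fk_sum_nodes (F : R -> R) (c : nat -> nat -> R) t :
  (forall l l', (l <= m)%N -> (l' <= m)%N ->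
    \sum_(j < q) cos ((l%:R - l'%:R) * (t + theta j)) * F (t + theta j) = c l l') ->
  \sum_(j < q) K (t + theta j) * F (t + theta j) =
  \sum_(l < m.+1) \sum_(l' < m.+1) a l * a l' * c l l'.
Proof.
move=> h; under eq_bigr do rewrite mulr_suml.
rewrite exchange_big; apply: eq_bigr => l _ /=.
under eq_bigr do rewrite mulr_suml.
rewrite exchange_big; apply: eq_bigr => l' _ /=.
rewrite -(h l l' (ltn_ord l) (ltn_ord l')) mulr_sumr.
by apply: eq_bigr => j _; rewrite mulrA.
Qed.

Lemma fk_last : a m.+1 = 0.
Proof. by rewrite /a fk_phi sinpi. Qed.

Lemma fk_pick i (c : R) : (i <= m.+1)%N ->
  \sum_(l < m.+1) a l * (if i == l :> nat then c else 0) = a i * c.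
Proof.
rewrite leq_eqVlt => /predU1P[->|im].
  rewrite fk_last mul0r big1 // => l _; have := ltn_ord l.
  by rewrite ltn_neqAle eq_sym => /andP[/negPf -> _]; rewrite mulr0.
rewrite (bigD1 (Ordinal im)) //= eqxx big1 ?addr0 // => l /eqP il.
case: eqP => [e|]; last by rewrite mulr0.
by case: il; apply: val_inj; rewrite /= -e.
Qed.

Lemma fk_moment0 t : \sum_(j < q) K (t + theta j) = q%:R * Z.
Proof.
transitivity (\sum_(j < q) K (t + theta j) * 1).
  by apply: eq_bigr => j _; rewrite mulr1.
rewrite (@fk_sum_nodes (fun=> 1) (fun l l' => if l == l' then q%:R else 0)); last first.
  by move=> l l' lm lm'; under eq_bigr do rewrite mulr1; apply: node_cos; lia.
rewrite /Z mulr_sumr; apply: eq_bigr => l _.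
under eq_bigr do rewrite -mulrA.
rewrite -mulr_sumr fk_pick; last by rewrite ltnW // ltnS -ltnS ltn_ord.
by ring.
Qed.

(** The extra cosine pairs neighbouring weights. The recurrence a_(l+1) + a_(l-1) = 2 rho a_l with
    zero boundary values makes [a] an eigenvector, so the sum of the a_l a_(l+1) is rho Z.
    Frequencies reach only m + 1 < q, hence the node sums remain exact. *)
Lemma fk_moment_cos t : \sum_(j < q) K (t + theta j) * cos (t + theta j) = rho * (q%:R * Z).
Proof.
rewrite (@fk_sum_nodes cos (fun l l' => 2^-1 * (if l.+1 == l' then q%:R else 0) +
   2^-1 * (if l == l'.+1 then q%:R else 0))); last first.
  move=> l l' lm lm'; rewrite -!(node_cos t); try lia.
  rewrite !mulr_sumr -big_split /=; apply: eq_bigr => j _; move: (t + theta j) => s.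
  have -> : (l.+1%:R - l'%:R) * s = (l%:R - l'%:R) * s + s by rewrite -natr1; ring.
  have -> : (l%:R - l'.+1%:R) * s = (l%:R - l'%:R) * s - s by rewrite -natr1; ring.
  by rewrite cosD cosB; field.
under eq_bigr do under eq_bigr do rewrite mulrDr.
under eq_bigr do rewrite big_split /=.
rewrite big_split /= [X in _ + X]exchange_big /=.
have e1 : \sum_(l < m.+1) \sum_(l' < m.+1)
    a l * a l' * (2^-1 * (if l.+1 == l' :> nat then q%:R else 0)) =
    2^-1 * q%:R * \sum_(l < m.+1) a l * a l.+1.
  rewrite mulr_sumr; apply: eq_bigr => l _.
  transitivity (2^-1 * a l * \sum_(l' < m.+1) a l' * (if l.+1 == l' :> nat then q%:R else 0)).
    by rewrite mulr_sumr; apply: eq_bigr => l' _; move: (if _ then _ else _) => X; ring.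
  by rewrite fk_pick; [ring|rewrite ltn_ord].
have e2 : \sum_(l' < m.+1) \sum_(l < m.+1)
    a l * a l' * (2^-1 * (if l == l'.+1 :> nat then q%:R else 0)) =
    2^-1 * q%:R * \sum_(l < m.+1) a l * a l.+1.
  rewrite -e1; apply: eq_bigr => l _; apply: eq_bigr => l' _.
  by rewrite (mulrC (a l)) eq_sym.
rewrite e1 e2 -mulrDl.
have e3 : \sum_(l < m.+1) (2 * (a l * a l.+1) - 2 * rho * (a l * a l)) = 0.
  pose v l := sin (l%:R * phi) * sin (l.+1%:R * phi).
  transitivity (\sum_(l < m.+1) (v l.+1 - v l)).
    apply: eq_bigr => l _; rewrite /v /a /rho.
    have -> : l.+2%:R * phi = l.+1%:R * phi + phi by rewrite -(natr1 l.+1); ring.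
    have -> : l%:R * phi = l.+1%:R * phi - phi by rewrite -(natr1 l); ring.
    by rewrite sinD sinB; ring.
  rewrite -(big_mkord xpredT (fun l => v l.+1 - v l)) telescope_sumr // /v.
  by rewrite fk_phi sinpi mul0r sin0 mulr0 mul0r subrr.
move: e3; rewrite sumrB -!mulr_sumr -/Z => /eqP; rewrite subr_eq0 => /eqP e3.
have -> : \sum_(l < m.+1) a l * a l.+1 = rho * Z by lra.
by field.
Qed.

Lemma fk_moment_sin t : \sum_(j < q) K (t + theta j) * sin (t + theta j) = 0.
Proof.
rewrite (@fk_sum_nodes sin (fun _ _ => 0)); last first.
  move=> l l' lm lm'.
  have h1 := @node_sin l.+1 l' t; have h2 := @node_sin l l'.+1 t.
  transitivity (2^-1 * (\sum_(j < q) sin ((l.+1%:R - l'%:R) * (t + theta j)) -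
     \sum_(j < q) sin ((l%:R - l'.+1%:R) * (t + theta j)))); last first.
    by rewrite h1 ?h2 ?subrr ?mulr0 //; lia.
  rewrite -sumrB mulr_sumr; apply: eq_bigr => j _; move: (t + theta j) => s.
  have -> : (l.+1%:R - l'%:R) * s = (l%:R - l'%:R) * s + s by rewrite -natr1; ring.
  have -> : (l%:R - l'.+1%:R) * s = (l%:R - l'%:R) * s - s by rewrite -natr1; ring.
  by rewrite sinD sinB; field.
by rewrite big1 // => l _; rewrite big1 // => l' _; rewrite mulr0.
Qed.

Lemma fk_moment_node t : \sum_(j < q) K (t + theta j) * cos (theta j) =
  rho * (q%:R * Z) * cos t.
Proof.
transitivity (\sum_(j < q) (K (t + theta j) * cos (t + theta j) * cos t +
    K (t + theta j) * sin (t + theta j) * sin t)); last first.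
  by rewrite big_split /= -!mulr_suml fk_moment_cos fk_moment_sin mul0r addr0.
apply: eq_bigr => j _; have -> : cos (theta j) = cos (t + theta j - t) by congr cos; ring.
by rewrite cosB; ring.
Qed.

(** Up to normalisation, [w j] is the part of K(t + theta_j) even in t, which is a polynomial of
    degree at most m in x = cos t; its moments average those at t and -t. *)
Lemma fejer_korovkin : exists (w : nat -> {poly R}) (y : nat -> R),
  [/\ forall j, (size (w j) <= m.+1)%N, forall j, -1 <= y j <= 1 &
  forall x, -1 <= x <= 1 -> [/\ forall j, 0 <= (w j).[x],
    \sum_(j < q) (w j).[x] = 1, \sum_(j < q) (w j).[x] * y j = rho * x
  & \sum_(j < q) (w j).[x] * (x - y j) ^+ 2 <= 2 * (1 - rho)]].
Proof.
have [T hT] := chebyshev_poly.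
have Z0 := fk_norm_gt0; have q0 : 0 < q%:R :> R by rewrite ltr0n.
have W0 : 0 < q%:R * Z by rewrite mulr_gt0.
have Wn : q%:R * Z != 0 by rewrite gt_eqF.
pose dist l l' := ((l - l') + (l' - l))%N.
exists (fun j => (q%:R * Z)^-1 *: \sum_(l < m.+1) \sum_(l' < m.+1)
  (a l * a l' * cos ((l%:R - l'%:R) * theta j)) *: T (dist l l')).
exists (fun j => cos (theta j)); split.
- move=> j; apply: leq_trans (size_scale_leq _ _) _.
  apply: leq_trans (size_sum _ _ _) _; apply/bigmax_leqP => l _.
  apply: leq_trans (size_sum _ _ _) _; apply/bigmax_leqP => l' _.
  apply: leq_trans (size_scale_leq _ _) _; apply: leq_trans (proj1 (hT _)) _.
  by have := ltn_ord l; have := ltn_ord l'; rewrite /dist; lia.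
- by move=> j; rewrite cos_geN1 cos_le1.
move=> x hx; pose t := acos x.
have xt : x = cos t by rewrite /t acosK // in_itv.
have wE j : ((q%:R * Z)^-1 *: \sum_(l < m.+1) \sum_(l' < m.+1)
    (a l * a l' * cos ((l%:R - l'%:R) * theta j)) *: T (dist l l')).[x] =
    (q%:R * Z)^-1 * (2^-1 * (K (t + theta j) + K (- t + theta j))).
  rewrite hornerZ horner_sum; congr (_ * _).
  rewrite -big_split mulr_sumr /=; apply: eq_bigr => l _.
  rewrite horner_sum -big_split mulr_sumr /=; apply: eq_bigr => l' _.
  rewrite hornerZ xt -(proj2 (hT _)).
  have -> : cos ((dist l l')%:R * t) = cos ((l%:R - l'%:R) * t).
    rewrite /dist; have [h|h] := leqP l l'.
      rewrite (eqP h : (l - l')%N = 0%N) add0n natrB // -cosN; congr cos; ring.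
    by rewrite (_ : (l' - l)%N = 0%N) ?addn0 ?natrB ?(ltnW h) //; lia.
  have -> : (l%:R - l'%:R) * (t + theta j) =
    (l%:R - l'%:R) * theta j + (l%:R - l'%:R) * t by ring.
  have -> : (l%:R - l'%:R) * (- t + theta j) =
    (l%:R - l'%:R) * theta j - (l%:R - l'%:R) * t by ring.
  by rewrite cosD cosB; field.
have cm c : \sum_(j < q) (q%:R * Z)^-1 * (2^-1 * (K (t + theta j) + K (- t + theta j))) * c j =
  (q%:R * Z)^-1 * (2^-1 * (\sum_(j < q) K (t + theta j) * c j +
    \sum_(j < q) K (- t + theta j) * c j)).
  rewrite -big_split !mulr_sumr /=; apply: eq_bigr => j _.
  by rewrite -mulrDl !mulrA.
split.
- by move=> j; rewrite wE !mulr_ge0 ?invr_ge0 ?addr_ge0 ?fk_kernel_ge0 // ltW.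
- under eq_bigr do rewrite wE.
  by rewrite -!mulr_sumr big_split /= !fk_moment0; move: (_ * Z) Wn => W Wn; field.
- under eq_bigr do rewrite wE.
  rewrite cm !fk_moment_node cosN xt; by move: (_ * Z) Wn => W Wn; field.
under eq_bigr do rewrite wE.
(* Adding (sin s + sin theta_j)^2 to the left side gives equality. *)
have hs s j : (cos s - cos (theta j)) ^+ 2 <= 2 - 2 * cos (s + theta j).
  rewrite cosD; have := sqr_ge0 (sin s + sin (theta j)).
  by have := cos2Dsin2 s; have := cos2Dsin2 (theta j); nra.
apply: (@le_trans _ _ ((q%:R * Z)^-1 * (2^-1 *
  (\sum_(j < q) K (t + theta j) * (2 - 2 * cos (t + theta j)) +
   \sum_(j < q) K (- t + theta j) * (2 - 2 * cos (- t + theta j)))))).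
  rewrite (cm (fun j => (x - cos (theta j)) ^+ 2)) ler_wpM2l ?invr_ge0 ?(ltW W0) //.
  rewrite ler_wpM2l ?invr_ge0 // lerD //.
    by apply: ler_sum => j _; rewrite ler_wpM2l ?fk_kernel_ge0 // xt.
  by apply: ler_sum => j _; rewrite ler_wpM2l ?fk_kernel_ge0 // xt -(cosN t).
have e s : \sum_(j < q) K (s + theta j) * (2 - 2 * cos (s + theta j)) =
    2 * (1 - rho) * (q%:R * Z).
  transitivity (2 * (\sum_(j < q) K (s + theta j)) -
      2 * \sum_(j < q) K (s + theta j) * cos (s + theta j)).
    by rewrite !mulr_sumr -sumrB; apply: eq_bigr => j _; ring.
  by rewrite fk_moment0 fk_moment_cos; ring.
by rewrite !e (_ : _^-1 * _ = 2 * (1 - rho)) //; move: (_ * Z) Wn => W Wn; field.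
Qed.

End FejerKorovkin.

(** * Jackson estimates by the kernel *)

Section Jackson.
Variable R : realType.
Implicit Types (g : R -> R) (p : {poly R}).

Lemma has_deriv_sin (x : R) : has_deriv (@sin R) x (cos x).
Proof. exact: is_derive_sin. Qed.

Lemma has_deriv_cos (x : R) : has_deriv (@cos R) x (- sin x).
Proof. exact: is_derive_cos. Qed.

Lemma one_sub_cos_le (x : R) : 1 - cos x <= x ^+ 2 / 2.
Proof.
pose f s := cos (0 + x * s) - 1; pose f1 s := x * - sin (0 + x * s).
pose f2 s := x * - (x * cos (0 + x * s)).
have h1 s : 0 <= s <= 1 -> has_deriv f s (f1 s).
  move=> _; rewrite /f1 -[X in has_deriv _ _ X]subr0.
  by apply: has_derivB (has_deriv_cst _ _); apply: has_deriv_affine; exact: has_deriv_cos.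
have h2 s : 0 <= s <= 1 -> has_deriv f1 s (f2 s).
  by move=> _; apply: has_derivZ; apply: has_derivN; apply: has_deriv_affine; exact: has_deriv_sin.
have := second_derive_bound h1 h2; rewrite /f /f1 mulr0 addr0 cos0 sin0 oppr0 mulr0 subrr.
move=> /(_ (x ^+ 2) erefl erefl); rewrite mulr1 add0r => h.
rewrite -[leLHS]opprB (le_trans _ (h _)) //; first by rewrite -normrN ler_norm.
move=> s _; rewrite /f2 mulrN mulrA normrN normrM -expr2 ger0_norm ?sqr_ge0 //.
by rewrite ler_piMr ?sqr_ge0 // cos_max.
Qed.

Lemma cos_ub (x : R) : 0 <= x -> cos x <= 1 - x ^+ 2 / 2 + x ^+ 4 / 24.
Proof.
have hX n (y : R) : has_deriv (fun t => t ^+ n.+1) y (n.+1%:R * y ^+ n).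
  elim: n => [|n ih]; first by rewrite expr0 mulr1; exact: has_deriv_id.
  rewrite (_ : (fun t => t ^+ n.+2) = fun t => t * t ^+ n.+1); last first.
    by apply/funext => t; rewrite exprS.
  apply: has_deriv_eq; first by apply: has_derivM; [exact: has_deriv_id|exact: ih].
  by rewrite -[n.+2%:R]natr1 (exprS y n) /=; ring.
have h1 (z : R) : 0 <= z -> sin z <= z.
  move=> z0; have := @derive_bound_ub _ sin cos (fun t => t) (fun=> 1) 0 z z0.
  rewrite sin0 !subr0; apply => t _; [exact: has_deriv_sin|exact: has_deriv_id|exact: cos_le1].
have h2 (z : R) : 0 <= z -> 1 - z ^+ 2 / 2 <= cos z.
  by move=> _; have := one_sub_cos_le z; lra.
have h3 (z : R) : 0 <= z -> z - z ^+ 3 / 6 <= sin z.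
  move=> z0; have := @derive_bound_ub _ (fun t => t - 6^-1 * t ^+ 3) (fun t => 1 - t ^+ 2 / 2)
    sin cos 0 z z0.
  rewrite sin0 !expr0n /= mulr0 !subr0 (mulrC _ 6^-1); apply => t.
  - move=> _; apply: has_derivB; first exact: has_deriv_id.
    by apply: has_deriv_eq; [apply: has_derivZ; exact: hX|field].
  - by move=> _; exact: has_deriv_sin.
  by move=> /andP[t0 _]; apply: h2; exact: ltW.
move=> x0; have := @derive_bound_ub _ cos (fun t => - sin t)
  (fun t => - (2^-1 * t ^+ 2) + 24^-1 * t ^+ 4) (fun t => - t + t ^+ 3 / 6) 0 x x0.
rewrite cos0 !expr0n /= !mulr0 oppr0 addr0 subr0 => h.
suff : cos x - 1 <= - (2^-1 * x ^+ 2) + 24^-1 * x ^+ 4 by lra.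
apply: h => t.
- by move=> _; exact: has_deriv_cos.
- move=> _; apply: has_derivD.
    by apply: has_deriv_eq; [apply: has_derivN; apply: has_derivZ; exact: hX|field].
  by apply: has_deriv_eq; [apply: has_derivZ; exact: hX|field].
by move=> /andP[t0 _]; have := h3 t (ltW t0); lra.
Qed.

(** The quartic Taylor bound makes cos(8/5) negative, so pi / 2 cannot exceed 8/5. *)
Lemma pi_ub : pi <= 16 / 5 :> R.
Proof.
rewrite leNgt; apply/negP => h.
have c : 0 < cos (8 / 5 : R).
  by apply: cos_gt0_pihalf; apply/andP; split; lra.
have := @cos_ub (8 / 5) _; rewrite (_ : _ + _ = - (13 / 1875)); last by field.
by move=> /(_ ltac:(lra)); lra.
Qed.

Definition approx (m : nat) (e : R) g : Prop := exists p, (size p <= m.+1)%N /\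
  forall x, -1 <= x <= 1 -> `|g x - p.[x]| <= e.

Lemma approx_le m e e' g : e <= e' -> approx m e g -> approx m e' g.
Proof. by move=> ee [p [sp hp]]; exists p; split => // x /hp /le_trans; exact. Qed.

Lemma approxD m e e' g h : approx m e g ->
  (forall x, -1 <= x <= 1 -> `|h x - g x| <= e') -> approx m (e' + e) h.
Proof.
move=> [p [sp hp]] hh; exists p; split => // x hx.
rewrite -(subrK (g x) (h x)) -addrA (le_trans (ler_normD _ _)) //.
by rewrite lerD ?hh ?hp.
Qed.

Lemma approxZ m e g (c : R) : 0 <= c -> approx m e g ->
  approx m (c * e) (fun x => c * g x).
Proof.
move=> c0 [p [sp hp]]; exists (c *: p); split; first exact: leq_trans (size_scale_leq _ _) _.
by move=> x hx; rewrite hornerZ -mulrBr normrM ger0_norm // ler_wpM2l // hp.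
Qed.

(** With d = pi / (m+2), |x - y| <= ((x - y)^2 / d + d) / 2 reduces the error to the second moment,
    at most 2 (1 - rho) <= d^2. *)
Lemma jackson_lipschitz m L g : 0 <= L ->
  (forall x y, -1 <= x <= 1 -> -1 <= y <= 1 -> `|g x - g y| <= L * `|x - y|) ->
  approx m (L * (pi / m.+2%:R)) g.
Proof.
move=> L0 hg; have [w [y [sw hy hw]]] := fejer_korovkin R m.
set d := pi / m.+2%:R in hw *; have d0 : 0 < d by rewrite divr_gt0 // pi_gt0.
have dn : d != 0 by rewrite gt_eqF.
clearbody d.
exists (\sum_(j < m.+2) g (y j) *: w j); split.
  apply: leq_trans (size_sum _ _ _) _; apply/bigmax_leqP => j _.
  exact: leq_trans (size_scale_leq _ _) (sw j).
move=> x hx; have [w0 w1 _ w2] := hw x hx.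
have -> : g x = \sum_(j < m.+2) g x * (w j).[x] by rewrite -mulr_sumr w1 mulr1.
rewrite horner_sum -sumrB.
apply: le_trans (ler_norm_sum _ _ _) _.
apply: (@le_trans _ _ (\sum_(j < m.+2) L / 2 * (w j).[x] * ((x - y j) ^+ 2 / d + d))).
  apply: ler_sum => j _; rewrite hornerZ -mulrBl normrM (ger0_norm (w0 j)).
  rewrite [leRHS](_ : _ = L * (2^-1 * ((x - y j) ^+ 2 / d + d)) * (w j).[x]); last by ring.
  rewrite ler_wpM2r // (le_trans (hg _ _ hx (hy j))) //.
  rewrite ler_wpM2l // -(ler_pM2l d0) -subr_ge0.
  rewrite -real_normK ?num_real //; move: `|x - y j| => z.
  have -> : d * (2^-1 * (z ^+ 2 / d + d)) - d * z = 2^-1 * (z - d) ^+ 2.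
    by field.
  by rewrite mulr_ge0 ?sqr_ge0 // invr_ge0.
have -> : \sum_(j < m.+2) L / 2 * (w j).[x] * ((x - y j) ^+ 2 / d + d) =
   L / (2 * d) * (\sum_(j < m.+2) (w j).[x] * (x - y j) ^+ 2) + L / 2 * d.
  transitivity (L / (2 * d) * (\sum_(j < m.+2) (w j).[x] * (x - y j) ^+ 2) +
      L / 2 * d * (\sum_(j < m.+2) (w j).[x])); last by rewrite w1 mulr1.
  by rewrite !mulr_sumr -big_split; apply: eq_bigr => j _ /=; field.
have -> : L * d = L / (2 * d) * d ^+ 2 + L / 2 * d by field.
rewrite lerD2r ler_wpM2l ?divr_ge0 ?mulr_ge0 ?(ltW d0) // (le_trans w2) //.
by have := one_sub_cos_le d; lra.
Qed.

Definition jackson_const (m : nat) : R :=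
  (pi / m.+2%:R) ^+ 2 / 2 * (1 + pi / m.+1%:R).

Lemma jackson_const_ge0 m : 0 <= jackson_const m.
Proof.
have pi0 : 0 <= pi :> R := ltW (pi_gt0 R).
by apply: mulr_ge0; [rewrite divr_ge0 // sqr_ge0|rewrite addr_ge0 // divr_ge0].
Qed.

Lemma taylor1 g g1 g2 e (x y : R) : (forall x, has_deriv g x (g1 x)) ->
  (forall x, has_deriv g1 x (g2 x)) ->
  (forall x, -1 <= x <= 1 -> `|g2 x| <= e) -> -1 <= x <= 1 -> -1 <= y <= 1 ->
  `|g y - g x - g1 x * (y - x)| <= e / 2 * (y - x) ^+ 2.
Proof.
move=> h1 h2 hb /andP[x1 x2] /andP[y1 y2]; set d := y - x.
pose f s := g (x + d * s) - g x - g1 x * d * s.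
pose f1 s := d * g1 (x + d * s) - g1 x * d.
pose f2 s := d * (d * g2 (x + d * s)).
have H1 s : 0 <= s <= 1 -> has_deriv f s (f1 s).
  move=> _; apply: has_derivB; last first.
    by apply: has_deriv_eq; [apply: has_derivZ; exact: has_deriv_id|rewrite mulr1].
  rewrite -[X in has_deriv _ _ X]subr0.
  by apply: has_derivB (has_deriv_cst _ _); apply: has_deriv_affine.
have H2 s : 0 <= s <= 1 -> has_deriv f1 s (f2 s).
  move=> _; rewrite -[X in has_deriv _ _ X]subr0.
  by apply: has_derivB (has_deriv_cst _ _); apply: has_derivZ; apply: has_deriv_affine.
have H3 s : 0 <= s <= 1 -> `|f2 s| <= d ^+ 2 * e.
  move=> /andP[s0 s1]; rewrite /f2 mulrA normrM -expr2 ger0_norm ?sqr_ge0 //.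
  rewrite ler_wpM2l ?sqr_ge0 // hb //.
  have -> : x + d * s = (1 - s) * x + s * y by rewrite /d; ring.
  by apply/andP; split; nra.
have e0 : f 0 = 0 by rewrite /f !mulr0 addr0 subrr subr0.
have e1 : f1 0 = 0 by rewrite /f1 mulr0 addr0 mulrC subrr.
have h := second_derive_bound H1 H2 e0 e1 H3.
rewrite (_ : _ - _ - _ = f 1); last by rewrite /f !mulr1 /d (addrC x) subrK.
by rewrite (_ : e / 2 * _ = d ^+ 2 * e / 2) //; ring.
Qed.

(** Since the kernel maps x to rho x, its operator shifts g by about (1 - rho) x g'(x). The term (1
    - rho) X q, with q approximating the Lipschitz function g', compensates this; the Taylor
    remainder is paid by the second moment. *)
Lemma jackson_second m g g1 g2 e : 0 <= e -> (forall x, has_deriv g x (g1 x)) ->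
  (forall x, has_deriv g1 x (g2 x)) ->
  (forall x, -1 <= x <= 1 -> `|g2 x| <= e) ->
  approx m.+1 (jackson_const m.+1 * e) g.
Proof.
move=> e0 h1 h2 hb; have [w [y [sw hy hw]]] := fejer_korovkin R m.+1.
have lip x z : -1 <= x <= 1 -> -1 <= z <= 1 -> `|g1 x - g1 z| <= e * `|x - z|.
  wlog xz : x z / z <= x => [hwlog hx hz|].
    have [|/ltW h] := leP z x; first by move/hwlog; exact.
    by rewrite distrC (distrC x); exact: hwlog.
  move=> /andP[x1 x2] /andP[z1 z2]; have xz0 : 0 <= x - z by rewrite subr_ge0.
  rewrite (ger0_norm xz0) mulrBr.
  have ed (t : R) : has_deriv (fun t => e * t) t e.
    by apply: has_deriv_eq; [exact/has_derivZ/has_deriv_id|rewrite mulr1].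
  apply: (@derive_bound _ g1 g2 (fun t => e * t) (fun=> e) z x xz) => // t /andP[t1 t2].
  by apply: hb; apply/andP; split; lra.
have [q [sq hq]] := jackson_lipschitz m e0 lip.
set rho := cos _ in hw.
have r0 : 0 <= 1 - rho by rewrite subr_ge0 cos_le1.
exists (\sum_(j < m.+3) g (y j) *: w j + (1 - rho) *: ('X * q)); split.
  apply: leq_trans (size_polyD _ _) _; rewrite geq_max; apply/andP; split.
    apply: leq_trans (size_sum _ _ _) _; apply/bigmax_leqP => j _.
    exact: leq_trans (size_scale_leq _ _) (sw j).
  apply: leq_trans (size_scale_leq _ _) _; apply: leq_trans (size_polyMleq _ _) _.
  by rewrite size_polyX.
move=> x hx; have [w0 w1 wy w2] := hw x hx.
have eS : \sum_(j < m.+3) (w j).[x] * (g (y j) - g x - g1 x * (y j - x)) =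
   \sum_(j < m.+3) (w j).[x] * g (y j) - g x + g1 x * (1 - rho) * x.
  transitivity (\sum_(j < m.+3) (w j).[x] * g (y j) - g x * (\sum_(j < m.+3) (w j).[x])
     - g1 x * (\sum_(j < m.+3) (w j).[x] * y j) + g1 x * x * (\sum_(j < m.+3) (w j).[x])).
    by rewrite !mulr_sumr -!sumrB -big_split; apply: eq_bigr => j _ /=; ring.
  by rewrite w1 wy; ring.
have -> : g x - (\sum_(j < m.+3) g (y j) *: w j + (1 - rho) *: ('X * q)).[x] =
   (1 - rho) * x * (g1 x - q.[x]) -
   \sum_(j < m.+3) (w j).[x] * (g (y j) - g x - g1 x * (y j - x)).
  rewrite eS hornerD horner_sum hornerZ hornerM hornerX.
  under eq_bigr do rewrite hornerZ mulrC.
  by ring.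
apply: le_trans (ler_normB _ _) _.
have hS : `|\sum_(j < m.+3) (w j).[x] * (g (y j) - g x - g1 x * (y j - x))| <= e * (1 - rho).
  apply: le_trans (ler_norm_sum _ _ _) _.
  apply: (@le_trans _ _ (e / 2 * \sum_(j < m.+3) (w j).[x] * (x - y j) ^+ 2)).
    rewrite mulr_sumr; apply: ler_sum => j _; rewrite normrM (ger0_norm (w0 j)).
    rewrite mulrCA ler_wpM2l // -sqrrN opprB; exact: taylor1 h1 h2 hb hx (hy j).
  rewrite (le_trans (ler_wpM2l _ w2)) ?divr_ge0 //.
  by rewrite (_ : e / 2 * (2 * (1 - rho)) = e * (1 - rho)) //; field.
have hL : `|(1 - rho) * x * (g1 x - q.[x])| <= (1 - rho) * (e * (pi / m.+2%:R)).
  rewrite !normrM (ger0_norm r0) -mulrA ler_wpM2l //.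
  have x1 : `|x| <= 1 by rewrite ler_norml.
  by rewrite -[leRHS]mul1r ler_pM // hq.
apply: le_trans (lerD hL hS) _.
rewrite [leLHS](_ : _ = (1 - rho) * (e * (1 + pi / m.+2%:R))); last by ring.
rewrite /jackson_const -mulrA (mulrC _ e); apply: ler_wpM2r.
  by rewrite mulr_ge0 // addr_ge0 // divr_ge0 // ltW // pi_gt0.
exact: one_sub_cos_le.
Qed.

Lemma poly_primitive p : exists q : {poly R}, (size q <= (size p).+1)%N /\ q^`() = p.
Proof.
exists (\poly_(i < (size p).+1) (if i is i'.+1 then p`_i' / i'.+1%:R else 0)).
split; first exact: size_poly.
apply/polyP => i; rewrite coef_deriv coef_poly ltnS.
case: ltnP => h; last by rewrite mul0rn nth_default.
by rewrite -(mulr_natr (p`_i / _)) divfK // pnatr_eq0.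
Qed.

(** Subtracting from g a double primitive of the approximant of g'' replaces the bound on the second
    derivative by the approximation error. *)
Lemma jackson_step m g g1 g2 e : 0 <= e -> (forall x, has_deriv g x (g1 x)) ->
  (forall x, has_deriv g1 x (g2 x)) -> approx m e g2 ->
  approx m.+2 (jackson_const m.+2 * e) g.
Proof.
move=> e0 h1 h2 [p [sp hp]].
have [p1 [s1 d1]] := poly_primitive p; have [p2 [s2 d2]] := poly_primitive p1.
have H1 x : has_deriv (fun y => g y - p2.[y]) x (g1 x - p1.[x]).
  by apply: has_derivB; rewrite // -d2; exact: has_deriv_horner.
have H2 x : has_deriv (fun y => g1 y - p1.[y]) x (g2 x - p.[x]).
  by apply: has_derivB; rewrite // -d1; exact: has_deriv_horner.
have [q [sq hq]] := jackson_second m.+1 e0 H1 H2 hp.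
exists (p2 + q); split; last by move=> x hx; rewrite hornerD opprD addrA; exact: hq.
rewrite (leq_trans (size_polyD _ _)) // geq_max sq andbT.
by rewrite (leq_trans s2) // !ltnS (leq_trans s1).
Qed.

Lemma jackson_step_scaled m u u1 u2 e (c d : R) : 0 <= e ->
  (forall x, has_deriv u x (u1 x)) -> (forall x, has_deriv u1 x (u2 x)) ->
  approx m e (fun x => u2 (c + d * x)) ->
  approx m.+2 (jackson_const m.+2 * d ^+ 2 * e) (fun x => u (c + d * x)).
Proof.
move=> e0 h1 h2 /(approxZ (sqr_ge0 d)) h; rewrite -mulrA.
apply: (@jackson_step _ _ (fun x => d * u1 (c + d * x))) h.
- by rewrite mulr_ge0 // sqr_ge0.
- by move=> x; exact: has_deriv_affine.
move=> x; rewrite expr2 -mulrA; apply: has_derivZ; exact: has_deriv_affine.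
Qed.

End Jackson.

(** * Iteration and numerical estimates *)

Section Recursion.
Variable R : realType.

(** Error at level i with d smoothing steps left, in units of (4 M)^i B: the smoothing error g, plus
    the Jackson factor times the error of the next level. *)
Fixpoint smooth_eps (g c : R) (th : nat -> R) d i : R :=
  if d is d'.+1 then g + th i * smooth_eps g c th d' i.+1 else c.

Lemma smooth_eps_ge0 g c th d i : 0 <= g -> 0 <= c -> (forall i, 0 <= th i) ->
  0 <= smooth_eps g c th d i.
Proof.
move=> g0 c0 h; elim: d i => //= d ih i.
by rewrite addr_ge0 // mulr_ge0.
Qed.

Lemma smooth_eps_le g c th t d i : 0 <= g -> 0 <= c -> (forall i, 0 <= th i) ->
  (forall j, (i <= j < i + d)%N -> th j <= t j) ->
  smooth_eps g c th d i <= smooth_eps g c t d i.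
Proof.
move=> g0 c0 h; elim: d i => //= d ih i ht.
rewrite lerD2l; apply: ler_pM => //; first exact: smooth_eps_ge0.
  by apply: ht; lia.
by apply: ih => j hj; apply: ht; lia.
Qed.

(** -2 g is the fixed point of x -> g + 3 x / 2. *)
Lemma smooth_eps_geom g c d i : 0 <= g ->
  smooth_eps g c (fun=> 3 / 2) d i <= (3 / 2) ^+ d * (2 * g + c) - 2 * g.
Proof.
move=> g0; elim: d i => [|d ih] i /=; first by rewrite expr0; lra.
by rewrite exprS -mulrA; have := ih i.+1; move: (_ ^+ d * _) => y; lra.
Qed.

Definition jackson_kappa (N : R) m : R := jackson_const R m * (N / 2) ^+ 2.

Lemma jackson_kappa_ge0 N m : 0 <= jackson_kappa N m.
Proof. by rewrite mulr_ge0 ?jackson_const_ge0 // sqr_ge0. Qed.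

(** Reduces every later case to rational data: A bounds N pi, rho bounds A / (m+2), and x0 bounds m
    + 1 from below. *)
Lemma jackson_kappa_le N m A rho x0 c : 0 <= N -> N * pi <= A ->
  A <= rho * m.+2%:R -> 0 < x0 -> x0 <= m.+1%:R ->
  rho ^+ 2 / 2 * (1 + 16 / 5 / x0) <= c ->
  4 * jackson_kappa N m <= c.
Proof.
move=> N0 NA Arho x00 xm; apply: le_trans; rewrite /jackson_kappa /jackson_const.
have pi0 : 0 < pi :> R := pi_gt0 R.
have m2 : 0 < m.+2%:R :> R by rewrite ltr0n.
have m1 : 0 < m.+1%:R :> R by rewrite ltr0n.
rewrite [leLHS](_ : _ = (N * pi / m.+2%:R) ^+ 2 / 2 * (1 + pi / m.+1%:R)); last first.
  by move: (m.+1%:R) (m.+2%:R) m1 m2 => x y x1 y1; field; rewrite !gt_eqF.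
apply: ler_pM.
- by rewrite divr_ge0 // sqr_ge0.
- by rewrite addr_ge0 // divr_ge0 // ltW.
- rewrite ler_pM2r ?invr_gt0 //.
  have h : 0 <= N * pi / m.+2%:R by rewrite divr_ge0 ?mulr_ge0 // ltW.
  rewrite lerXn2r ?nnegrE //; last by rewrite ler_pdivrMr // (le_trans NA).
  by rewrite -(ler_pM2r m2) mul0r (le_trans _ Arho) // (le_trans _ NA) // mulr_ge0 // ltW.
rewrite lerD2l; apply: ler_pM => //; try exact: ltW.
  exact: pi_ub.
by rewrite lef_pV2 ?posrE.
Qed.

Variable k : nat.
Hypothesis k0 : (0 < k)%N.
Local Notation r := (2 * k)%N.
Local Notation M := (smooth_norm R k).
Local Notation gam := ('C(r, k)%:R : R).

Definition smooth_theta n (N : R) i : R := M * (4 * jackson_kappa N (n - 2 * i)).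

Lemma smooth_theta_ge0 n N i : 0 <= smooth_theta n N i.
Proof. by apply: mulr_ge0; [exact: smooth_norm_ge0|rewrite mulr_ge0 // jackson_kappa_ge0]. Qed.

Lemma smooth_approx n (N B : R) f : (2 * k <= n)%N -> 0 <= B -> continuous f ->
  (forall x s, 0 <= s <= 1 -> `|fdiff r s f x| <= B) ->
  approx n (B * smooth_eps gam^-1 (4^-1 ^+ k) (smooth_theta n N) k 0)
    (fun x => f (N / 2 + N / 2 * x)).
Proof.
move=> kn B0 cf hB; have M0 := smooth_norm_ge0 R k0.
have gam0 : 0 < gam := center_gt0 R k0.
set eps := smooth_eps _ _ _.
suff gen d i : (i + d = k)%N -> approx (n - 2 * i) ((4 * M) ^+ i * B * eps d i)
    (fun x => smooth_iter k f i (N / 2 + N / 2 * x)).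
  by have := gen k 0%N (add0n k); rewrite expr0 mul1r muln0 subn0.
elim: d i => [|d ih] i idk.
  exists 0; split; first by rewrite size_poly0.
  move=> x _; rewrite horner0 subr0 /eps /=.
  have -> : i = k by rewrite -idk addn0.
  have h1 (y : R) : `|fdiff r 1 f y| <= B by apply: hB; rewrite ler01 lexx.
  rewrite (le_trans (smooth_iter_last_le k0 B0 h1 _)) //.
  by rewrite mulrAC -exprMn (_ : 4 * M * 4^-1 = M) //; field.
have {}ih := ih i.+1 (etrans (addSnnS _ _) idk).
have hs := fdiff_smooth_iter_le k0 (f := f) i B0 hB.
have cs : continuous (smooth_iter k f i) by apply: continuous_smooth_iter.
have [u [u1 [d1 d2 hu]]] := smoothing k0 cs hs.
have e0 : 0 <= (4 * M) ^+ i.+1 * B * eps d i.+1.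
  rewrite !mulr_ge0 ?exprn_ge0 ?mulr_ge0 //.
  apply: smooth_eps_ge0; rewrite ?invr_ge0 ?exprn_ge0 ?invr_ge0 ?(ltW gam0) //.
  by move=> j; exact: smooth_theta_ge0.
have := jackson_step_scaled e0 d1 d2 ih.
have nE : (n - 2 * i.+1).+2 = (n - 2 * i)%N by nlia.
rewrite nE => hj.
have hh x : -1 <= x <= 1 -> `|smooth_iter k f i (N / 2 + N / 2 * x) - u (N / 2 + N / 2 * x)|
    <= (4 * M) ^+ i * B / gam by move=> _; exact: hu.
apply: approx_le (approxD hj hh); rewrite /eps /= -/eps (exprS _ i) /smooth_theta /jackson_kappa.
by rewrite [leLHS](_ : _ = (4 * M) ^+ i * B * (gam^-1 + M * (4 * (jackson_const R (n - 2 * i) * (N / 2) ^+ 2)) * eps d i.+1)) //; ring.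
Qed.

End Recursion.

(** * The numerical bound, case by case in k *)

Section Numerics.
Variable R : realType.

Definition rescale_length k n : R := Num.max (n%:R / pi) (2 * k%:R + 1).
Definition jackson_total k n : R := whitney_end R k + extension_const R k *
  smooth_eps ('C(2 * k, k)%:R)^-1 (4^-1 ^+ k) (smooth_theta k n (rescale_length k n)) k 0.

Lemma rescale_length_ge0 k n : 0 <= rescale_length k n.
Proof.
rewrite /rescale_length le_max; apply/orP; right.
by rewrite addr_ge0 // mulr_ge0.
Qed.

Lemma rescale_length_le k n A : n%:R <= A -> (2 * k%:R + 1) * (16 / 5) <= A ->
  rescale_length k n * pi <= A.
Proof.
have pi0 : 0 < pi :> R := pi_gt0 R; have pi1 := pi_ub R.
move=> nA kA; rewrite -ler_pdivlMr // /rescale_length ge_max !ler_pdivlMr //.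
rewrite divfK ?gt_eqF // nA /=; apply: le_trans _ kA.
by rewrite ler_wpM2l // addr_ge0 // mulr_ge0.
Qed.

Lemma smooth_theta_le k n i A rho x0 c M' : (0 < k)%N ->
  n%:R <= A -> (2 * k%:R + 1) * (16 / 5) <= A ->
  A <= rho * (n - 2 * i).+2%:R -> 0 < x0 -> x0 <= (n - 2 * i).+1%:R ->
  rho ^+ 2 / 2 * (1 + 16 / 5 / x0) <= c -> smooth_norm R k <= M' ->
  smooth_theta k n (rescale_length k n) i <= M' * c.
Proof.
move=> k0 nA kA Arho x00 xm hc hM; have h := rescale_length_le nA kA.
have := jackson_kappa_le (rescale_length_ge0 k n) h Arho x00 xm hc.
move=> hk; rewrite /smooth_theta; apply: ler_pM => //; first exact: smooth_norm_ge0.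
by rewrite mulr_ge0 // jackson_kappa_ge0.
Qed.

Lemma smooth_norm_le_bin k (a b c : nat) : (0 < k)%N ->
  'C(2 * k, k) = a -> 'C(2 * k, k + 1) = b -> 'C(2 * k, k + 3) = c ->
  smooth_norm R k <= 2 * b%:R / a%:R + c%:R / (2 * a%:R).
Proof.
move=> k0 ea eb ec; have := smooth_norm_le R k0.
by rewrite /smooth_coef /side_bin ea eb ec expr1n mulr1.
Qed.

Lemma whitney_constsE k : [/\ whitney_end R 1 = 11 / 4, whitney_end R 2 = 11 / 4,
  whitney_inner R 1 = 11 / 4, whitney_inner R 2 = 71 / 20 & 
  whitney_end R k.+3 = 4 /\ whitney_inner R k.+3 = 4 / 5 * k.+3%:R + 39 / 10].
Proof. by split; rewrite ?whitney_endS ?whitney_innerS. Qed.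

Lemma jackson_total1 n : (5 <= n)%N -> jackson_total 1 n <= 99 / 10.
Proof.
move=> n5; have n5' : 5 <= n%:R :> R by rewrite ler_nat.
have hM : smooth_norm R 1 <= 1.
  by have := @smooth_norm_le_bin 1 2 1 0 isT erefl erefl erefl; lra.
have th : smooth_theta 1 n (rescale_length 1 n) 0 <= 1 * (29 / 20).
  have e2 : (n - 2 * 0).+2%:R = n%:R + 2 :> R by rewrite muln0 subn0 -addn2 natrD.
  have e1 : (n - 2 * 0).+1%:R = n%:R + 1 :> R by rewrite muln0 subn0 -addn1 natrD.
  have [n10|n10] := leqP 10 n.
    have n10' : 10 <= n%:R :> R by rewrite ler_nat.
    by apply: (@smooth_theta_le 1 n 0 n%:R 1 11) => //; rewrite ?e1 ?e2; lra.
  have n10' : n%:R <= 9 :> R by rewrite (ler_nat _ n 9).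
  (* For n <= 9 the scale is N = 3, hence A = 3 * 16/5, and n >= 5 makes the denominator n + 2 at
     least 7. *)
  by apply: (@smooth_theta_le 1 n 0 (48 / 5) (48 / 35) 6) => //; rewrite ?e1 ?e2; lra.
have [_ e1 _ e2 _] := whitney_constsE 0.
rewrite /jackson_total /extension_const /=.
rewrite (_ : 'C(2 * 1, 1) = 2%N) // invr1 expr1 (_ : (2 * 1)%N = 2%N) //.
rewrite (_ : whitney_end R 1 = 11 / 4) // (_ : whitney_inner R 1 = 11 / 4) //.
by move: (smooth_theta _ _ _ _) th => t; lra.
Qed.

Lemma jackson_total2 n : (13 <= n)%N -> jackson_total 2 n <= 99 / 10.
Proof.
move=> n13; have n13' : 13 <= n%:R :> R by rewrite ler_nat.
have hM : smooth_norm R 2 <= 4 / 3.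
  by have := @smooth_norm_le_bin 2 6 4 0 isT erefl erefl erefl; lra.
have e02 : (n - 2 * 0).+2%:R = n%:R + 2 :> R by rewrite muln0 subn0 -addn2 natrD.
have e01 : (n - 2 * 0).+1%:R = n%:R + 1 :> R by rewrite muln0 subn0 -addn1 natrD.
have e12 : (n - 2 * 1).+2%:R = n%:R :> R by congr _%:R; nlia.
have e11 : (n - 2 * 1).+1%:R = n%:R - 1 :> R.
  have -> : ((n - 2 * 1).+1 = n - 1)%N by nlia.
  by rewrite natrB //; nlia.
pose t i : R := if i == 0%N then 14 / 15 else 32 / 25.
have th i : (0 <= i < 0 + 2)%N -> smooth_theta 2 n (rescale_length 2 n) i <= t i.
  have e0 : t 0%N = 4 / 3 * (7 / 10) by rewrite /t /=; field.
  have e1 : t 1%N = 4 / 3 * (24 / 25) by rewrite /t /=; field.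
  have [n16|n16] := leqP 16 n.
    have n16' : 16 <= n%:R :> R by rewrite ler_nat.
    case: i => [|[|//]] _; rewrite ?e0 ?e1.
      by apply: (@smooth_theta_le 2 n 0 n%:R 1 16) => //; rewrite ?e01 ?e02; lra.
    by apply: (@smooth_theta_le 2 n 1 n%:R 1 15) => //; rewrite ?e11 ?e12; lra.
  (* Here N = 5, so N pi <= 16; the least n = 13 gives the denominators 15 and 13 at the two
     levels. *)
  have n15 : n%:R <= 15 :> R by rewrite (ler_nat _ n 15).
  case: i => [|[|//]] _; rewrite ?e0 ?e1.
    by apply: (@smooth_theta_le 2 n 0 16 (16 / 15) 14) => //; rewrite ?e01 ?e02; lra.
  by apply: (@smooth_theta_le 2 n 1 16 (16 / 13) 12) => //; rewrite ?e11 ?e12; lra.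
rewrite /jackson_total /extension_const.
rewrite (_ : 'C(2 * 2, 2) = 6%N) // (_ : (2 * 2)%N = 4%N) //.
have [_ W _ wi _] := whitney_constsE 0; rewrite W wi.
have := @smooth_eps_le R 6^-1 (4^-1 ^+ 2) _ t 2 0 _ _ (smooth_theta_ge0 (isT : (0 < 2)%N) n _) th.
move=> /(_ ltac:(by rewrite invr_ge0) ltac:(by rewrite exprn_ge0 // invr_ge0)).
have -> : smooth_eps 6^-1 (4^-1 ^+ 2) t 2 0 = 6^-1 + 14 / 15 * (6^-1 + 32 / 25 * 16^-1).
  by rewrite /= /t /=; field.
by move: (smooth_eps _ _ _ _ _) => e he; lra.
Qed.

Lemma jackson_total3 n : (31 <= n)%N -> jackson_total 3 n <= 99 / 10.
Proof.
move=> n31; have n31' : 31 <= n%:R :> R by rewrite ler_nat.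
have hM : smooth_norm R 3 <= 61 / 40.
  by have := @smooth_norm_le_bin 3 20 15 1 isT erefl erefl erefl; lra.
pose t i : R := if i == 0%N then 61 / 40 * (11 / 20) else 61 / 40 * (637 / 1000).
have th i : (0 <= i < 0 + 3)%N -> smooth_theta 3 n (rescale_length 3 n) i <= t i.
  case: (eqVneq i 0%N) => [-> _|i0 i3]; rewrite /t ?eqxx ?(negPf i0).
    have e02 : (n - 2 * 0).+2%:R = n%:R + 2 :> R by rewrite muln0 subn0 -addn2 natrD.
    have e01 : (n - 2 * 0).+1%:R = n%:R + 1 :> R by rewrite muln0 subn0 -addn1 natrD.
    by apply: (@smooth_theta_le 3 n 0 n%:R 1 32) => //; rewrite ?e01 ?e02; lra.
  have e2 : n%:R - 2 <= (n - 2 * i).+2%:R :> R.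
    by rewrite -natrB ?ler_nat; nlia.
  have e1 : 28 <= (n - 2 * i).+1%:R :> R by rewrite ler_nat; nlia.
  (* 31/29 is n / (n - 2) at the least n, for the deepest level i = 2. *)
  by apply: (@smooth_theta_le 3 n i n%:R (31 / 29) 28) => //; lra.
rewrite /jackson_total /extension_const.
rewrite (_ : 'C(2 * 3, 3) = 20%N) // (_ : (2 * 3)%N = 6%N) //.
have [_ _ _ _ [W wi]] := whitney_constsE 0; rewrite W wi.
have := @smooth_eps_le R 20^-1 (4^-1 ^+ 3) _ t 3 0 _ _ (smooth_theta_ge0 (isT : (0 < 3)%N) n _) th.
move=> /(_ ltac:(by rewrite invr_ge0) ltac:(by rewrite exprn_ge0 // invr_ge0)).
have h : smooth_eps 20^-1 (4^-1 ^+ 3) t 3 0 <= 3 / 20.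
  rewrite /= /t /= (_ : 4^-1 ^+ 3 = 1 / 64); last by field.
  lra.
by move: (smooth_eps _ _ _ _ _) h => e h h2; lra.
Qed.

Lemma jackson_total4 n : (57 <= n)%N -> jackson_total 4 n <= 99 / 10.
Proof.
move=> n57; have n57' : 57 <= n%:R :> R by rewrite ler_nat.
have hM : smooth_norm R 4 <= 5 / 3.
  by have := @smooth_norm_le_bin 4 70 56 8 isT erefl erefl erefl; lra.
pose t (i : nat) : R := 5 / 3 * (63 / 100).
have th i : (0 <= i < 0 + 4)%N -> smooth_theta 4 n (rescale_length 4 n) i <= t i.
  move=> i4; have e2 : n%:R - 4 <= (n - 2 * i).+2%:R :> R.
    by rewrite -natrB ?ler_nat; nlia.
  have e1 : 52 <= (n - 2 * i).+1%:R :> R by rewrite ler_nat; nlia.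
  by apply: (@smooth_theta_le 4 n i n%:R (57 / 53) 52) => //; lra.
rewrite /jackson_total /extension_const.
rewrite (_ : 'C(2 * 4, 4) = 70%N) // (_ : (2 * 4)%N = 8%N) //.
have [_ _ _ _ [W wi]] := whitney_constsE 1; rewrite W wi.
have := @smooth_eps_le R 70^-1 (4^-1 ^+ 4) _ t 4 0 _ _ (smooth_theta_ge0 (isT : (0 < 4)%N) n _) th.
move=> /(_ ltac:(by rewrite invr_ge0) ltac:(by rewrite exprn_ge0 // invr_ge0)).
have h : smooth_eps 70^-1 (4^-1 ^+ 4) t 4 0 <= 1 / 10.
  rewrite /= /t (_ : 4^-1 ^+ 4 = 1 / 256); last by field.
  lra.
by move: (smooth_eps _ _ _ _ _) h => e h h2; lra.
Qed.

Lemma center_bin_ratio k :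
  k.+1%:R * 'C(2 * k.+1, k.+1)%:R = 2 * (2 * k%:R + 1) * 'C(2 * k, k)%:R :> R.
Proof.
have h1 := mul_bin_diag (2 * k).+1 k.
have h2 := mul_bin_diag (2 * k).+2 k.
have e : 'C((2 * k).+1, k) = 'C((2 * k).+1, k.+1).
  have kl : (k.+1 <= (2 * k).+1)%N by lia.
  by rewrite -(bin_sub kl); congr 'C(_, _); lia.
have e2 : (2 * k.+1 = (2 * k).+2)%N by lia.
have E : (k.+1 * 'C(2 * k.+1, k.+1) = 2 * (2 * k).+1 * 'C(2 * k, k))%N.
  rewrite e2 -h2 /= e -mulnA h1 /=; lia.
have := congr1 (fun n => n%:R : R) E.
by rewrite !natrM -(natr1 (2 * k)) natrM.
Qed.

(** From k to k + 1 the quadratic factor at most doubles, while C(2k,k) grows by at least 3, so that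
    the other factor is at most multiplied by (3/2)(1/3). *)
Lemma jackson_total5_bound k : (5 <= k)%N ->
  (2 * k%:R * (4 / 5 * k%:R + 39 / 10) + 4) *
  ((3 / 2) ^+ k * (2 * ('C(2 * k, k)%:R)^-1 + 4^-1 ^+ k)) <= 57 / 10 :> R.
Proof.
move=> /subnK <-; elim: (k - 5)%N => [|d ih].
  rewrite add0n (_ : 'C(2 * 5, 5) = 252%N) //.
  by rewrite (_ : (3 / 2) ^+ 5 = 243 / 32); [rewrite (_ : 4^-1 ^+ 5 = 1 / 1024); [lra|field]|field].
rewrite addSn; move: ih; move: (d + 5)%N (leq_addl d 5) => {d}k k5 ih.
have K5 : 5 <= k%:R :> R by rewrite ler_nat.
have g0 : 0 < 'C(2 * k, k)%:R :> R by rewrite ltr0n bin_gt0; nlia.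
have g1 : 0 < 'C(2 * k.+1, k.+1)%:R :> R by rewrite ltr0n bin_gt0; nlia.
have hr : ('C(2 * k.+1, k.+1)%:R)^-1 <= ('C(2 * k, k)%:R)^-1 / 3 :> R.
  rewrite -invfM lef_pV2 ?posrE ?mulr_gt0 // mulrC.
  have := center_bin_ratio k; rewrite -natr1.
  by move: ('C(_, _)%:R) ('C(_, _)%:R) g0 g1 => a b a0 b0 e; nra.
apply: le_trans ih; rewrite !exprS -(natr1 k).
set a := 'C(2 * k.+1, k.+1)%:R^-1 in hr *; set b := 'C(2 * k, k)%:R^-1 in hr *.
have a0 : 0 <= a by rewrite invr_ge0 ltW.
have b0 : 0 <= b by rewrite invr_ge0 ltW.
set u := (3 / 2) ^+ k; set v := 4^-1 ^+ k.
have u0 : 0 <= u by rewrite exprn_ge0.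
have v0 : 0 <= v by rewrite exprn_ge0 // invr_ge0.
move: (k%:R : R) K5 => K K5.
have h1 : 2 * (K + 1) * (4 / 5 * (K + 1) + 39 / 10) + 4 <=
   2 * (2 * K * (4 / 5 * K + 39 / 10) + 4) by nra.
have h2 : 2 * a + 4^-1 * v <= 1 / 3 * (2 * b + v) by lra.
have h3 : 3 / 2 * u * (2 * a + 4^-1 * v) <= 1 / 2 * (u * (2 * b + v)).
  by have := ler_wpM2l u0 h2; lra.
apply: (@le_trans _ _ (2 * (2 * K * (4 / 5 * K + 39 / 10) + 4) *
   (1 / 2 * (u * (2 * b + v))))); last first.
  by rewrite le_eqVlt; apply/orP; left; apply/eqP; field.
have p0 : 0 <= 2 * (K + 1) * (4 / 5 * (K + 1) + 39 / 10) by rewrite !mulr_ge0 //; lra.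
have q0 : 0 <= 3 / 2 * u * (2 * a + 4^-1 * v).
  by rewrite mulr_ge0 // ?mulr_ge0 //; lra.
apply: ler_pM; [lra|exact: q0|exact: h1|exact: h3].
Qed.

Lemma jackson_total5 k n : (5 <= k)%N -> (2 * k * (2 * k - 1) < n)%N ->
  jackson_total k n <= 99 / 10.
Proof.
move=> k5 kn; have k0 : (0 < k)%N by lia.
have K5 : 5 <= k%:R :> R by rewrite ler_nat.
have g0 : 0 < 'C(2 * k, k)%:R :> R := center_gt0 R k0.
have sb j : side_bin R k j <= 'C(2 * k, k)%:R.
  by have := side_bin_le R k0 (leq0n j); rewrite {2}/side_bin addn0.
have hM : smooth_norm R k <= 5 / 2.
  apply: le_trans (smooth_norm_le R k0) _.
  rewrite /smooth_coef expr1n mulr1.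
  have h1 : 2 * side_bin R k 1 / 'C(2 * k, k)%:R <= 2.
    by rewrite ler_pdivrMr // ler_wpM2l.
  have h3 : side_bin R k 3 / (2 * 'C(2 * k, k)%:R) <= 1 / 2.
    by rewrite ler_pdivrMr ?mulr_gt0 //; have := sb 3; lra.
  by lra.
have th i : (0 <= i < 0 + k)%N -> smooth_theta k n (rescale_length k n) i <= 3 / 2.
  (* The extremal data are k = 5, n = 91, i = 4, where n - 2i + 2 = 85 and n - 2i + 1 = 84. *)
  move=> ik; rewrite (_ : 3 / 2 = 5 / 2 * (3 / 5)); last by field.
  have n1 : (85 * n <= 91 * (n - 2 * i).+2)%N.
    have [t kt] : exists t, k = (t + 5)%N by exists (k - 5)%N; nlia.
    by move: kn ik; rewrite kt; clear; nia.
  have n2 : (84 <= (n - 2 * i).+1)%N.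
    have [t kt] : exists t, k = (t + 5)%N by exists (k - 5)%N; nlia.
    by move: kn ik; rewrite kt; clear; nia.
  have n3 : (16 * (2 * k + 1) <= 5 * n)%N by clear -kn k5; nia.
  have n1' : 85 * n%:R <= 91 * (n - 2 * i).+2%:R :> R by rewrite -!natrM ler_nat.
  have n3' : 16 * (2 * k%:R + 1) <= 5 * n%:R :> R.
    by have := n3; rewrite -(ler_nat R) !natrM natrD natrM.
  apply: (@smooth_theta_le k n i n%:R (91 / 85) 84) => //; try lra.
  by rewrite ler_nat.
rewrite /jackson_total.
have := @smooth_eps_le R ('C(2 * k, k)%:R)^-1 (4^-1 ^+ k) _ (fun=> 3 / 2) k 0 _ _
  (smooth_theta_ge0 k0 n _) th.
have i0 : 0 <= ('C(2 * k, k)%:R)^-1 :> R by rewrite invr_ge0 ltW.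
have v0 : 0 <= 4^-1 ^+ k :> R by rewrite exprn_ge0 // invr_ge0.
move=> /(_ i0 v0) h; have := jackson_total5_bound k5.
have := smooth_eps_geom (4^-1 ^+ k) k 0 i0.
have e20 := smooth_eps_ge0 k 0 i0 v0 (smooth_theta_ge0 k0 n (rescale_length k n)).
move=> h2 h3; move: h e20; move: (smooth_eps _ _ (smooth_theta _ _ _) _ _) => e2 h1 e20.
have -> : whitney_end R k = 4.
  by case: k k5 {k0 kn K5 g0 sb hM th i0 v0 e20 h1 h2 h3} => [|[|[|m]]] // _; rewrite whitney_endS.
have hB : extension_const R k <= 2 * k%:R * (4 / 5 * k%:R + 39 / 10) + 4.
  have -> : extension_const R k = ((2 * k)%:R - 1 + k%:R^-1) * (4 / 5 * k%:R + 39 / 10) + 4.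
    rewrite /extension_const.
    by case: k k5 {k0 kn K5 g0 sb hM th i0 v0 e20 h1 h2 h3} => [|[|[|m]]] // _;
      rewrite whitney_endS whitney_innerS.
  rewrite lerD2r ler_wpM2r ?addr_ge0 ?mulr_ge0 // natrM.
  have : k%:R^-1 <= 1 :> R by rewrite invf_le1 ?ltr0n // ler1n.
  by lra.
have hB0 : 0 <= 2 * k%:R * (4 / 5 * k%:R + 39 / 10) + 4 :> R.
  by rewrite !addr_ge0 // !mulr_ge0 // addr_ge0 // mulr_ge0.
have : extension_const R k * e2 <= 57 / 10.
  apply: le_trans h3; apply: (le_trans (ler_wpM2r e20 hB)); rewrite ler_wpM2l //.
  by apply: le_trans h1 _; apply: le_trans h2 _; rewrite gerBl mulr_ge0.
by lra.
Qed.

Lemma jackson_total_le k n : (0 < k)%N -> (2 * k * (2 * k - 1) < n)%N ->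
  (5 <= n)%N -> jackson_total k n <= 99 / 10.
Proof.
case: k => [//|[|[|[|[|k]]]]] _ kn n5.
- exact: jackson_total1.
- exact: jackson_total2.
- exact: jackson_total3.
- exact: jackson_total4.
exact: jackson_total5.
Qed.

End Numerics.

(** * The constant *)

Section Moduli.
Variable R : realType.
Implicit Types f : R -> R.

Lemma sup_ge0 (E : set R) : (forall y, E y -> 0 <= y) -> 0 <= sup E.
Proof.
move=> h; have [hs|hs] := pselect (has_sup E); last by rewrite sup_out.
by have [[y Ey] _] := hs; apply: le_trans (h y Ey) (sup_upper_bound hs Ey).
Qed.

Lemma best_approx_ge0 m f : 0 <= best_approx m f.
Proof.
apply: lb_le_inf.
  by exists (approx_error f 0); exists 0 => //=; rewrite size_poly0.
by move=> _ [p _ <-]; apply: sup_ge0 => _ [x _ <-].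
Qed.

Lemma best_approx_le m f e : approx m e f -> best_approx m f <= e.
Proof.
move=> [p [sp hp]]; apply: (@le_trans _ _ (approx_error f p)).
  apply: ge_inf; last by exists p.
  by exists 0 => _ [q _ <-]; apply: sup_ge0 => _ [x _ <-].
apply: ge_sup; first by exists `|f 0 - p.[0]|, 0 => //=; rewrite in_itv /=; lra.
by move=> _ [x hx <-]; apply: hp; move: hx; rewrite /= in_itv.
Qed.

(** Composition with it makes f continuous on the whole line and leaves it unchanged on [-1,1]. *)
Definition clamp (x : R) : R := Num.max (- 1) (Num.min x 1).

Lemma clamp_itv x : -1 <= clamp x <= 1.
Proof.
rewrite /clamp le_max lexx /= ge_max (_ : -1 <= 1) /=; last by lra.
by rewrite ge_min lexx orbT.
Qed.

Lemma clamp_id x : -1 <= x <= 1 -> clamp x = x.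
Proof. by move=> /andP[x1 x2]; rewrite /clamp (min_idPl x2) (max_idPr x1). Qed.

Lemma continuous_clamp : continuous clamp.
Proof.
have h (a b x : R) : {for x, continuous (fun y => Num.max a (Num.min y b))}.
  apply: (@continuous_max _ _ (fun=> a) (fun y => Num.min y b)).
    exact: cst_continuous.
  by apply: continuous_min; [exact: cvg_id|exact: cst_continuous].
exact: h.
Qed.

Lemma continuous_comp_clamp f : {within `[-1, 1], continuous f} ->
  continuous (fun x => f (clamp x)).
Proof.
move=> /subspace_continuousP cf x.
have cx : `[-1, 1]%classic (clamp x) by rewrite /= in_itv /=; exact: clamp_itv.
apply: (@cvg_comp _ _ _ clamp f _ (within `[-1, 1]%classic (nbhs (clamp x)))).
  move=> P hP; have h := @continuous_clamp x _ hP.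
  apply: (@filterS _ (nbhs x) _ _ _ _ h) => y; apply.
  by rewrite /= in_itv /=; exact: clamp_itv.
exact: cf.
Qed.

Lemma continuous_affine (a b x : R) : {for x, continuous (fun y => a + b * y)}.
Proof.
apply: (@continuousD _ _ _ (fun=> a) (fun y => b * y)); first exact: cst_continuous.
by apply: (@continuousM _ _ (fun=> b) (fun y => y)); [exact: cst_continuous|exact: cvg_id].
Qed.

Lemma bounded_continuous f : {within `[-1, 1], continuous f} ->
  exists B, forall x, -1 <= x <= 1 -> `|f x| <= B.
Proof.
move=> cf; have cc := continuous_comp_clamp cf.
have cn : continuous (fun x => `|f (clamp x)|).
  by move=> x; apply: (continuous_comp (cc x)); exact: norm_continuous.
have [||c _ hc] := @EVT_max R (fun x => `|f (clamp x)|) (-1) 1.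
- by lra.
- exact: continuous_subspaceT.
exists `|f (clamp c)| => x hx; rewrite -{1}(clamp_id hx); apply: hc.
by rewrite in_itv.
Qed.

Lemma central_diff_fdiff k h f x : central_diff (2 * k) h f x =
  fdiff (2 * k) h f (x - (2 * k)%:R * h / 2).
Proof.
apply: eq_bigr => j _; have jk : (j <= 2 * k)%N by rewrite -ltnS.
congr (_ * _ * f _); last by ring.
by rewrite -signr_odd oddB // oddM /= signr_odd.
Qed.

Lemma omega_ge0 r f d : 0 <= omega r f d.
Proof. by apply: sup_ge0 => y [h [x [_ _ _ ->]]]. Qed.

Lemma omega_ub r f d (h x : R) : {within `[-1, 1], continuous f} ->
  0 < h <= d -> -1 <= x - r%:R * h / 2 <= 1 -> -1 <= x + r%:R * h / 2 <= 1 ->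
  `|central_diff r h f x| <= omega r f d.
Proof.
move=> cf hd hl hr; have [B hB] := bounded_continuous cf.
apply: ub_le_sup; last by exists h, x.
exists (\sum_(j < r.+1) 'C(r, j)%:R * B) => _ [h' [x' [/andP[h0 _] hl' hr' ->]]].
apply: le_trans (ler_norm_sum _ _ _) _; apply: ler_sum => j _.
rewrite 2!normrM normrX normrN1 expr1n mul1r normr_nat ler_wpM2l // hB //.
have jr : j%:R * h' <= r%:R * h' by rewrite ler_wpM2r ?(ltW h0) // ler_nat -ltnS.
have j0 : 0 <= j%:R * h' by rewrite mulr_ge0 // (ltW h0).
by lra.
Qed.

Lemma fdiff_le_omega k f d (s x : R) : {within `[-1, 1], continuous f} -> (0 < k)%N ->
  0 <= s <= d -> -1 <= x -> x + (2 * k)%:R * s <= 1 ->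
  `|fdiff (2 * k) s f x| <= omega (2 * k) f d.
Proof.
(* The modulus admits only positive steps; for s = 0 the difference is that of a constant. *)
move=> cf k0 /andP[s0 sd] x1 x2; move: s0; rewrite le_eqVlt => /predU1P[s0|s0].
  have -> : fdiff (2 * k) s f x = fdiff (2 * k) s (fun y => (f x)%:P.[y]) x.
    by apply: eq_fdiff => i _; rewrite -s0 mulr0 addr0 hornerC.
  rewrite fdiff_poly ?normr0 ?omega_ge0 //.
  by rewrite (leq_trans (size_polyC_leq1 _)) //; lia.
have rs : 0 <= (2 * k)%:R * s by rewrite mulr_ge0 // ltW.
have := @omega_ub (2 * k) f d s (x + (2 * k)%:R * s / 2) cf.
rewrite central_diff_fdiff addrK; apply; rewrite ?s0 //; lra.
Qed.

Lemma approx_omega k n f d : (0 < k)%N -> (2 * k * (2 * k - 1) < n)%N -> (5 <= n)%N ->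
  2 * pi / n%:R <= d -> {within `[-1, 1], continuous f} ->
  approx n (99 / 10 * omega (2 * k) f d) f.
Proof.
move=> k0 kn n5 hd cf; set w := omega _ _ _; have w0 : 0 <= w := omega_ge0 _ _ _.
have pi0 : 0 < pi :> R := pi_gt0 R.
set N := rescale_length R k n.
have n0 : 0 < n%:R :> R by rewrite ltr0n; lia.
have hN1 : n%:R / pi <= N by rewrite /N /rescale_length le_max lexx.
have hN2 : (2 * k)%:R + 1 <= N by rewrite /N /rescale_length natrM le_max lexx orbT.
have N0 : 0 < N by rewrite (lt_le_trans _ hN1) // divr_gt0.
(* A unit step on [0, N] is a step 2 / N on [-1,1], and N >= n / pi. *)
have Nd : 2 / N <= d.
  apply: le_trans hd; rewrite ler_pdivrMr //.
  have c0 : 0 <= 2 * pi / n%:R :> R by rewrite divr_ge0 // mulr_ge0 // ltW.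
  apply: le_trans (ler_wpM2l c0 hN1).
  have pn : pi != 0 :> R by rewrite gt_eqF.
  have nn : n%:R != 0 :> R by rewrite gt_eqF.
  rewrite (_ : 2 * pi / n%:R * (n%:R / pi) = 2) //.
  by move: (pi : R) (n%:R : R) pn nn => p m pn nn; field; rewrite pn nn.
pose F y := f (clamp (-1 + 2 / N * y)).
have cF : continuous F.
  move=> y; apply: (@continuous_comp _ _ _ (fun y => -1 + 2 / N * y) (fun x => f (clamp x))).
    exact: continuous_affine.
  exact: continuous_comp_clamp.
have hF x s : 0 <= x -> 0 <= s <= 1 -> x + (2 * k)%:R * s <= N ->
    `|fdiff (2 * k) s F x| <= w.
  move=> x0 /andP[s0 s1] xs.
  have n2 : 0 <= 2 / N by rewrite divr_ge0 // ltW.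
  have -> : fdiff (2 * k) s F x = fdiff (2 * k) (2 / N * s) f (-1 + 2 / N * x).
    apply: eq_bigr => i _; congr (_ * _); rewrite /F clamp_id; last first.
      have i0 : 0 <= i%:R * s by rewrite mulr_ge0.
      have ir : i%:R * s <= (2 * k)%:R * s by rewrite ler_wpM2r // ler_nat -ltnS.
      have h1 : 0 <= 2 / N * (x + i%:R * s) by rewrite mulr_ge0 // addr_ge0.
      have h2 : 2 / N * (x + i%:R * s) <= 2 / N * N by rewrite ler_wpM2l //; lra.
      by move: h2; rewrite divfK ?gt_eqF //; lra.
    by congr f; ring.
  apply: fdiff_le_omega => //.
  - rewrite mulr_ge0 //= (le_trans _ Nd) // -[leRHS]mulr1; exact: ler_wpM2l.
  - by rewrite lerDl mulr_ge0.
  have h2 : 2 / N * (x + (2 * k)%:R * s) <= 2 / N * N by rewrite ler_wpM2l.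
  by move: h2; rewrite divfK ?gt_eqF // mulrDr mulrCA; lra.
have [f1 [cf1 h1 h2]] := extension k0 cF hN2 hF.
have kn2 : (2 * k <= n)%N by apply: leq_trans (ltnW kn); rewrite leq_pmulr //; nlia.
have B0 : 0 <= w * extension_const R k.
  by apply: le_trans (normr_ge0 _) (h2 0 0 _); rewrite lexx ler01.
have h := smooth_approx k0 N kn2 B0 cf1 h2.
have hf x : -1 <= x <= 1 -> `|f x - f1 (N / 2 + N / 2 * x)| <= w * whitney_end R k.
  move=> hx; have -> : f x = F (N / 2 + N / 2 * x).
    rewrite /F; have -> : -1 + 2 / N * (N / 2 + N / 2 * x) = x by field; rewrite gt_eqF.
    by rewrite clamp_id.
  by apply: h1; move: hx => /andP[x1 x2]; apply/andP; split; nra.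
apply: approx_le (approxD h hf).
rewrite -mulrA -mulrDr mulrC ler_wpM2r //; exact: jackson_total_le.
Qed.

Lemma fdiff2 (s : R) f x : fdiff 2 s f x = f x - 2 * f (x + s) + f (x + 2%:R * s).
Proof.
rewrite !fdiffS fdiff0 (_ : x + s + s = x + 2%:R * s); last by ring.
by ring.
Qed.

(** Let c maximise |g|, g being f minus its chord. The second difference centred at c with one node
    at the nearer end, where g = 0, gives 2 |g c| <= |g c| + omega; its step is at most 1. *)
Lemma approx_chord f d : 1 <= d -> {within `[-1, 1], continuous f} ->
  approx 1 (omega 2 f d) f.
Proof.
move=> d1 cf; pose m := (f 1 + f (-1)) / 2; pose s := (f 1 - f (-1)) / 2.
pose p : {poly R} := m%:P + s *: 'X.
have pE x : p.[x] = m + s * x by rewrite /p hornerD hornerC hornerZ hornerX.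
pose g x := f x - p.[x].
have g1 : g 1 = 0 by rewrite /g pE /m /s; field.
have gN1 : g (-1) = 0 by rewrite /g pE /m /s; field.
have hg h x : 0 <= h <= d -> -1 <= x -> x + 2%:R * h <= 1 ->
    `|g x - 2 * g (x + h) + g (x + 2%:R * h)| <= omega 2 f d.
  move=> hd x1 x2; have := @fdiff_le_omega 1 f d h x cf isT hd x1 x2.
  rewrite fdiff2; set L := (X in `|X| <= _); rewrite (_ : L = g x - 2 * g (x + h) + g (x + 2%:R * h)) //.
  by rewrite /L /g !pE; ring.
exists p; split.
  rewrite (leq_trans (size_polyD _ _)) // geq_max.
  rewrite (leq_trans (size_polyC_leq1 _)) // (leq_trans (size_scale_leq _ _)) //.
  by rewrite size_polyX.
have cn : continuous (fun x => `|g (clamp x)|).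
  have cc : continuous (fun x => f (clamp x)) := continuous_comp_clamp cf.
  have cp : continuous (fun x => p.[clamp x]).
    move=> x; apply: (continuous_comp (@continuous_clamp x)); exact: continuous_horner.
  move=> x; apply: (@continuous_comp _ _ _ (fun x => g (clamp x)) (fun y => `|y|)).
    by apply: (@continuousB _ _ _ (fun x => f (clamp x)) (fun x => p.[clamp x])); [exact: cc|exact: cp].
  exact: norm_continuous.
have [||c hc gc] := @EVT_max R (fun x => `|g (clamp x)|) (-1) 1.
- by lra.
- exact: continuous_subspaceT.
have /andP[c1 c2] : -1 <= c <= 1 by move: hc; rewrite in_itv.
have gmax x : -1 <= x <= 1 -> `|g x| <= `|g c|.
  by move=> hx; have := gc x; rewrite in_itv /= !clamp_id // ?c1 //; apply.
have key (a w : R) : `|a| <= `|g c| -> `|a - 2 * g c| <= w -> `|g c| <= w.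
  move=> ha hw; have : `|2 * g c| <= `|a| + `|a - 2 * g c|.
    by rewrite -{1}(subKr a (2 * g c)) ler_normB.
  by rewrite normrM ger0_norm //; lra.
move=> x hx; apply: le_trans (gmax x hx) _; have [c0|c0] := leP 0 c.
  apply: (key (g (c - (1 - c)))); first by apply: gmax; lra.
  have := @hg (1 - c) (c - (1 - c)).
  have -> : c - (1 - c) + (1 - c) = c by ring.
  have -> : c - (1 - c) + 2%:R * (1 - c) = 1 by ring.
  by rewrite g1 addr0; apply; lra.
apply: (key (g (-1 + 2%:R * (1 + c)))); first by apply: gmax; lra.
have := @hg (1 + c) (-1).
have -> : -1 + (1 + c) = c by ring.
by rewrite gN1 sub0r (addrC (- (2 * g c))); apply; lra.
Qed.

(** A function with positive modulus forces every admissible constant to be nonnegative, so the set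
    of constants is bounded below. The ramp on [1 - h, 1] is seen by the last node of the stencil
    only. *)
Lemma omega_gt0_witness k d : (0 < k)%N -> 0 < d ->
  exists f : R -> R, {within `[-1, 1], continuous f} /\ 0 < omega (2 * k) f d.
Proof.
move=> k0 d0; have K0 : 0 < k%:R :> R by rewrite ltr0n.
pose h := Num.min d k%:R^-1.
have h0 : 0 < h by rewrite /h lt_min d0 invr_gt0.
pose f (y : R) := Num.max 0 (y - (1 - h)).
have cf : {within `[-1, 1], continuous f}.
  apply: continuous_subspaceT => y.
  apply: (@continuous_max _ _ (fun=> 0) (fun y => y - (1 - h))); first exact: cst_continuous.
  by apply: (@continuousB _ _ _ (fun y => y) (fun=> 1 - h)); [exact: cvg_id|exact: cst_continuous].
exists f; split => //; apply: (lt_le_trans h0).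
have hd : 0 <= h <= d by rewrite (ltW h0) /h ge_min lexx.
have kh : k%:R * h <= 1.
  by rewrite -ler_pdivlMl // mulr1 /h ge_min lexx orbT.
have x1 : -1 <= 1 - (2 * k)%:R * h by rewrite natrM -mulrA; lra.
have x2 : 1 - (2 * k)%:R * h + (2 * k)%:R * h <= 1 by rewrite subrK.
apply: le_trans (fdiff_le_omega cf k0 hd x1 x2).
rewrite /fdiff big_ord_recr /= binn mulr1 exprM sqrrN expr1n expr1n mul1r subrK big1.
  rewrite add0r /f (_ : 1 - (1 - h) = h); last by ring.
  by rewrite (max_idPr (ltW h0)) ger0_norm // ltW.
move=> i _; rewrite /f (max_idPl _) ?mulr0 //.
have ih : (i.+1)%:R * h <= (2 * k)%:R * h by rewrite ler_wpM2r ?(ltW h0) // ler_nat.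
by rewrite -natr1 mulrDl mul1r in ih; lra.
Qed.

Lemma jackson_constants_99_10 k alpha : (0 < k)%N -> 2 <= alpha ->
  jackson_constants k alpha (99 / 10 : R).
Proof.
move=> k0 ha f cf n kn; apply: best_approx_le.
have pi0 : 0 < pi :> R := pi_gt0 R; have pi2 := pi_ge2 R.
have n0 : 0 < n%:R :> R by rewrite ltr0n (leq_ltn_trans _ kn).
have hd : 2 * pi / n%:R <= alpha * pi / n%:R.
  by rewrite -!mulrA ler_wpM2r // mulr_ge0 ?invr_ge0 ?(ltW pi0) // ltW.
have [n5|n4] := leqP 5 n; first exact: approx_omega.
(* For k >= 2 the hypothesis already gives n > 12. *)
have k1 : k = 1%N.
  apply/eqP; rewrite eqn_leq k0 andbT leqNgt; apply/negP => k2.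
  have : (4 * 3 <= 2 * k * (2 * k - 1))%N by apply: leq_mul; nlia.
  by nlia.
rewrite k1 in kn *; have d1 : 1 <= alpha * pi / n%:R.
  apply: le_trans hd; rewrite ler_pdivlMr // mul1r.
  have : n%:R <= 4 :> R by rewrite (ler_nat _ n 4).
  by lra.
have [p [sp hp]] := approx_chord d1 cf; exists p; split.
  by rewrite (leq_trans sp) // ltnS; nlia.
move=> x /hp /le_trans; apply; have := omega_ge0 2 f (alpha * pi / n%:R).
by rewrite muln1; lra.
Qed.

End Moduli.

Unset Implicit Arguments.

Theorem mainTheorem1 (R : realType) (k : nat) (alpha : R)
    (hk : (1 <= k)%N) (halpha : 2 <= alpha) :
  exists J : R, is_Ja k alpha J /\ J < 10.
Proof.
have h99 := jackson_constants_99_10 hk halpha.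
have lb0 : lbound (jackson_constants k alpha) 0.
  move=> J hJ; pose n := (2 * k * (2 * k - 1)).+1.
  have d0 : 0 < alpha * pi / n%:R.
    by rewrite divr_gt0 ?ltr0n // mulr_gt0 ?pi_gt0 // (lt_le_trans _ halpha).
  have [f [cf w0]] := omega_gt0_witness hk d0.
  have := le_trans (best_approx_ge0 n f) (hJ f cf n (ltnSn _)).
  by rewrite pmulr_lge0.
have hlb : has_lbound (jackson_constants k alpha) by exists 0.
exists (inf (jackson_constants k alpha)); split; last first.
  by apply: le_lt_trans (ge_inf hlb h99) _; lra.
split; last by move=> J; exact: ge_inf.
move=> f cf n kn; set w := omega _ _ _.
have : 0 <= w by exact: omega_ge0.
rewrite le_eqVlt => /predU1P[w0|w0].
  (* Division by the modulus is impossible here, but the constant 99/10 already bounds the best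
     approximation by 0. *)
  by have := h99 f cf n kn; rewrite -/w -w0 !mulr0.
rewrite -ler_pdivrMr //; apply: lb_le_inf; first by exists (99 / 10).
by move=> J hJ; rewrite ler_pdivrMr //; exact: hJ.
Qed.
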